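(* Let $X$ be a $CAT(\kappa)$ space. Then there is a canonically defined isometric embedding $i:X\to Y\times H$, where $Y$ is a geodesic metric space and $H$ is a Hilbert space. Every affine function $f:X\to\mathbb{R}$ factors as $f=\hat f\circ p_H\circ i$, where $p_H$ is the projection onto $H$ and $\hat f:H\to\mathbb{R}$ is an affine function. Moreover, each isometry of $X$ determines an isometry of $Y$ and of $H$. Finally, the completion of $Y$ is $CAT(0)$ if $X$ is $CAT(0)$.
   Context: A geodesic in a metric space is a length-minimizing curve parametrized proportionally to arclength. A metric space is geodesic if every pair of points is connected by a geodesic. A $CAT(\kappa)$ space is a complete geodesic metric space in which triangles are not thicker than in the space of constant curvature $\kappa$. A Lipschitz map $f:X\to Z$ between geodesic metric spaces is called affine if it maps each geodesic to a geodesic parametrized proportionally to arclength; in the case $Z=\mathbb{R}$, $f$ is called an affine function. The product $Y\times H$ carries the product metric $d((y,h),(y',h'))=\sqrt{d(y,y')^2+\|h-h'\|^2}$, and an isometric embedding is a distance-preserving map (not necessarily onto). *)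

(* Defs.v *)
From HB Require Import structures.
From mathcomp Require Import all_boot all_order all_algebra.
From mathcomp Require Import all_classical all_reals all_analysis.

Set Implicit Arguments.
Unset Strict Implicit.
Unset Printing Implicit Defensive.
Import Order.TTheory GRing.Theory Num.Theory.
Import numFieldNormedType.Exports.
Local Open Scope classical_set_scope.
Local Open Scope ring_scope.

HB.mixin Record CompleteNormedModule_isHilbert (R : realType) H
    & CompleteNormedModule R H & Metric R H := {
  hdot : H -> H -> R ;
  hdot_linear : forall (a : R) (x y z : H),
    hdot (a *: x + y) z = a * hdot x z + hdot y z ;
  hdotC : forall x y : H, hdot x y = hdot y x ;
  hdot_norm : forall x : H, hdot x x = `|x| ^+ 2 ;
  mdist_norm : forall x y : H, mdist x y = `|x - y|
}.

#[short(type="hilbertType")]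
HB.structure Definition Hilbert (R : realType) :=
  { H of CompleteNormedModule R H & Metric R H
       & CompleteNormedModule_isHilbert R H }.

Section MetricGeometry.
Variable R : realType.

(* The completeType of the library is pointed; a metricType may be empty. *)
Definition complete_space (X : metricType R) :=
  forall F : set_system X, ProperFilter F -> cauchy F ->
    exists x : X, F --> x.

Definition isometric_embedding (X Y : metricType R) (f : X -> Y) :=
  forall x x', mdist (f x) (f x') = mdist x x'.

Definition is_isometry (X Y : metricType R) (f : X -> Y) :=
  isometric_embedding f /\ bijective f.

Definition curve_length (X : metricType R) (c : R -> X) (a b : R) : \bar R :=
  ereal_sup
    [set (\sum_(0 <= k < size s)
            mdist (c (nth b (a :: s) k)) (c (nth b (a :: s) k.+1)))%:E
    | s in itv_partition a b].

(* Continuity of c on [a, b] is implied: the length condition makes c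
   l-Lipschitz there. The speed l may be 0, so constant curves are geodesics. *)
Definition is_geodesic (X : metricType R) (a b : R) (c : R -> X) :=
  [/\ a <= b,
      curve_length c a b = (mdist (c a) (c b))%:E
    & exists2 l : R, 0 <= l &
        forall s t, a <= s -> s <= t -> t <= b ->
          curve_length c s t = (l * (t - s))%:E].

Definition geodesic_from_to (X : metricType R) (x y : X) (c : R -> X) :=
  [/\ is_geodesic 0 1 c, c 0 = x & c 1 = y].

Definition geodesic_space (X : metricType R) :=
  forall x y : X, exists c, geodesic_from_to x y c.

Definition is_affine (X Z : metricType R) (f : X -> Z) :=
  (exists k : R, forall x x', mdist (f x) (f x') <= k * mdist x x') /\
  (forall a b (c : R -> X), is_geodesic a b c -> is_geodesic a b (f \o c)).

(* The model surface of curvature kappa inside R^3: the unit sphere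
   (kappa > 0) and the upper sheet of the unit hyperboloid (kappa < 0), with
   distances rescaled by 1 / sqrt |kappa|, and the plane z = 0 (kappa = 0). *)

Definition dot3 (e : R) (u v : 'rV[R]_3) : R :=
  u 0 0 * v 0 0 + u 0 1 * v 0 1 + e * (u 0 (2 : 'I_3) * v 0 (2 : 'I_3)).

Definition arcosh (x : R) : R := ln (x + Num.sqrt (x ^+ 2 - 1)).

Definition model_space (kappa : R) : set 'rV[R]_3 :=
  [set u | if 0 < kappa then dot3 1 u u = 1
           else if kappa < 0 then dot3 (-1) u u = -1 /\ 0 < u 0 (2 : 'I_3)
           else u 0 (2 : 'I_3) = 0].

Definition model_dist (kappa : R) (u v : 'rV[R]_3) : R :=
  if 0 < kappa then acos (dot3 1 u v) / Num.sqrt kappa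
  else if kappa < 0 then arcosh (- dot3 (-1) u v) / Num.sqrt (- kappa)
  else Num.sqrt (dot3 1 (u - v) (u - v)).

(* The side i of a triangle joins v i to v (ordS i). *)
Definition geodesic_triangle (X : metricType R)
    (v : 'I_3 -> X) (c : 'I_3 -> R -> X) :=
  forall i, geodesic_from_to (v i) (v (ordS i)) (c i).

Definition comparison_triangle (kappa : R) (X : metricType R)
    (v : 'I_3 -> X) (w : 'I_3 -> 'rV[R]_3) :=
  forall i, model_space kappa (w i) /\
    model_dist kappa (w i) (w (ordS i)) = mdist (v i) (v (ordS i)).

(* When x lies on the side i, the two equations force p onto the segment
   from w i to w (ordS i). *)
Definition comparison_point (kappa : R) (X : metricType R)
    (v : 'I_3 -> X) (w : 'I_3 -> 'rV[R]_3) (i : 'I_3) (x : X)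
    (p : 'rV[R]_3) :=
  [/\ model_space kappa p,
      model_dist kappa (w i) p = mdist (v i) x
    & model_dist kappa p (w (ordS i)) = mdist x (v (ordS i))].

(* For kappa > 0 only triangles of perimeter < 2 * pi / sqrt kappa are
   compared. Comparison triangles and comparison points then exist, and are
   unique up to isometries of the model surface. *)
Definition thin_triangles (kappa : R) (X : metricType R) :=
  forall (v : 'I_3 -> X) (c : 'I_3 -> R -> X) (w : 'I_3 -> 'rV[R]_3),
    geodesic_triangle v c ->
    (0 < kappa ->
       \sum_(i < 3) mdist (v i) (v (ordS i)) < 2 * pi / Num.sqrt kappa) ->
    comparison_triangle kappa v w ->
    forall (i j : 'I_3) (s t : R) (p q : 'rV[R]_3),
      0 <= s <= 1 -> 0 <= t <= 1 ->
      comparison_point kappa v w i (c i s) p ->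
      comparison_point kappa v w j (c j t) q ->
      mdist (c i s) (c j t) <= model_dist kappa p q.

Definition cat_space (kappa : R) (X : metricType R) :=
  [/\ complete_space X, geodesic_space X & thin_triangles kappa X].

Definition is_completion (Y Z : metricType R) (j : Y -> Z) :=
  [/\ complete_space Z, isometric_embedding j & dense (range j)].

(* The library metric on products is the sup metric, hence a separate
   definition for the l^2 product. *)
Definition prod_dist (Y H : metricType R) (p q : Y * H) : R :=
  Num.sqrt (mdist p.1 q.1 ^+ 2 + mdist p.2 q.2 ^+ 2).

Record hilbert_product_map (X : metricType R) := HilbertProductMap {
  Yfactor : metricType R ;
  Hfactor : hilbertType R ;
  embed : X -> Yfactor * Hfactor
}.

Definition induces (X X' : metricType R)
    (S : hilbert_product_map X) (S' : hilbert_product_map X') (phi : X -> X')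
    (g : (Yfactor S -> Yfactor S') * (Hfactor S -> Hfactor S')) :=
  [/\ is_isometry g.1, is_isometry g.2
    & forall x, embed S' (phi x) = (g.1 (embed S x).1, g.2 (embed S x).2)].

End MetricGeometry.

Arguments induces {R X X'} S S' phi g.

(* Main.v *)
Require Import Defs.
From HB Require Import structures.
From mathcomp Require Import all_boot all_order all_algebra.
From mathcomp Require Import all_classical all_reals all_analysis.
From mathcomp Require Import ring lra.

Set Implicit Arguments.
Unset Strict Implicit.
Unset Printing Implicit Defensive.
Import Order.TTheory GRing.Theory Num.Theory.
Import numFieldNormedType.Exports.
Local Open Scope classical_set_scope.
Local Open Scope ring_scope.

(* Affine functions on X modulo constants, normed by their least Lipschitz
   constant, form a Banach space. On small scales X is flat up to a relative
   error quadratic in the size, and a Lipschitz constant on a small ball is one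
   everywhere, so the steepest directions of f + g and f - g can be compared
   near one point; this gives the parallelogram law, and the space is a Hilbert
   space H. By Riesz, the evaluations x |-> (f |-> f x - f o) define a map
   E : X -> H which is 1-Lipschitz, affine on geodesics, and through which every
   affine function factors.

   Y is X with the pseudo-distance sqrt (d(x, y)^2 - |E x - E y|^2). As |E x - p|^2
   satisfies Stewart's identity along geodesics, the approximate Stewart
   inequality of X is inherited by the difference. It yields a local triangle
   inequality with a small error; subdividing one side finely makes it exact and
   global. If X is CAT(0), Stewart's inequality holds exactly in X, hence in Y
   and in its completion, and it implies CAT(0) there.

   Both H and Y are built from the distance of X only, hence natural. *)

(** * Model trigonometry *)

(** Under a positive curvature bound geodesics may branch into several at large distances, so
    comparison is available in small balls only and has to be propagated. The quadratic error is
    what makes this possible: cutting a path into N pieces of length about 1 / N costs N times O(1 /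
    N^2), which tends to 0, whereas a linear error would survive. The assignment is chosen before
    kappa and is defined on every metric space, with or without a curvature bound. So H must be a
    Hilbert space and Y a metric space even where comparison fails; there H is made 0, and the
    distance of Y is that of X. E depends on the base point o, which isometries do not respect. Only
    the differences E x - E y are natural, so an isometry of X acts on H by a linear isometry
    followed by a translation. E(X) need not be all of H, yet this action is unique: an element of H
    is an affine function modulo constants, hence it is determined by its inner products with the
    differences E y - E x. *)

Section ModelTrigonometry.
Variable R : realType.
Implicit Types (C S : R -> R) (a b c e r s t x y : R).

Lemma derive_ge0_le (f f' : R -> R) x y :
  (forall z : R, is_derive z 1 f (f' z)) -> x <= y ->
  (forall z, x <= z <= y -> 0 <= f' z) -> f x <= f y.
Proof.
move=> df xy f'0.
have [|z zxy fxy] := MVT_segment xy (fun z _ => df z).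
  apply: continuous_subspaceT => z.
  exact/differentiable_continuous/derivable1_diffP/ex_derive.
by rewrite -subr_ge0 fxy mulr_ge0 ?subr_ge0// f'0//; rewrite in_itv in zxy.
Qed.

(* The pairs (cos, sin) and (cosh, sinh), with sg = 1 and sg = -1. *)
Record model_trig (sg : R) C S : Prop := ModelTrig {
  model_sg : sg = 1 \/ sg = -1 ;
  model_CB : forall x y, C (x - y) = C x * C y + sg * (S x * S y) ;
  model_SB : forall x y, S (x - y) = S x * C y - C x * S y ;
  model_C0 : C 0 = 1 ;
  model_S0 : S 0 = 0 ;
  model_dC : forall x : R, is_derive x 1 C (- (sg * S x)) ;
  model_dS : forall x : R, is_derive x 1 S (C x) ;
  model_C2 : forall x, 0 <= x <= 1 -> `|C x| <= 3
}.

Lemma model_trig_cos : model_trig 1 (@cos R) (@sin R).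
Proof.
split; first by left.
- by move=> x y; rewrite cosB mul1r.
- by move=> x y; rewrite sinB.
- exact: cos0.
- exact: sin0.
- by move=> x; rewrite mul1r; exact: is_derive_cos.
- by move=> x; exact: is_derive_sin.
- by move=> x _; rewrite (le_trans (cos_max x))// ler1n.
Qed.

(** Integrates a bound on the derivative. Iterated from [|C x| <= 3], it gives the Taylor estimates
    of [S], [C] and again [S], of orders 1, 2 and 3. *)
Lemma derive_norm_le (f f' g g' : R -> R) x y :
  (forall z : R, is_derive z 1 f (f' z)) ->
  (forall z : R, is_derive z 1 g (g' z)) -> x <= y ->
  (forall z, x <= z <= y -> `|f' z| <= g' z) -> `|f y - f x| <= g y - g x.
Proof.
move=> df dg xy fg.
have h1 : g x - f x <= g y - f y.
  apply: (@derive_ge0_le (g \- f) (fun z => g' z - f' z)) => // z.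
  by move=> /fg; rewrite subr_ge0; apply: le_trans; rewrite ler_norm.
have h2 : g x + f x <= g y + f y.
  apply: (@derive_ge0_le (g \+ f) (fun z => g' z + f' z)) => // z.
  by move=> /fg; rewrite ler_norml => /andP[]; lra.
by rewrite ler_norml; lra.
Qed.

Definition cosh x : R := (expR x + expR (- x)) / 2.
Definition sinh x : R := (expR x - expR (- x)) / 2.

Lemma model_trig_cosh : model_trig (-1) cosh sinh.
Proof.
have dN x : is_derive x 1 (fun y => expR (- y)) (- expR (- x)) :> Prop.
  by apply: is_derive_eq; rewrite ?mulN1r ?scaleN1r ?scalerN ?scaler1; ring.
split; first by right.
- move=> x y; rewrite /cosh /sinh opprB !expRD; lra.
- move=> x y; rewrite /cosh /sinh opprB !expRD; lra.
- by rewrite /cosh oppr0 expR0; lra.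
- by rewrite /sinh oppr0 expR0; lra.
- move=> x; rewrite /cosh.
  have := dN x => ?; apply: is_derive_eq; rewrite /sinh /=.
  by rewrite scaler0 /GRing.scale /=; lra.
- move=> x; rewrite /sinh.
  have := dN x => ?; apply: is_derive_eq; rewrite /cosh /=.
  by rewrite scaler0 /GRing.scale /=; lra.
(* From [1 - x / 2 <= expR (- (x / 2))] and [x <= 1] follows [expR (x / 2) <= 2], so [cosh x] is at
   most 5 / 2. *)
- move=> x /andP[x0 x1].
  have h1 := expR_ge1Dx (- (x / 2)); have h2 := expRxMexpNx_1 (x / 2).
  have h3 : expR x = expR (x / 2) ^+ 2 by rewrite expr2 -expRD -splitr.
  have h0 := expR_ge0 (x / 2).
  have h4 : expR (x / 2) <= 2 by nra.
  have e1 : expR x <= 4 by rewrite h3; nra.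
  have e2 : expR (- x) <= 1 by rewrite -expR0 ler_expR oppr_le0.
  have := expR_ge0 x; have := expR_ge0 (- x) => ? ?.
  by rewrite /cosh ger0_norm; lra.
Qed.

Section model_trig_bounds.
Variables (sg : R) (C S : R -> R).
Hypothesis mt : model_trig sg C S.

Let dC := model_dC mt.
Let dS := model_dS mt.
Let C0 := model_C0 mt.
Let S0 := model_S0 mt.

Lemma model_sg_norm : `|sg| = 1.
Proof. by case: (model_sg mt) => ->; rewrite ?normrN normr1. Qed.

Lemma model_S_le3 x : 0 <= x <= 1 -> `|S x| <= 3 * x.
Proof.
move=> /andP[x0 x1].
have -> : S x = S x - S 0 by rewrite S0 subr0.
have -> : 3 * x = 3 * x - 3 * 0 by rewrite mulr0 subr0.
apply: (derive_norm_le (g := fun z => 3 * z) (g' := fun=> 3) dS) => // [z|z z01].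
  by apply: is_derive_eq; rewrite /GRing.scale /= ?scaler0; lra.
by apply: (model_C2 mt); lra.
Qed.

Lemma model_C_near1 x : 0 <= x <= 1 -> `|C x - 1| <= 3 / 2 * x ^+ 2.
Proof.
move=> /andP[x0 x1].
rewrite -[X in C x - X]C0.
have -> : 3 / 2 * x ^+ 2 = 3 / 2 * x ^+ 2 - 3 / 2 * 0 ^+ 2.
  by rewrite expr0n mulr0 subr0.
apply: (derive_norm_le (g := fun z => 3 / 2 * z ^+ 2) (g' := fun z => 3 * z) dC).
- by move=> z; apply: is_derive_eq; rewrite /GRing.scale /= ?scaler0; lra.
- by [].
- move=> z z01; rewrite normrN normrM model_sg_norm mul1r.
  by apply: model_S_le3; lra.
Qed.

Lemma model_S_near_id x : 0 <= x <= 1 -> `|S x - x| <= x ^+ 3 / 2.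
Proof.
move=> /andP[x0 x1].
have -> : S x - x = (S x - x) - (S 0 - 0) by rewrite S0; ring.
have -> : x ^+ 3 / 2 = x ^+ 3 / 2 - 0 ^+ 3 / 2 by rewrite expr0n mul0r subr0.
apply: (derive_norm_le (f := fun z => S z - z) (f' := fun z => C z - 1)
  (g := fun z => z ^+ 3 / 2) (g' := fun z => 3 / 2 * z ^+ 2)).
- by move=> z; exact: (is_deriveB (dS z) (is_derive_id z 1)).
- by move=> z; apply: is_derive_eq; rewrite /GRing.scale /= ?scaler0; lra.
- by [].
- by move=> z z01; apply: model_C_near1; lra.
Qed.

(** Turns the cubic error into a relative error [r ^+ 2], of the same form on the sphere and in the
    hyperbolic plane. *)
Lemma model_S_bounds r x : r <= 1 -> 0 <= x <= r ->
  (1 - r ^+ 2) * x <= S x <= (1 + r ^+ 2) * x.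
Proof.
move=> r1 /andP[x0 xr].
have /(_ _)/[!ler_norml]/(_ _)/andP := @model_S_near_id x.
rewrite x0 (le_trans xr r1) => /(_ isT)[h1 h2].
have h3 : x ^+ 3 <= r ^+ 2 * x by rewrite exprS mulrC ler_wpM2r// ler_sqr ?nnegrE//; lra.
have h4 : 0 <= x ^+ 3 by rewrite exprn_ge0.
by apply/andP; split; lra.
Qed.

Lemma model_S_gt0 x : 0 < x <= 1 -> 0 < S x.
Proof.
move=> /andP[x0 x1]; have := @model_S_near_id x; rewrite ltW//= x1 => /(_ isT).
by rewrite ler_norml => /andP[h _]; nra.
Qed.

Lemma model_S_ge0 x : 0 <= x <= 1 -> 0 <= S x.
Proof.
move=> /andP[]; rewrite le_eqVlt => /predU1P[<-|x0] x1; first by rewrite S0.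
by rewrite ltW// model_S_gt0// x0.
Qed.

(** As [- (sg * C u)] is a primitive of [S u], this is [model_S_bounds] integrated from x to y.
    Differences of [C] thus become half differences of squares, which makes the law of cosines
    Euclidean up to a factor. *)
Lemma model_C_diff r x y : r <= 1 -> 0 <= x -> x <= y -> y <= r ->
  (1 - r ^+ 2) * ((y ^+ 2 - x ^+ 2) / 2) <= sg * (C x - C y) <=
  (1 + r ^+ 2) * ((y ^+ 2 - x ^+ 2) / 2).
Proof.
move=> r1 x0 xy yr.
have sg2 : sg * sg = 1 by case: (model_sg mt) => ->; rewrite ?mulrNN mulr1.
have Sb z : x <= z <= y -> (1 - r ^+ 2) * z <= S z <= (1 + r ^+ 2) * z.
  by move=> /andP[xz zy]; apply: model_S_bounds => //; lra.
have dsC (z : R) : is_derive z 1 (fun u => - (sg * C u)) (S z).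
  apply: (is_derive_eq (is_deriveN (is_deriveZ sg (dC z)))).
  by rewrite /GRing.scale /= mulrN opprK mulrA sg2 mul1r.
have dq (c z : R) : is_derive z 1 (fun u => c * (u ^+ 2 / 2)) (c * z).
  by apply: is_derive_eq; rewrite /GRing.scale /= ?scaler0; lra.
apply/andP; split.
  have : - (sg * C x) - (1 - r ^+ 2) * (x ^+ 2 / 2) <=
         - (sg * C y) - (1 - r ^+ 2) * (y ^+ 2 / 2).
    apply: (@derive_ge0_le (fun u => - (sg * C u) - (1 - r ^+ 2) * (u ^+ 2 / 2))
      (fun u => S u - (1 - r ^+ 2) * u)) => // z /Sb /andP[].
    by rewrite subr_ge0.
  lra.
have : (1 + r ^+ 2) * (x ^+ 2 / 2) + sg * C x <=
       (1 + r ^+ 2) * (y ^+ 2 / 2) + sg * C y.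
  rewrite -[_ + sg * C x]opprK -[_ + sg * C y]opprK lerN2.
  suff : (1 + r ^+ 2) * (x ^+ 2 / 2) - - (sg * C x) <=
         (1 + r ^+ 2) * (y ^+ 2 / 2) - - (sg * C y) by lra.
  apply: (@derive_ge0_le (fun u => (1 + r ^+ 2) * (u ^+ 2 / 2) - - (sg * C u))
      (fun u => (1 + r ^+ 2) * u - S u)) => // z /Sb /andP[_].
  by rewrite subr_ge0.
lra.
Qed.

Lemma model_C_bounds r x : r <= 1 -> 0 <= x -> x <= r ->
  1 - r ^+ 2 <= C x <= 1 + r ^+ 2.
Proof.
move=> r1 x0 xr; have := model_C_diff r1 (lexx 0) x0 xr.
rewrite C0 expr0n subr0 => /andP[h1 h2].
have h3 : x ^+ 2 <= r ^+ 2 by rewrite ler_sqr// nnegrE; lra.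
have h4 : r ^+ 2 <= 1 by rewrite expr_le1//; lra.
have h5 : 0 <= x ^+ 2 by rewrite sqr_ge0.
by case: (model_sg mt) h1 h2 => -> h1 h2; apply/andP; split; nra.
Qed.

Lemma model_CN x : C (- x) = C x.
Proof. by rewrite -sub0r (model_CB mt) C0 S0; ring. Qed.

Lemma model_SN x : S (- x) = - S x.
Proof. by rewrite -sub0r (model_SB mt) C0 S0; ring. Qed.

Lemma model_CD x y : C (x + y) = C x * C y - sg * (S x * S y).
Proof. by rewrite -[y]opprK (model_CB mt) opprK model_CN model_SN; ring. Qed.

Lemma model_SD x y : S (x + y) = S x * C y + C x * S y.
Proof. by rewrite -[y]opprK (model_SB mt) opprK model_CN model_SN; ring. Qed.

Lemma model_CS x : C x ^+ 2 + sg * S x ^+ 2 = 1.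
Proof. by rewrite -C0 -(subrr x) (model_CB mt). Qed.

Lemma model_C_norm x : C `|x| = C x.
Proof. by case: ger0P => // _; rewrite model_CN. Qed.

(** Two sines and one difference of cosines lose a factor (1 + q)^3 / (1 - q)^3 in a comparison of
    squared lengths; it is absorbed into the square of [1 + 8 * q]. *)
Let cubic_bound (q : R) : 0 <= q <= 1 / 4 ->
  (1 + q) ^+ 3 <= (1 - q) ^+ 3 * (1 + 8 * q) ^+ 2.
Proof.
move=> /andP[q0 q1]; rewrite -subr_ge0.
have -> : (1 - q) ^+ 3 * (1 + 8 * q) ^+ 2 - (1 + q) ^+ 3 =
  q * ((10 - 41 / 2 * q) + 146 * q * (1 / 4 - q) + q ^+ 3 * (176 - 64 * q)) by field.
apply: mulr_ge0; first exact: q0.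
have : 0 <= q * (1 / 4 - q) by rewrite mulr_ge0//; lra.
have : 0 <= q ^+ 3 * (176 - 64 * q) by rewrite mulr_ge0 ?exprn_ge0//; lra.
lra.
Qed.

(* In the plane, [e] is the distance between the points that divide the two
   sides of lengths [b], [c] at an apex in the ratio [s], and [a] is the length
   of the third side. *)
Lemma model_contract r a b c e s :
  r <= 1 / 2 -> 0 <= s <= 1 -> 0 < b <= r -> 0 < c <= r -> 0 <= a <= r ->
  0 <= e <= r -> `|b - c| <= a ->
  S (s * b) * S (s * c) * (sg * (C a - C b * C c)) <=
    S b * S c * (sg * (C e - C (s * b) * C (s * c))) ->
  e <= (1 + 8 * r ^+ 2) * (s * a).
Proof.
move=> r1 /andP[s0 s1] /andP[b0 br] /andP[c0 cr] /andP[a0 ar] /andP[e0 er] bca h.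
have r0 : 0 < r by lra.
have sg2 : sg * sg = 1 by case: (model_sg mt) => ->; rewrite ?mulrNN mulr1.
(* A triangle with apex angle 0 has third side [u], and its points at ratio [s] are [s * u] apart.
   Subtracting its law of cosines turns [h] into a comparison of [C u - C a] with [C (s * u) - C e],
   to which [model_C_diff] applies. *)
set u := `|b - c| in bca.
have u0 : 0 <= u by rewrite normr_ge0.
have Cu : C u = C b * C c + sg * (S b * S c) by rewrite model_C_norm (model_CB mt).
have Csu : C (s * u) = C (s * b) * C (s * c) + sg * (S (s * b) * S (s * c)).
  have -> : s * u = `|s * b - s * c| by rewrite -mulrBr normrM ger0_norm.
  by rewrite model_C_norm (model_CB mt).
have {}h : S b * S c * (sg * (C (s * u) - C e)) <=
    S (s * b) * S (s * c) * (sg * (C u - C a)).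
  rewrite Cu Csu -subr_ge0; move: h; rewrite -subr_ge0.
  congr (0 <= _); ring: sg2.
have [esu|sue] := leP e (s * u).
  have : e <= s * a by rewrite (le_trans esu)// ler_wpM2l.
  move/le_trans; apply; rewrite ler_peMl ?mulr_ge0// lerDl mulr_ge0//.
  exact: sqr_ge0.
have r1' : r <= 1 by lra.
have su0 : 0 <= s * u by rewrite mulr_ge0.
have /andP[h1 _] := model_C_diff r1' su0 (ltW sue) er.
have /andP[h2 h3] := model_C_diff r1' u0 bca ar.
set q := r ^+ 2 in h1 h2 h3 *.
have q0 : 0 <= q by rewrite sqr_ge0.
have q1 : q <= 1 / 4 by rewrite /q; nra.
have p0 : 0 <= 1 - q by lra.
have p1 : 0 <= 1 + q by lra.
have b0' := ltW b0; have c0' := ltW c0.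
have /andP[Sb1 _] : (1 - q) * b <= S b <= (1 + q) * b by apply: model_S_bounds; lra.
have /andP[Sc1 _] : (1 - q) * c <= S c <= (1 + q) * c by apply: model_S_bounds; lra.
have /andP[Sb3 Sb4] : (1 - q) * (s * b) <= S (s * b) <= (1 + q) * (s * b).
  by apply: model_S_bounds => //; rewrite mulr_ge0//= (le_trans _ br)// ler_piMl.
have /andP[Sc3 Sc4] : (1 - q) * (s * c) <= S (s * c) <= (1 + q) * (s * c).
  by apply: model_S_bounds => //; rewrite mulr_ge0//= (le_trans _ cr)// ler_piMl.
have Sb0 : 0 <= S (s * b) by rewrite (le_trans _ Sb3)// !mulr_ge0.
have Sc0 : 0 <= S (s * c) by rewrite (le_trans _ Sc3)// !mulr_ge0.
set A := a ^+ 2 - u ^+ 2 in h2 h3.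
have A0 : 0 <= A by rewrite /A subr_ge0 ler_sqr ?nnegrE.
set E := e ^+ 2 - (s * u) ^+ 2 in h1.
have E0 : 0 <= E by rewrite /E subr_ge0 ler_sqr ?nnegrE// ltW.
have bc0 : 0 < b * c by rewrite mulr_gt0.
have k1 : (1 - q) ^+ 2 * (b * c) <= S b * S c.
  have -> : (1 - q) ^+ 2 * (b * c) = ((1 - q) * b) * ((1 - q) * c) by ring.
  by apply: ler_pM => //; rewrite mulr_ge0.
have k2 : S (s * b) * S (s * c) <= (1 + q) ^+ 2 * s ^+ 2 * (b * c).
  have -> : (1 + q) ^+ 2 * s ^+ 2 * (b * c) =
    ((1 + q) * (s * b)) * ((1 + q) * (s * c)) by ring.
  exact: ler_pM.
have A2 : 0 <= A / 2 by rewrite divr_ge0.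
have E2 : 0 <= E / 2 by rewrite divr_ge0.
have k3 : (1 - q) ^+ 2 * (b * c) * ((1 - q) * (E / 2)) <=
   (1 + q) ^+ 2 * s ^+ 2 * (b * c) * ((1 + q) * (A / 2)).
  apply: (le_trans (_ : _ <= S b * S c * (sg * (C (s * u) - C e)))).
    by apply: ler_pM => //; rewrite mulr_ge0// ?mulr_ge0 ?exprn_ge0.
  apply: (le_trans h); apply: ler_pM => //; first by rewrite mulr_ge0.
  by apply: le_trans h2; rewrite mulr_ge0.
have k4 : (1 - q) ^+ 3 * E <= (1 + q) ^+ 3 * (s ^+ 2 * A).
  by rewrite -(ler_pM2r bc0); move: k3; clear; lra.
have k6 : E <= (1 + 8 * q) ^+ 2 * (s ^+ 2 * A).
  rewrite -(@ler_pM2l _ ((1 - q) ^+ 3)); last by rewrite exprn_gt0//; lra.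
  apply: (le_trans k4); rewrite [leRHS]mulrA; apply: ler_wpM2r.
    by rewrite mulr_ge0// sqr_ge0.
  by apply: cubic_bound; rewrite q0.
have k7 : e ^+ 2 <= ((1 + 8 * q) * (s * a)) ^+ 2.
  have : (s * u) ^+ 2 <= (1 + 8 * q) ^+ 2 * (s * u) ^+ 2.
    by rewrite ler_peMl ?sqr_ge0//; apply: exprn_ege1; rewrite lerDl mulr_ge0.
  by move: k6; rewrite /E /A; clear; lra.
by move: k7; rewrite ler_sqr// nnegrE ?mulr_ge0//; lra.
Qed.

(* In the plane, [e] is the length of the median to the side of length [b] of
   a triangle with side lengths [a], [b], [c]. *)
Lemma model_median r a b c e :
  r <= 1 / 2 -> 0 < b <= r -> 0 < c <= r -> 0 <= a <= r -> 0 <= e <= r ->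
  `|a - c| <= b -> b <= a + c ->
  S (2^-1 * b) * S c * (sg * (C a - C b * C c)) <=
    S b * S c * (sg * (C e - C (2^-1 * b) * C c)) ->
  e ^+ 2 <= (a ^+ 2 + c ^+ 2) / 2 - (1 - 4 * r ^+ 2) * (b ^+ 2 / 4).
Proof.
move=> r1 /andP[b0 br] /andP[c0 cr] /andP[a0 ar] /andP[e0 er] acb bac.
set be := 2^-1 * b => h.
have b2 : b = be + be by rewrite /be; lra.
have sg2 : sg * sg = 1 by case: (model_sg mt) => ->; rewrite ?mulrNN mulr1.
(* Since [C a + C c = 2 * (C u * C w)], the hypothesis becomes a comparison of [C w - C be] with
   [C e - C u]. As [u ^+ 2 + w ^+ 2] is the mean of the squares of a and c, it suffices to compare
   [be ^+ 2 - w ^+ 2] with [u ^+ 2 - e ^+ 2]. *)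
set u := (a + c) / 2; set w := `|a - c| / 2.
have w0 : 0 <= w by rewrite divr_ge0.
have r1' : r <= 1 by lra.
have Sbe : 0 < S be by apply: model_S_gt0; rewrite /be; lra.
have Sc : 0 < S c by apply: model_S_gt0; lra.
have CC x y : 2 * (C x * C y) = C (x + y) + C (x - y).
  by rewrite model_CD (model_CB mt); ring.
have {}h : C u * (sg * (C w - C be)) <= C be * (sg * (C e - C u)).
  have Cuw : 2 * (C u * C w) = C a + C c.
    have -> : C w = C ((a - c) / 2).
      by rewrite -[RHS]model_C_norm normrM [X in _ * X]ger0_norm.
    by rewrite CC /u; congr (C _ + C _); field.
  have Cbb : C b = 2 * C be ^+ 2 - 1.
    by rewrite b2 model_CD; have := model_CS be; lra.
  have h' : sg * (C a - C b * C c) <= 2 * C be * (sg * (C e - C be * C c)).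
    rewrite -(ler_pM2l (mulr_gt0 Sbe Sc)); apply: (le_trans h).
    by rewrite b2 model_SD le_eqVlt; apply/orP; left; apply/eqP; ring.
  by move: h'; rewrite Cbb; nra.
have wb : w <= be by rewrite /w /be; lra.
have ur : u <= r by rewrite /u; lra.
have u0 : 0 <= u by rewrite /u; lra.
have ber : be <= r by rewrite /be; lra.
have /andP[h1 h2] := model_C_diff r1' w0 wb ber.
have /andP[Cu1 Cu2] := model_C_bounds r1' u0 ur.
have /andP[Cb1 Cb2] := model_C_bounds r1' (le_trans w0 wb) ber.
set q := r ^+ 2 in h1 h2 Cu1 Cu2 Cb1 Cb2 *.
have q0 : 0 <= q by rewrite sqr_ge0.
have q1 : q <= 1 / 4 by rewrite /q; nra.
set B := be ^+ 2 - w ^+ 2 in h1 h2.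
have B0 : 0 <= B by rewrite /B subr_ge0 ler_sqr ?nnegrE// (le_trans w0).
have k1 : (1 - q) ^+ 2 * (B / 2) <= C be * (sg * (C e - C u)).
  apply: le_trans h; rewrite expr2 -mulrA.
  by apply: ler_pM => //; rewrite ?mulr_ge0//; lra.
have k2 : (1 - 4 * q) * B <= u ^+ 2 - e ^+ 2.
  have [eu|ue] := leP e u.
    have /andP[_ h3] := model_C_diff r1' e0 eu ur; rewrite -/q in h3.
    set A := u ^+ 2 - e ^+ 2 in h3 *.
    have A0 : 0 <= A by rewrite /A subr_ge0 ler_sqr ?nnegrE.
    have k3 : (1 - q) ^+ 2 * B <= (1 + q) ^+ 2 * A.
      have : C be * (sg * (C e - C u)) <= (1 + q) * ((1 + q) * (A / 2)).
        apply: (le_trans (_ : _ <= C be * ((1 + q) * (A / 2)))).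
          by rewrite ler_wpM2l//; lra.
        by rewrite ler_wpM2r// mulr_ge0//; lra.
      by move: k1; lra.
    have k4 : (1 + q) ^+ 2 * (1 - 4 * q) <= (1 - q) ^+ 2.
      rewrite -subr_ge0.
      have -> : (1 - q) ^+ 2 - (1 + q) ^+ 2 * (1 - 4 * q) =
        q ^+ 2 * (8 + 4 * q) by ring.
      by rewrite mulr_ge0 ?sqr_ge0//; lra.
    rewrite -(@ler_pM2l _ ((1 + q) ^+ 2)); last by rewrite exprn_gt0//; lra.
    by apply: le_trans k3; rewrite mulrA ler_wpM2r.
  (* The case [u < e] is contradictory: the right side of [h] would be negative and its left side is
     not. *)
  have /andP[h3 _] := model_C_diff r1' u0 (ltW ue) er; rewrite -/q in h3.
  have ue2 : u ^+ 2 < e ^+ 2 by rewrite ltr_sqr ?nnegrE.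
  have lt0 : sg * (C e - C u) < 0.
    rewrite -oppr_gt0 -mulrN opprB (lt_le_trans _ h3)// mulr_gt0//; first by lra.
    by rewrite divr_gt0// subr_gt0.
  have Cbe0 : 0 < C be by lra.
  have : 0 <= C be * (sg * (C e - C u)).
    by apply: le_trans k1; rewrite mulr_ge0 ?sqr_ge0// divr_ge0.
  by rewrite pmulr_rge0// leNgt lt0.
have uw : u ^+ 2 + w ^+ 2 = (a ^+ 2 + c ^+ 2) / 2.
  rewrite /u /w [in X in _ + X]exprMn -[in X in _ + X]normrX.
  by rewrite [`|_ ^+ 2|]ger0_norm ?sqr_ge0//; field.
have bb : be ^+ 2 = b ^+ 2 / 4 by rewrite /be; field.
have := sqr_ge0 w.
move: k2; rewrite -uw -bb /B; nra.
Qed.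

End model_trig_bounds.

End ModelTrigonometry.

(** * Geodesics *)

Section Geodesics.
Variables (R : realType) (X : metricType R).
Implicit Types (x y z : X) (c : R -> X) (a b l s t : R).

Lemma partition_sum c l a b p : itv_partition a b p ->
  (forall s t, a <= s -> s <= t -> t <= b ->
     mdist (c s) (c t) = l * (t - s)) ->
  \sum_(0 <= k < size p)
    mdist (c (nth b (a :: p) k)) (c (nth b (a :: p) k.+1)) = l * (b - a).
Proof.
elim: p a => [a /itv_partition_nil -> _|u p IH a].
  by rewrite big_nil subrr mulr0.
move=> pab lc; have [/= /andP[au pu] plast] := pab.
have ub : u <= b.
  by apply: (@itv_partition_le _ _ u b p); split.
rewrite big_nat_recl//= lc ?lexx ?(ltW au)//.
rewrite IH//; first by rewrite -mulrDr; congr (_ * _); lra.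
by move=> s t us; apply: lc; rewrite (le_trans (ltW au)).
Qed.

Lemma curve_length_const c l a b : a <= b ->
  (forall s t, a <= s -> s <= t -> t <= b ->
     mdist (c s) (c t) = l * (t - s)) ->
  curve_length c a b = (l * (b - a))%:E.
Proof.
move=> ab lc; rewrite /curve_length.
have -> : [set (\sum_(0 <= k < size p)
    mdist (c (nth b (a :: p) k)) (c (nth b (a :: p) k.+1)))%:E
    | p in itv_partition a b] = [set (l * (b - a))%:E].
  apply/seteqP; split => [_ [p pab <-]|_ ->] /=.
    by rewrite (partition_sum pab lc).
  have [p pab] : exists p, itv_partition a b p.
    move: ab; rewrite le_eqVlt => /predU1P[->|ab].
      by exists [::]; split => //=.
    by exists [:: b]; exact: itv_partition1.
  by exists p => //; rewrite (partition_sum pab lc).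
by rewrite ereal_sup1.
Qed.

Lemma mdist_curve_length c a b : a <= b ->
  ((mdist (c a) (c b))%:E <= curve_length c a b)%E.
Proof.
rewrite le_eqVlt => /predU1P[->|ab]; apply: ereal_sup_ubound.
  by exists [::]; [split => //=|rewrite big_nil mdistxx].
by exists [:: b]; [exact: itv_partition1|rewrite big_nat1].
Qed.

(** The length of each arc bounds the distance of its ends. Since the bound is attained on all of
    [a, b], the triangle inequality forces it to be attained on every subarc. *)
Lemma is_geodesicP a b c : is_geodesic a b c <->
  a <= b /\ exists2 l, 0 <= l &
    forall s t, a <= s -> s <= t -> t <= b -> mdist (c s) (c t) = l * (t - s).
Proof.
split=> [[ab cab [l l0 lc]]|[ab [l l0 lc]]].
  split => //; exists l => // s t as_ st tb.
  have dle u v : a <= u -> u <= v -> v <= b -> mdist (c u) (c v) <= l * (v - u).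
    by move=> au uv vb; rewrite -lee_fin -lc//; exact: mdist_curve_length.
  have dab : mdist (c a) (c b) = l * (b - a).
    by apply: EFin_inj; rewrite -cab lc.
  apply/eqP; rewrite eq_le dle//=.
  have := dle a s (lexx _) as_ (le_trans st tb).
  have := dle t b (le_trans as_ st) tb (lexx _).
  have := metric_triangle (c a) (c s) (c b).
  have := metric_triangle (c s) (c t) (c b).
  by rewrite dab; lra.
split => //; first by rewrite (curve_length_const ab lc) lc.
by exists l => // s t as_ st tb; apply: curve_length_const => // u v su uv vt;
  apply: lc; [exact: le_trans su|by []|exact: le_trans tb].
Qed.

Lemma mdist_diff_le x y z : `|mdist x y - mdist x z| <= mdist y z.
Proof.
rewrite ler_norml; have := metric_triangle x y z.
by have := metric_triangle x z y; rewrite (metric_sym z y); lra.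
Qed.

(** The working form of [geodesic_from_to]: distances in place of lengths, and no order between the
    two parameters. *)
Definition geod x y c := [/\ c 0 = x, c 1 = y &
  forall s t, 0 <= s <= 1 -> 0 <= t <= 1 ->
    mdist (c s) (c t) = `|s - t| * mdist x y].

Lemma geodP x y c : geodesic_from_to x y c <-> geod x y c.
Proof.
split=> [[/is_geodesicP[_ [l l0 lc]] c0 c1]|[c0 c1 cd]]; split => //.
  have <- : l = mdist x y by rewrite -c0 -c1 lc ?ler01// subr0 mulr1.
  move=> s t s01 t01; have [ts|st] := leP t s.
    rewrite metric_sym lc; [|lra..].
    by rewrite ger0_norm ?subr_ge0// mulrC.
  rewrite lc; [|lra..].
  by rewrite distrC ger0_norm ?subr_ge0 ?(ltW st)// mulrC.
apply/is_geodesicP; split; first by rewrite ler01.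
exists (mdist x y); first exact: mdist_ge0.
move=> s t s0 st t1; rewrite cd; [|lra..].
by rewrite distrC ger0_norm ?subr_ge0// mulrC.
Qed.

Lemma geod_sym x y c : geod x y c -> geod y x (fun s => c (1 - s)).
Proof.
move=> [c0 c1 cd]; split; rewrite ?subr0 ?subrr//.
move=> s t s01 t01; rewrite cd; [|lra..].
rewrite (metric_sym y x); congr (_ * _).
by rewrite distrC; congr `| _ |; lra.
Qed.

Lemma geod_distl x y c s : geod x y c -> 0 <= s <= 1 ->
  mdist x (c s) = s * mdist x y.
Proof.
move=> [c0 c1 cd] s01; rewrite -{1}c0 cd; [|lra..].
by rewrite sub0r normrN ger0_norm; lra.
Qed.

Lemma geod_distr x y c s : geod x y c -> 0 <= s <= 1 ->
  mdist (c s) y = (1 - s) * mdist x y.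
Proof.
move=> [c0 c1 cd] s01; rewrite -{1}c1 cd; [|lra..].
by rewrite distrC ger0_norm; lra.
Qed.

Lemma geod_sub x y c s t : geod x y c -> 0 <= s <= 1 -> 0 <= t <= 1 ->
  geod (c s) (c t) (fun u => c (s + u * (t - s))).
Proof.
move=> [c0 c1 cd] s01 t01; split; first by congr c; lra.
  by congr c; lra.
move=> u v u01 v01; rewrite !cd//; [|nra..].
rewrite mulrA (distrC s t) -normrM; congr (`| _ | * _); lra.
Qed.

End Geodesics.

(** * Comparison on small scales *)

Section LocallyAlmostFlat.
Variables (R : realType) (X : metricType R).
Implicit Types (x y z : X) (c : R -> X) (s t q r : R).

Definition contracting q r := forall z x x' c c' s,
  geod z x c -> geod z x' c' -> mdist z x <= r -> mdist z x' <= r ->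
  0 <= s <= 1 -> mdist (c s) (c' s) <= (1 + q) * (s * mdist x x').

Definition short_medians q r := forall x y z c, geod y z c ->
  mdist x y <= r -> mdist x z <= r -> mdist y z <= r ->
  mdist x (c 2^-1) ^+ 2 <= (mdist x y ^+ 2 + mdist x z ^+ 2) / 2
    - (1 - q) * (mdist y z ^+ 2 / 4).

(* What a curvature bound leaves of the CAT(0) inequalities on small scales:
   they hold up to a relative error that is quadratic in the size. *)
Definition almost_flat (C r0 : R) := forall r, 0 <= r <= r0 ->
  contracting (C * r ^+ 2) r /\ short_medians (C * r ^+ 2) r.

(** The model comparison determines the angle at the apex by a division by [S b * S c]; sides of
    length 0 are therefore treated apart. *)
Lemma contracting_degenerate z x x' c c' s : geod z x c -> geod z x' c' ->
  0 <= s <= 1 -> mdist z x = 0 \/ mdist z x' = 0 ->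
  mdist (c s) (c' s) = s * mdist x x'.
Proof.
move=> g g' s01 [] e.
  have cs : z = c s by apply: mdist_positivity; rewrite (geod_distl g)// e mulr0.
  by rewrite -cs (geod_distl g')// (mdist_positivity _ _ e).
have cs : z = c' s by apply: mdist_positivity; rewrite (geod_distl g')// e mulr0.
by rewrite -cs metric_sym (geod_distl g)// (mdist_positivity _ _ e) metric_sym.
Qed.

Lemma short_medians_degenerate q x y z c : 0 <= q -> geod y z c ->
  mdist y z = 0 \/ mdist y x = 0 ->
  mdist x (c 2^-1) ^+ 2 <= (mdist x y ^+ 2 + mdist x z ^+ 2) / 2
    - (1 - q) * (mdist y z ^+ 2 / 4).
Proof.
move=> q0 g; have h2 : 0 <= (2^-1 : R) <= 1 by rewrite invr_ge0 invf_le1//=; lra.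
move=> [e|e].
  have cs : y = c 2^-1 by apply: mdist_positivity; rewrite (geod_distl g)// e mulr0.
  by rewrite -cs -(mdist_positivity _ _ e) mdistxx expr0n /= mul0r mulr0; lra.
rewrite -(mdist_positivity _ _ e) (geod_distl g)// mdistxx expr0n /=.
have : 0 <= q * mdist y z ^+ 2 by rewrite mulr_ge0 ?sqr_ge0.
lra.
Qed.

End LocallyAlmostFlat.

Section Comparison.
Variables (R : realType) (X : metricType R).
Implicit Types (x y z : X) (s t : R).

Definition triple (T : Type) (a b c : T) (i : 'I_3) : T :=
  match val i with 0%N => a | 1%N => b | _ => c end.

Lemma forall_I3 (P : 'I_3 -> Prop) :
  P 0 -> P 1 -> P (2 : 'I_3) -> forall i, P i.
Proof.
move=> P0 P1 P2 [[|[|[|//]]] ilt].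
- by rewrite (_ : Ordinal ilt = 0)//; exact: val_inj.
- by rewrite (_ : Ordinal ilt = 1)//; exact: val_inj.
- by rewrite (_ : Ordinal ilt = 2 :> 'I_3)//; exact: val_inj.
Qed.

Lemma ordS_I3 : (ordS 0 = 1 :> 'I_3) * (ordS 1 = 2 :> 'I_3) * (ordS 2 = 0 :> 'I_3).
Proof. by do !split; exact: val_inj. Qed.

Definition vec3 (a b c : R) : 'rV[R]_3 := \row_j triple a b c j.

Lemma vec3E a b c : (vec3 a b c 0 0 = a) * (vec3 a b c 0 1 = b) *
  (vec3 a b c 0 (2 : 'I_3) = c).
Proof. by rewrite !mxE. Qed.

Lemma vec3B a b c a' b' c' :
  vec3 a b c - vec3 a' b' c' = vec3 (a - a') (b - b') (c - c').
Proof. by apply/rowP; apply: forall_I3; rewrite !mxE. Qed.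

Lemma dot3_vec3 e a b c a' b' c' :
  dot3 e (vec3 a b c) (vec3 a' b' c') = a * a' + b * b' + e * (c * c').
Proof. by rewrite /dot3 !vec3E. Qed.

Lemma thin_apex kappa x y z c1 c2 s t (w0 w1 w2 p q : 'rV[R]_3) :
  thin_triangles kappa X -> geodesic_space X ->
  geod z x c1 -> geod z y c2 -> 0 <= s <= 1 -> 0 <= t <= 1 ->
  (0 < kappa -> mdist z x + mdist x y + mdist y z < 2 * pi / Num.sqrt kappa) ->
  [/\ model_space kappa w0, model_space kappa w1, model_space kappa w2,
      model_space kappa p & model_space kappa q] ->
  [/\ model_dist kappa w0 w1 = mdist z x, model_dist kappa w1 w2 = mdist x y
    & model_dist kappa w2 w0 = mdist y z] ->
  model_dist kappa w0 p = s * mdist z x ->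
  model_dist kappa p w1 = (1 - s) * mdist z x ->
  model_dist kappa w2 q = (1 - t) * mdist z y ->
  model_dist kappa q w0 = t * mdist z y ->
  mdist (c1 s) (c2 t) <= model_dist kappa p q.
Proof.
move=> thin geo g1 g2 s01 t01 peri [mw0 mw1 mw2 mp mq] [d01 d12 d20] d0p dp1 d2q dq0.
have [c3 /geodP g3] := geo x y.
pose v := triple z x y; pose w := triple w0 w1 w2.
(* Sides are oriented cyclically z, x, y. The last one runs from y back to z, so it is [c2]
   reversed, and [c2 t] sits at parameter [1 - t]. *)
pose c := triple c1 c3 (fun u => c2 (1 - u)).
have c2E : c 2 (1 - t) = c2 t by rewrite /c /triple /= opprB addrC subrK.
rewrite -c2E; have -> : c1 s = c 0 s by [].
apply: (thin v c w _ _ _ 0 2) => //.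
- apply: forall_I3; rewrite ordS_I3; apply/geodP => //.
  exact: geod_sym.
- by move=> /peri; rewrite !big_ord_recl big_ord0 addr0 addrA.
- by apply: forall_I3; rewrite ordS_I3.
- lra.
- split => //.
    by rewrite d0p [RHS](geod_distl g1).
  by rewrite ordS_I3 dp1 [RHS](geod_distr g1).
- split => //.
    by rewrite d2q c2E [RHS]metric_sym (geod_distr g2).
  by rewrite ordS_I3 dq0 c2E [RHS]metric_sym (geod_distl g2).
Qed.

Lemma thin_apex0 x y z c1 c2 s t :
  thin_triangles 0 X -> geodesic_space X ->
  geod z x c1 -> geod z y c2 -> 0 <= s <= 1 -> 0 <= t <= 1 ->
  mdist (c1 s) (c2 t) ^+ 2 <= s ^+ 2 * mdist z x ^+ 2 + t ^+ 2 * mdist z y ^+ 2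
    + s * t * (mdist x y ^+ 2 - mdist z x ^+ 2 - mdist z y ^+ 2).
Proof.
move=> thin geo g1 g2 s01 t01.
set b := mdist z x; set c := mdist z y; set a := mdist x y.
have b0 : 0 <= b := mdist_ge0 _ _.
have c0 : 0 <= c := mdist_ge0 _ _.
have a0 : 0 <= a := mdist_ge0 _ _.
have abc : a <= b + c by rewrite /b metric_sym; exact: metric_triangle.
have bac : b <= a + c by rewrite addrC /a (metric_sym x y); exact: metric_triangle.
have cab : c <= b + a by exact: metric_triangle.
(* [m] and [n] are the cosine and sine of the comparison angle at z. If a side at z has length 0 the
   other two sides are equal, and the angle 0 satisfies the law of cosines. *)
pose m := if b * c == 0 then 1 else (b ^+ 2 + c ^+ 2 - a ^+ 2) / (2 * (b * c)).
have bcm : 2 * (b * c * m) = b ^+ 2 + c ^+ 2 - a ^+ 2.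
  rewrite /m; case: ifPn => [|]; last first.
    have fE (P Q : R) : P != 0 -> 2 * (P * (Q / (2 * P))) = Q.
      by move=> P0; field.
    exact: fE.
  rewrite mulf_eq0 => /orP[] /eqP e.
    have -> : a = c by apply/eqP; rewrite eq_le; lra.
    by rewrite e; ring.
  have -> : a = b by apply/eqP; rewrite eq_le; lra.
  by rewrite e; ring.
have m1 : m ^+ 2 <= 1.
  rewrite /m; case: ifPn => [_|]; first by rewrite expr1n.
  move=> bc0; have {}bc0 : 0 < b * c by rewrite lt_neqAle eq_sym bc0 mulr_ge0.
  have bc2 : 0 < 2 * (b * c) by rewrite mulr_gt0.
  set M := _ / _; have /andP[M1 M2] : -1 <= M <= 1.
    rewrite ler_pdivlMr// ler_pdivrMr//.
    have h1 : 0 <= (a - (b - c)) * (a + (b - c)) by rewrite mulr_ge0//; lra.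
    have h2 : 0 <= (b + c - a) * (b + c + a) by rewrite mulr_ge0//; lra.
    by apply/andP; split; move: h1 h2; clear; lra.
  have : 0 <= (1 - M) * (1 + M) by rewrite mulr_ge0//; lra.
  by clear; lra.
pose n := Num.sqrt (1 - m ^+ 2).
have mn : n ^+ 2 = 1 - m ^+ 2 by rewrite sqr_sqrtr ?subr_ge0.
have dE (u v : 'rV[R]_3) r : 0 <= r -> dot3 1 (u - v) (u - v) = r ^+ 2 ->
    model_dist 0 u v = r.
  by move=> r0 e; rewrite /model_dist ltxx e sqrtr_sqr ger0_norm.
have mE a' b' : model_space 0 (vec3 a' b' 0) by rewrite /model_space/= ltxx vec3E.
pose p := vec3 (s * b) 0 0; pose q := vec3 (t * c * m) (t * c * n) 0.
have pq : dot3 1 (p - q) (p - q) = s ^+ 2 * b ^+ 2 + t ^+ 2 * c ^+ 2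
    + s * t * (a ^+ 2 - b ^+ 2 - c ^+ 2).
  rewrite vec3B dot3_vec3.
  transitivity ((s * b - t * c * m) ^+ 2 + t ^+ 2 * c ^+ 2 * n ^+ 2); first by ring.
  rewrite mn; transitivity (s ^+ 2 * b ^+ 2 + t ^+ 2 * c ^+ 2 - s * t * (2 * (b * c * m))); first by ring.
  by rewrite bcm; ring.
have h : mdist (c1 s) (c2 t) <= model_dist 0 p q.
  apply: (thin_apex (w0 := vec3 0 0 0) (w1 := vec3 b 0 0)
    (w2 := vec3 (c * m) (c * n) 0) thin geo g1 g2 s01 t01).
  - by rewrite ltxx.
  - by split; exact: mE.
  - rewrite (metric_sym y z) -/a -/b -/c; split; apply: dE => //.
    + by rewrite vec3B dot3_vec3; ring.
    + rewrite vec3B dot3_vec3.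
      transitivity (b ^+ 2 - 2 * (b * c * m) + c ^+ 2 * (m ^+ 2 + n ^+ 2)); first by ring.
      by rewrite mn bcm; ring.
    + rewrite vec3B dot3_vec3.
      transitivity (c ^+ 2 * (m ^+ 2 + n ^+ 2)); first by ring.
      by rewrite mn; ring.
  - by rewrite -/b; apply: dE; [rewrite mulr_ge0//; lra|rewrite vec3B dot3_vec3; ring].
  - by rewrite -/b; apply: dE; [rewrite mulr_ge0//; lra|rewrite vec3B dot3_vec3; ring].
  - rewrite -/c; apply: dE; first by rewrite mulr_ge0//; lra.
    rewrite vec3B dot3_vec3.
    transitivity ((1 - t) ^+ 2 * c ^+ 2 * (m ^+ 2 + n ^+ 2)); first by ring.
    by rewrite mn; ring.
  - rewrite -/c; apply: dE; first by rewrite mulr_ge0//; lra.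
    rewrite vec3B dot3_vec3.
    transitivity (t ^+ 2 * c ^+ 2 * (m ^+ 2 + n ^+ 2)); first by ring.
    by rewrite mn; ring.
move: h; rewrite /model_dist ltxx pq => h.
have E0 : 0 <= dot3 1 (p - q) (p - q).
  by rewrite /dot3 mul1r -!expr2 !addr_ge0 ?sqr_ge0.
rewrite pq in E0.
by rewrite -(sqr_sqrtr E0) ler_sqr// nnegrE ?mdist_ge0.
Qed.

Section NonflatModel.
Variables (kappa k sg : R) (C S arc : R -> R).
Hypothesis mt : model_trig sg C S.
Hypothesis k0 : 0 < k.
(** The bilinear form with value 1 on both model surfaces: the scalar product for [sg = 1], the
    opposite of the Lorentz form for [sg = -1]. With it both geometries share one computation. *)
Let inner (u v : 'rV[R]_3) : R :=
  sg * (u 0 0 * v 0 0 + u 0 1 * v 0 1) + u 0 (2 : 'I_3) * v 0 (2 : 'I_3).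
Hypothesis distE : forall u v, model_dist kappa u v = arc (inner u v) / k.
Hypothesis spaceE : forall u,
  inner u u = 1 -> 0 < u 0 (2 : 'I_3) -> model_space kappa u.
Hypothesis arcK : forall r, 0 <= r <= 1 -> arc (C r) = r.
Hypothesis arc_le : forall e r, 0 <= e <= 1 -> -1 <= r -> 0 <= sg * (1 - r) ->
  e <= arc r -> sg * r <= sg * C e.

(** Geodesic polar coordinates around (0, 0, 1): radius [r], direction the unit vector (m, n). *)
Let polar (r m n : R) := vec3 (S r * m) (S r * n) (C r).

Let inner_polar r m n r' m' n' : inner (polar r m n) (polar r' m' n') =
  C r * C r' + sg * (S r * S r' * (m * m' + n * n')).
Proof. by rewrite /inner /polar !vec3E; ring. Qed.

Let sg2 : sg * sg = 1.
Proof. by case: (model_sg mt) => ->; rewrite ?mulrNN mulr1. Qed.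

Let distC u v : model_dist kappa u v = model_dist kappa v u.
Proof. by rewrite !distE; congr (arc _ / k); rewrite /inner; ring. Qed.

Let dist_ray r r' d m n : m ^+ 2 + n ^+ 2 = 1 -> 0 <= r - r' <= 1 / 2 ->
  r - r' = k * d -> model_dist kappa (polar r m n) (polar r' m n) = d.
Proof.
move=> mn r01 rd; rewrite distE inner_polar -!expr2 mn mulr1 -(model_CB mt) arcK.
  by rewrite rd mulrC mulKf// gt_eqF.
lra.
Qed.

Let polar_space r m n : 0 <= r <= 1 / 2 -> m ^+ 2 + n ^+ 2 = 1 ->
  model_space kappa (polar r m n).
Proof.
move=> r01 mn; apply: spaceE.
  by rewrite inner_polar -!expr2 mn mulr1 (model_CS mt).
rewrite /polar vec3E.
have h1 : (1 / 2 : R) <= 1 by lra.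
have /andP[r0 r12] := r01; have /andP[] := model_C_bounds mt h1 r0 r12; lra.
Qed.

Let half_bounds (u v : R) : 0 <= u <= 1 / 2 -> 0 <= v <= 1 / 2 ->
  [/\ 0 <= u + v, u + v <= 1 & `|u - v| <= 1].
Proof. by move=> u01 v01; rewrite ler_norml; split; lra. Qed.

Let sign_mul_le (e u v w : R) : e = 1 \/ e = -1 -> v <= w ->
  0 <= e * (1 - (u + e * w)) -> 0 <= e * (1 - (u + e * v)).
Proof. by case=> ->; lra. Qed.

(** The comparison angle at z, computed from [c1 s] and [c2 t], is at most the one computed from x
    and y. Both cosines are given by the law of cosines, with the denominators cleared. *)
Lemma thin_apex_model x y z c1 c2 s t :
  thin_triangles kappa X -> geodesic_space X ->
  geod z x c1 -> geod z y c2 -> 0 <= s <= 1 -> 0 <= t <= 1 ->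
  (0 < kappa -> mdist z x + mdist x y + mdist y z < 2 * pi / Num.sqrt kappa) ->
  let a := k * mdist x y in let b := k * mdist z x in let c := k * mdist z y in
  let e := k * mdist (c1 s) (c2 t) in
  0 < b <= 1 / 2 -> 0 < c <= 1 / 2 -> a <= 1 / 2 ->
  S (s * b) * S (t * c) * (sg * (C a - C b * C c)) <=
    S b * S c * (sg * (C e - C (s * b) * C (t * c))).
Proof.
move=> thin geo g1 g2 s01 t01 peri a b c e /andP[b0 b1] /andP[c0 c1'] a1.
have a0 : 0 <= a by rewrite mulr_ge0 ?mdist_ge0// ltW.
have e0 : 0 <= e by rewrite mulr_ge0 ?mdist_ge0// ltW.
have abc : a <= b + c.
  rewrite /a /b /c -mulrDr ler_wpM2l ?(ltW k0)// (metric_sym z x).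
  exact: metric_triangle.
have bac : b <= a + c.
  rewrite /a /b /c -mulrDr ler_wpM2l ?(ltW k0)// addrC (metric_sym x y).
  exact: metric_triangle.
have cab : c <= b + a.
  by rewrite /a /b /c -mulrDr ler_wpM2l ?(ltW k0)// metric_triangle.
have esbtc : e <= s * b + t * c.
  rewrite /e /b /c !(mulrCA _ k) -mulrDr ler_wpM2l ?(ltW k0)//.
  rewrite -(geod_distl g1)// -(geod_distl g2)// (metric_sym z).
  exact: metric_triangle.
have Sb0 : 0 < S b by apply: (model_S_gt0 mt); lra.
have Sc0 : 0 < S c by apply: (model_S_gt0 mt); lra.
have SS0 : 0 < S b * S c by rewrite mulr_gt0.
pose m := sg * (C a - C b * C c) / (S b * S c).
have SSm : S b * S c * m = sg * (C a - C b * C c).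
  by rewrite /m mulrC divfK// gt_eqF.
(* For [r = 1] the lower bound of [model_C_diff] is 0: it says that [sg * C] does not increase on
   [0, 1]. Applied to [a <= b + c] and to [|b - c| <= a], it bounds the cosine [m] on both sides. *)
have /andP[m1 m2] : -1 <= m <= 1.
  rewrite ler_pdivlMr// ler_pdivrMr//; apply/andP; split.
    have /andP[+ _] := model_C_diff mt (r := 1) (x := a) (y := b + c) (lexx _) a0 abc ltac:(lra).
    rewrite (model_CD mt) expr1n subrr mul0r.
    suff -> : sg * (C a - (C b * C c - sg * (S b * S c))) =
              sg * (C a - C b * C c) + sg * sg * (S b * S c) by rewrite sg2; lra.
    by ring.
  have bca : `|b - c| <= a by rewrite ler_norml; lra.
  have /andP[+ _] := model_C_diff mt (r := 1) (x := `|b - c|) (y := a) (lexx _) (normr_ge0 _) bca ltac:(lra).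
  rewrite (model_C_norm mt) (model_CB mt) expr1n subrr mul0r.
  suff -> : sg * (C b * C c + sg * (S b * S c) - C a) =
            sg * sg * (S b * S c) - sg * (C a - C b * C c) by rewrite sg2; lra.
  by ring.
have m2le : m ^+ 2 <= 1.
  have : 0 <= (1 - m) * (1 + m) by rewrite mulr_ge0//; lra.
  by lra.
pose n := Num.sqrt (1 - m ^+ 2).
have mn : m ^+ 2 + n ^+ 2 = 1 by rewrite sqr_sqrtr ?subr_ge0// addrC subrK.
have mn0 : 1 ^+ 2 + 0 ^+ 2 = 1 :> R by rewrite expr1n expr0n addr0.
have polar0 : polar 0 1 0 = polar 0 m n by rewrite /polar (model_S0 mt) !mul0r.
have scale (u v : R) : 0 <= u <= 1 -> 0 < v <= 1 / 2 -> 0 <= u * v <= 1 / 2.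
  move=> /andP[u0 u1] /andP[v0 v1]; rewrite mulr_ge0 ?(ltW v0)//=.
  by rewrite (le_trans _ v1)// ler_piMl// ltW.
have b01 : 0 <= b <= 1 / 2 by rewrite ltW.
have c01 : 0 <= c <= 1 / 2 by rewrite ltW.
have r01 : 0 <= (0 : R) <= 1 / 2 by rewrite lexx divr_ge0.
have sb01 : 0 <= s * b <= 1 / 2 by apply: scale => //; rewrite b0.
have tc01 : 0 <= t * c <= 1 / 2 by apply: scale => //; rewrite c0.
have scaleB (u v : R) : 0 <= u <= 1 -> 0 < v <= 1 / 2 -> 0 <= v - u * v <= 1 / 2.
  move=> u01 v0; have -> : v - u * v = (1 - u) * v by ring.
  by apply: scale => //; lra.
have sb' : 0 <= b - s * b <= 1 / 2 by apply: scaleB => //; rewrite b0.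
have tc' : 0 <= c - t * c <= 1 / 2 by apply: scaleB => //; rewrite c0.
pose p := polar (s * b) 1 0; pose q := polar (t * c) m n.
have pq : inner p q = C (s * b) * C (t * c) + sg * (S (s * b) * S (t * c) * m).
  by rewrite inner_polar mul1r mul0r addr0.
have dpq : mdist (c1 s) (c2 t) <= model_dist kappa p q.
  have kK r : k * r / k = r by rewrite mulrC mulKf// gt_eqF.
  apply: (thin_apex (w0 := polar 0 1 0) (w1 := polar b 1 0)
    (w2 := polar c m n) thin geo g1 g2 s01 t01 peri).
  - by split; apply: polar_space.
  - split.
    + by rewrite distC; apply: dist_ray => //; rewrite subr0.
    + rewrite distE inner_polar mul1r mul0r addr0 SSm mulrA sg2 mul1r.
      by rewrite addrC subrK arcK ?kK//; lra.
    + by rewrite polar0 (metric_sym y); apply: dist_ray => //; rewrite subr0.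
  - by rewrite distC; apply: dist_ray => //; rewrite ?subr0// /b; ring.
  - by rewrite distC; apply: dist_ray => //; rewrite // /b; ring.
  - by apply: dist_ray => //; rewrite // /c; ring.
  - by rewrite polar0; apply: dist_ray => //; rewrite ?subr0// /c; ring.
have Ssb : 0 <= S (s * b) by apply: (model_S_ge0 mt); lra.
have Stc : 0 <= S (t * c) by apply: (model_S_ge0 mt); lra.
have SS : 0 <= S (s * b) * S (t * c) by rewrite mulr_ge0.
have ler : e <= arc (inner p q).
  by move: dpq; rewrite distE ler_pdivlMr// mulrC.
have [sbtc0 sbtc1 sbtcB] := half_bounds sb01 tc01.
have e01 : 0 <= e <= 1 by rewrite e0 (le_trans esbtc).
set y0 := C (s * b) * C (t * c) + _ in pq.
have Ssbtc m' : m' <= 1 -> S (s * b) * S (t * c) * m' <= S (s * b) * S (t * c).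
  by move=> m'1; rewrite ler_piMr.
have sgm : `|sg * m| <= 1.
  by rewrite normrM (model_sg_norm mt) mul1r ler_norml m1.
(* [y1] and [y2] place [y0] in the domain of [arc]: [-1, 1] on the sphere, [1, infinity) in the
   hyperbolic plane. *)
have y1 : -1 <= y0.
  have := model_C_bounds mt (r := 1) (x := s * b + t * c) (lexx _) sbtc0 sbtc1.
  have := model_C_bounds mt (r := 1) (lexx _) (normr_ge0 _) sbtcB.
  rewrite (model_C_norm mt) (model_CB mt) (model_CD mt) /y0 expr1n subrr.
  move=> /andP[k1 _] /andP[k2 _].
  have {}k1 : S (s * b) * S (t * c) <= C (s * b) * C (t * c).
    by case: (model_sg mt) k1 k2 => ->; rewrite ?mul1r ?mulN1r ?opprK ?subr_ge0.
  move: sgm; rewrite ler_norml => /andP[sgm1 _].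
  have := Ssbtc (- (sg * m)); rewrite lerNl => /(_ sgm1).
  rewrite mulrN mulrCA => {}k2.
  by rewrite (le_trans (lerN10 _))// -lerBlDr sub0r (le_trans k2).
have y2 : 0 <= sg * (1 - y0).
  have := model_C_diff mt (lexx 1) (lexx 0) (normr_ge0 (s * b - t * c)) sbtcB.
  rewrite (model_C_norm mt) (model_CB mt) (model_C0 mt) /y0 expr1n subrr mul0r.
  by move=> /andP[+ _]; apply: sign_mul_le (Ssbtc _ m2); exact: model_sg mt.
rewrite pq in ler; have {}ler := arc_le e01 y1 y2 ler.
rewrite -SSm.
apply: (le_trans (_ : _ <= S b * S c * (sg * (y0 - C (s * b) * C (t * c))))).
  rewrite /y0 [X in sg * X](_ : _ = sg * (S (s * b) * S (t * c) * m)); last by ring.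
  by rewrite [sg * (sg * _)]mulrA sg2 mul1r le_eqVlt; apply/orP; left; apply/eqP; ring.
by rewrite ler_wpM2l ?(ltW SS0)// !mulrBr lerB.
Qed.

Lemma nonflat_almost_flat : thin_triangles kappa X -> geodesic_space X ->
  (0 < kappa -> k = Num.sqrt kappa) ->
  almost_flat X (32 * k ^+ 2) (4 * k)^-1.
Proof.
move=> thin geo kE r /andP[r0 rk].
have kr : k * r <= 1 / 4.
  rewrite (le_trans (ler_wpM2l (ltW k0) rk))// invfM mulrCA divff ?gt_eqF//; lra.
have kr0 : 0 <= k * r by rewrite mulr_ge0// ltW.
have kr2 : k * r <= 2 * (k * r) by lra.
have kr4 : 2 * (k * r) <= 1 / 2 by lra.
have peri (d1 d2 d3 : R) : d1 <= r -> d2 <= 2 * r -> d3 <= r ->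
    0 < kappa -> d1 + d2 + d3 < 2 * pi / Num.sqrt kappa.
  move=> h1 h2 h3 kappa0; rewrite -kE//.
  apply: (le_lt_trans (_ : _ <= 4 * r)); first by lra.
  rewrite ltr_pdivlMr//; have := @pi_ge2 R; lra.
set q := 32 * k ^+ 2 * r ^+ 2.
(* The factor 8 is the loss in [model_contract]. It is used with the rescaled radius [2 * (k * r)],
   because third sides and medians may be as long as [2 * r]. *)
have qE : q = 8 * (2 * (k * r)) ^+ 2 by rewrite /q; ring.
have q0 : 0 <= q by rewrite qE mulr_ge0// sqr_ge0.
have kle d d' : d <= d' -> k * d <= k * d' by apply: ler_wpM2l; exact: ltW.
have kge0 (u v : X) : 0 <= k * mdist u v by rewrite mulr_ge0 ?mdist_ge0 ?ltW.
have gt0 (u v : X) : mdist u v != 0 -> 0 < k * mdist u v.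
  by move=> uv; rewrite mulr_gt0// lt_neqAle eq_sym uv mdist_ge0.
split.
  move=> z x x' c c' s g g' zx zx' s01; have /andP[s0 s1] := s01.
  have [e|zx0] := eqVneq (mdist z x) 0.
    rewrite (contracting_degenerate g g' s01 (or_introl e)).
    by rewrite ler_peMl ?lerDl// mulr_ge0// mdist_ge0.
  have [e|zx'0] := eqVneq (mdist z x') 0.
    rewrite (contracting_degenerate g g' s01 (or_intror e)).
    by rewrite ler_peMl ?lerDl// mulr_ge0// mdist_ge0.
  have xx' : mdist x x' <= mdist z x + mdist z x'.
    by rewrite (metric_sym z x); exact: metric_triangle.
  have ss' : mdist (c s) (c' s) <= s * mdist z x + s * mdist z x'.
    rewrite -(geod_distl g)// -(geod_distl g')// (metric_sym z (c s)).
    exact: metric_triangle.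
  have sle d : 0 <= d -> d <= r -> s * d <= r.
    by move=> d0; apply: le_trans; rewrite ler_piMl//; lra.
  have /kle ss2 : mdist (c s) (c' s) <= 2 * r.
    have := sle _ (mdist_ge0 _ _) zx; have := sle _ (mdist_ge0 _ _) zx'; lra.
  have xx2 : mdist x x' <= 2 * r by lra.
  have xz : mdist x' z <= r by rewrite metric_sym.
  have h := @thin_apex_model x x' z c c' s s thin geo g g' s01 s01
    (peri _ _ _ zx xx2 xz).
  move/kle in xx2; have /kle zxr := zx; have /kle zxr' := zx'.
  have := model_contract mt (r := 2 * (k * r)) (a := k * mdist x x')
    (b := k * mdist z x) (c := k * mdist z x') (e := k * mdist (c s) (c' s)) (s := s).
  rewrite -qE !gt0//= !kge0/=.
  have -> : (1 + q) * (s * (k * mdist x x')) = k * ((1 + q) * (s * mdist x x')) by ring.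
  rewrite ler_pM2l//; apply => //.
  - exact: le_trans zxr kr2.
  - exact: le_trans zxr' kr2.
  - by rewrite mulrCA.
  - by rewrite mulrCA.
  - by rewrite -mulrBr normrM gtr0_norm// ler_wpM2l ?(ltW k0)// mdist_diff_le.
  apply: h; rewrite ?gt0//=.
  - by rewrite (le_trans zxr)// (le_trans kr2).
  - by rewrite (le_trans zxr')// (le_trans kr2).
  - by rewrite (le_trans xx2)// mulrCA.
move=> x y z c g xy xz yz.
have h2 : 0 <= (2^-1 : R) <= 1 by rewrite invr_ge0 invf_le1//=; lra.
have one01 : 0 <= (1 : R) <= 1 by rewrite ler01 lexx.
have [e|yz0] := eqVneq (mdist y z) 0.
  by apply: short_medians_degenerate => //; left.
have [e|yx0] := eqVneq (mdist y x) 0.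
  by apply: short_medians_degenerate => //; right.
have [c2 /geodP g2] := geo y x.
have c21 : c2 1 = x by case: g2.
have zx2 : mdist z x <= 2 * r by rewrite metric_sym (le_trans xz)// ler_peMl// ler1n.
have := @thin_apex_model z x y c c2 2^-1 1 thin geo g g2 h2 one01
    (peri _ _ _ yz zx2 xy).
rewrite c21 => h; cbv zeta in h; rewrite !(mul1r (k * _)) in h.
have xm : mdist (c 2^-1) x <= mdist y z + mdist x y.
  have : mdist (c 2^-1) x <= mdist (c 2^-1) y + mdist x y.
    by rewrite (metric_sym x y); exact: metric_triangle.
  rewrite (metric_sym _ y) (geod_distl g)//; have := mdist_ge0 y z; lra.
have /kle xm2 : mdist (c 2^-1) x <= 2 * r by lra.
have /kle yzr := yz; have /kle xyr := xy; have /kle xzr := xz.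
have := model_median mt (r := 2 * (k * r)) (a := k * mdist z x)
    (b := k * mdist y z) (c := k * mdist y x) (e := k * mdist (c 2^-1) x).
rewrite (metric_sym z x) (metric_sym y x) in h yx0 *.
rewrite !gt0//= !kge0/= => /(_ kr4 (le_trans yzr kr2) (le_trans xyr kr2) (le_trans xzr kr2)).
rewrite [in leRHS]mulrCA in xm2.
have tri1 : `|mdist x z - mdist x y| <= mdist y z.
  by rewrite (metric_sym y z) mdist_diff_le.
have tri2 : mdist y z <= mdist x z + mdist x y.
  by rewrite addrC (metric_sym x y); exact: metric_triangle.
move=> /(_ xm2); rewrite -mulrBr normrM gtr0_norm// !ler_pM2l// -mulrDr ler_pM2l//.
have kr5 := le_trans kr2 kr4.
rewrite !gt0//= (le_trans yzr kr5) (le_trans xyr kr5) (le_trans xzr kr5) in h.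
move=> /(_ tri1 tri2 (h isT isT isT)).
rewrite (metric_sym (c 2^-1)) => h'.
have k2 : 0 < k ^+ 2 by rewrite exprn_gt0.
rewrite -(ler_pM2l k2).
have h4 : 0 <= q * mdist y z ^+ 2 by rewrite mulr_ge0 ?sqr_ge0.
have : 0 <= k ^+ 2 * (q * mdist y z ^+ 2) by rewrite mulr_ge0 ?sqr_ge0.
move: h'; rewrite (_ : 4 * (2 * (k * r)) ^+ 2 = q / 2); last by rewrite qE; field.
lra.
Qed.

End NonflatModel.

Lemma spherical_almost_flat kappa : 0 < kappa -> thin_triangles kappa X ->
  geodesic_space X -> exists C, 0 <= C /\ exists2 r0, 0 < r0 & almost_flat X C r0.
Proof.
move=> kappa0 thin geo; pose k := Num.sqrt kappa.
have k0 : 0 < k by rewrite sqrtr_gt0.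
exists (32 * k ^+ 2); split; first by rewrite mulr_ge0// sqr_ge0.
exists (4 * k)^-1; first by rewrite invr_gt0 mulr_gt0.
apply: (nonflat_almost_flat (kappa := kappa) (arc := @acos R)
  (model_trig_cos R) k0) => //.
- move=> u v; rewrite /model_dist kappa0 /dot3; congr (acos _ / _); ring.
- move=> u uu _; rewrite /model_space/= kappa0 /dot3 -[RHS]uu; ring.
- by move=> r r01; rewrite cosK// in_itv/=; have := @pi_ge2 R; lra.
- move=> e r e01 r1 r2 er; rewrite !mul1r leNgt; apply/negP.
  have r11 : -1 <= r <= 1 by lra.
  rewrite -[ltRHS](@acosK _ r) ?in_itv//= ltr_cos ?in_itv/= ?acos_ge0 ?acos_lepi//.
    by rewrite ltNge er.
  by have := @pi_ge2 R; lra.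
Qed.

Lemma arcosh_cosh (r : R) : 0 <= r -> arcosh (cosh r) = r.
Proof.
move=> r0; have e1 := expRxMexpNx_1 r.
have -> : arcosh (cosh r) = ln (cosh r + Num.sqrt (sinh r ^+ 2)).
  rewrite /arcosh; congr (ln (_ + Num.sqrt _)).
  have -> : cosh r ^+ 2 - 1 = cosh r ^+ 2 - expR r * expR (- r) by rewrite e1.
  rewrite /cosh /sinh; lra.
rewrite sqrtr_sqr ger0_norm.
  by rewrite /cosh /sinh -[RHS]expRK; congr ln; lra.
by rewrite /sinh divr_ge0// subr_ge0 ler_expR; lra.
Qed.

Lemma le_arcosh (e r : R) : 0 <= e -> 1 <= r -> e <= arcosh r -> cosh e <= r.
Proof.
move=> e0 r1; rewrite /arcosh; set q := Num.sqrt _.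
have q0 : 0 <= q := sqrtr_ge0 _.
have qq : q ^+ 2 = r ^+ 2 - 1 by rewrite sqr_sqrtr// subr_ge0 expr_ge1//; lra.
have w0 : 0 < r + q by lra.
rewrite -ler_expR lnK ?posrE// => ew.
have E1 := expRxMexpNx_1 e; have E0 := expR_gt0 e; have E'0 := expR_gt0 (- e).
have ge1 : 1 <= expR e by rewrite -expR0 ler_expR.
have E'1 : expR (- e) <= 1 by rewrite -expR0 ler_expR oppr_le0.
have w'0 : 0 <= r - q.
  rewrite -(pmulr_lge0 _ w0) (_ : (r - q) * (r + q) = 1) ?ler01//.
  by rewrite [LHS](_ : _ = r ^+ 2 - q ^+ 2); [rewrite qq; ring|ring].
have w'1 : r - q <= 1.
  have : (r - q) * 1 <= (r - q) * (r + q) by rewrite ler_wpM2l//; lra.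
  by rewrite (_ : (r - q) * (r + q) = r ^+ 2 - q ^+ 2); [rewrite qq; lra|ring].
(* [r + q] and [r - q] are mutually inverse, and so are the two exponentials; the product therefore
   expands to [2 * (r - cosh e)]. *)
have : 0 <= (r + q - expR e) * (1 - expR (- e) * (r - q)).
  by rewrite mulr_ge0 ?subr_ge0// mulr_ile1// ltW.
have -> : (r + q - expR e) * (1 - expR (- e) * (r - q)) =
  r + q - expR e - expR (- e) * (r ^+ 2 - q ^+ 2) +
  expR e * expR (- e) * (r - q) by ring.
rewrite E1 qq /cosh; lra.
Qed.

Lemma hyperbolic_almost_flat kappa : kappa < 0 -> thin_triangles kappa X ->
  geodesic_space X -> exists C, 0 <= C /\ exists2 r0, 0 < r0 & almost_flat X C r0.
Proof.
move=> kappa0 thin geo; pose k := Num.sqrt (- kappa).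
have kappaN : (0 < kappa) = false by apply/negbTE; rewrite -leNgt ltW.
have k0 : 0 < k by rewrite sqrtr_gt0 oppr_gt0.
exists (32 * k ^+ 2); split; first by rewrite mulr_ge0// sqr_ge0.
exists (4 * k)^-1; first by rewrite invr_gt0 mulr_gt0.
apply: (nonflat_almost_flat (kappa := kappa) (arc := @arcosh R)
  (model_trig_cosh R) k0) => //.
- move=> u v; rewrite /model_dist kappaN kappa0 /dot3; congr (arcosh _ / _); ring.
- move=> u uu u0; rewrite /model_space/= kappaN kappa0; split => //.
  by rewrite -[in RHS]uu /dot3; ring.
- by move=> r /andP[r0 _]; exact: arcosh_cosh.
- move=> e r /andP[e0 _] r1 r2 er; rewrite !mulN1r lerN2.
  by apply: le_arcosh => //; lra.
- by rewrite kappaN.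
Qed.

Lemma flat_almost_flat r0 : thin_triangles 0 X -> geodesic_space X ->
  almost_flat X 0 r0.
Proof.
move=> thin geo r _; rewrite mul0r; split.
  move=> z x x' c c' s g g' _ _ s01.
  have := thin_apex0 thin geo g g' s01 s01.
  have -> : s ^+ 2 * mdist z x ^+ 2 + s ^+ 2 * mdist z x' ^+ 2 +
     s * s * (mdist x x' ^+ 2 - mdist z x ^+ 2 - mdist z x' ^+ 2) =
     (s * mdist x x') ^+ 2 by ring.
  by rewrite ler_sqr ?nnegrE ?mulr_ge0 ?mdist_ge0 ?addr0 ?mul1r//; lra.
move=> x y z c g _ _ _.
have [c2 /geodP g2] := geo y x.
have c21 : c2 1 = x by case: g2.
have h2 : 0 <= (2^-1 : R) <= 1 by rewrite invr_ge0 invf_le1//=; lra.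
have one01 : 0 <= (1 : R) <= 1 by rewrite ler01 lexx.
have := thin_apex0 thin geo g g2 h2 one01.
rewrite c21 (metric_sym (c _)) (metric_sym z x) (metric_sym y x); lra.
Qed.

Lemma cat_almost_flat kappa : cat_space kappa X ->
  exists C, 0 <= C /\ exists2 r0, 0 < r0 & almost_flat X C r0.
Proof.
move=> [_ geo thin]; have [kappa0|kappa0|kappaE] := ltgtP 0 kappa.
- exact: spherical_almost_flat kappa0 thin geo.
- exact: hyperbolic_almost_flat kappa0 thin geo.
- exists 0; split => //; exists 1 => //; apply: flat_almost_flat => //.
  by rewrite kappaE.
Qed.

End Comparison.

(** * Affine functions *)

Section AffineCocycles.
Variables (R : realType) (X : metricType R).
Implicit Types (x y z : X) (c : R -> X) (F G : X -> X -> R) (K s t r q : R).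

(** What the constructions of H and Y take from the curvature bound, expressed without kappa and
    invariant under isometries. *)
Definition good := geodesic_space X /\
  exists C, 0 <= C /\ exists2 r0, 0 < r0 & almost_flat X C r0.

(* F x y = f y - f x for an affine function f. *)
Definition affine_cocycle F :=
  (forall x y z, F x y + F y z = F x z) /\
  (forall x y c s, geod x y c -> 0 <= s <= 1 -> F x (c s) = s * F x y).

Lemma cocyclexx F x : affine_cocycle F -> F x x = 0.
Proof. by move=> [h _]; have := h x x x; lra. Qed.

Lemma cocycleN F x y : affine_cocycle F -> F y x = - F x y.
Proof. by move=> aF; have := cocyclexx x aF; rewrite -(aF.1 x y x); lra. Qed.

(** Moving both points towards z scales [F] exactly, while distances shrink by the same factor up to
    [1 + q]. Slopes can therefore be measured as close to z as desired. *)
Lemma cocycle_contract F z x y c c' s : affine_cocycle F ->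
  geod z x c -> geod z y c' -> 0 <= s <= 1 -> F (c s) (c' s) = s * F x y.
Proof.
move=> aF g g' s01; rewrite -(aF.1 _ z) (cocycleN _ _ aF) (aF.2 _ _ _ _ g)//.
rewrite (aF.2 _ _ _ _ g')// -(aF.1 x z y) (cocycleN _ _ aF); ring.
Qed.

Lemma almost_flat_small q : good -> 0 < q ->
  exists2 r, 0 < r & contracting X q r /\ short_medians X q r.
Proof.
move=> [_ [C [C0 [r0 r00 flat]]]] q0.
pose r := Num.min r0 (Num.min 1 (q / (C + 1))).
have r_gt0 : 0 < r by rewrite !lt_min r00 ltr01 divr_gt0//; lra.
have rr0 : r <= r0 by rewrite ge_min lexx.
have r1 : r <= 1 by rewrite !ge_min lexx orbT.
have rq : r * (C + 1) <= q by rewrite -ler_pdivlMr ?ge_min ?lexx ?orbT//; lra.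
have Crq : C * r ^+ 2 <= q.
  apply: le_trans rq; rewrite mulrC expr2 -mulrA ler_wpM2l ?(ltW r_gt0)//.
  by rewrite (le_trans (_ : _ <= 1 * C))// ?ler_wpM2r//; lra.
have rr : 0 <= r <= r0 by rewrite ltW.
have [con med] := flat r rr.
exists r => //; split.
  move=> z x x' c c' s g g' zx zx' s01.
  apply: (le_trans (con _ _ _ _ _ _ g g' zx zx' s01)).
  rewrite ler_wpM2r ?lerD2l//.
  by rewrite mulr_ge0 ?mdist_ge0//; case/andP: s01.
move=> x y z c g xy xz yz.
apply: (le_trans (med _ _ _ _ g xy xz yz)).
by rewrite lerD2l lerN2 ler_wpM2r ?divr_ge0 ?sqr_ge0// lerD2l lerN2.
Qed.

Section Lipschitz.
Variable F : X -> X -> R.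
Hypothesis aF : affine_cocycle F.
Hypothesis gX : good.

Definition lipschitz_at K z := exists2 r, 0 < r &
  forall x y, mdist z x <= r -> mdist z y <= r -> `|F x y| <= K * mdist x y.

(** Points within [d] of z' are contracted towards z until they enter the small ball on which [K] is
    valid. The radius [d] reached is independent of the radius of that ball, so steps can be
    iterated. *)
Lemma lipschitz_at_step C r0 K d z z' : 0 <= C -> almost_flat X C r0 ->
  0 <= K -> 0 < d -> 2 * d <= r0 -> mdist z z' <= d ->
  lipschitz_at K z -> lipschitz_at (K * (1 + C * (2 * d) ^+ 2)) z'.
Proof.
move=> C0 flat K0 d0 dr0 zz' [r r_gt0 Kr]; exists d => // x y z'x z'y.
have zx w : mdist z' w <= d -> mdist z w <= 2 * d.
  by move=> ?; have := metric_triangle z z' w; lra.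
pose s := Num.min 1 (r / (2 * d)).
have s0 : 0 < s by rewrite lt_min ltr01/= divr_gt0// mulr_gt0.
have s1 : s <= 1 by rewrite ge_min lexx.
have s01 : 0 <= s <= 1 by rewrite ltW.
have sr : s * (2 * d) <= r.
  by rewrite -ler_pdivlMr ?mulr_gt0// ge_min lexx orbT.
have [geo _] := gX.
have [c /geodP g] := geo z x; have [c' /geodP g'] := geo z y.
have zs w cw : mdist z' w <= d -> geod z w cw -> mdist z (cw s) <= r.
  move=> /zx zw gw; rewrite (geod_distl gw)//; apply: le_trans sr.
  by rewrite ler_wpM2l// ltW.
have d2 : 0 <= 2 * d <= r0 by rewrite dr0 mulr_ge0// ltW.
have [con _] := flat _ d2.
have := con _ _ _ _ _ _ g g' (zx _ z'x) (zx _ z'y) s01.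
have := Kr _ _ (zs _ _ z'x g) (zs _ _ z'y g').
rewrite (cocycle_contract aF g g' s01) normrM gtr0_norm// => h1 h2.
rewrite -(ler_pM2l s0) (le_trans h1)// (le_trans (ler_wpM2l K0 h2))//.
by rewrite le_eqVlt; apply/orP; left; apply/eqP; ring.
Qed.

Lemma lipschitz_at_geod C r0 K z w N : 0 <= C -> almost_flat X C r0 ->
  0 <= K -> let d := (mdist z w + 1) / N.+1%:R in
  let q := C * (2 * d) ^+ 2 in
  2 * d <= r0 -> N.+1%:R * q < 1 ->
  lipschitz_at K z -> lipschitz_at (K / (1 - N.+1%:R * q)) w.
Proof.
move=> C0 flat K0 d q dr0 q1 Kz; have [geo _] := gX.
have N0 : 0 < N.+1%:R :> R by rewrite ltr0n.
have d0 : 0 < d by rewrite divr_gt0// ltr_wpDl ?mdist_ge0.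
have q0 : 0 <= q by rewrite mulr_ge0 ?sqr_ge0.
have [c /geodP [c0 c1 cd]] := geo z w.
(* This form is stable under a factor [1 + q], as (1 + q) (1 - (i + 1) q) is at most 1 - i q. The 1
   added to the distance in [d] keeps the step positive when z and w coincide. *)
suff h i : (i <= N.+1)%N -> lipschitz_at (K / (1 - i%:R * q)) (c (i%:R / N.+1%:R)).
  by have := h _ (leqnn _); rewrite divff ?gt_eqF// c1.
elim: i => [|i IH] iN; first by rewrite !mul0r subr0 divr1 c0.
have iq : i.+1%:R * q < 1.
  by rewrite (le_lt_trans _ q1)// ler_wpM2r// ler_nat.
have iq' : i%:R * q < 1 by rewrite (le_lt_trans _ iq)// ler_wpM2r// ler_nat.
have K1 : 0 <= K / (1 - i%:R * q) by rewrite divr_ge0// subr_ge0 ltW.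
have i01 j : (j <= N.+1)%N -> 0 <= (j%:R / N.+1%:R : R) <= 1.
  by move=> jN; rewrite divr_ge0//= ler_pdivrMr// mul1r ler_nat.
have ci : mdist (c (i%:R / N.+1%:R)) (c (i.+1%:R / N.+1%:R)) <= d.
  rewrite cd ?i01 ?(ltnW iN)// distrC -mulrBl -natrB// subSnn mul1r.
  by rewrite gtr0_norm ?invr_gt0// /d mulrC ler_wpM2r ?invr_ge0// lerDl.
have [r r_gt0 Kr] := lipschitz_at_step C0 flat K1 d0 dr0 ci (IH (ltnW iN)).
exists r => // x y ix iy; apply: (le_trans (Kr _ _ ix iy)).
rewrite ler_wpM2r ?mdist_ge0// -mulrA ler_wpM2l// -/q.
rewrite mulrC ler_pdivrMr ?subr_gt0// [leRHS]mulrC ler_pdivlMr ?subr_gt0//.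
rewrite -subr_ge0 -natr1.
have -> : 1 - i%:R * q - (1 + q) * (1 - (i%:R + 1) * q) = (i%:R + 1) * q ^+ 2 by ring.
by rewrite mulr_ge0 ?sqr_ge0// addr_ge0.
Qed.

(* A local Lipschitz constant propagates along geodesics with a loss that is
   quadratic in the step length, hence negligible. *)
Lemma lipschitz_at_global K z x y : 0 <= K ->
  lipschitz_at K z -> `|F x y| <= K * mdist x y.
Proof.
move=> K0 Kz; have [geo [C [C0 [r0 r00 flat]]]] := gX.
have step e : 0 < e <= 1 / 2 -> `|F x y| * (1 - e) <= K * mdist x y.
  move=> /andP[e0 e1]; set L := mdist z x + 1.
  have L0 : 0 < L by rewrite ltr_wpDl ?mdist_ge0.
  (* The first bound makes each step short enough for [almost_flat]; the second makes the
     accumulated loss, 4 C L^2 divided by the number of steps, at most [e]. *)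
  pose B := Num.max (2 * L / r0) (4 * C * L ^+ 2 / e).
  have [N BN] : exists N, B <= N.+1%:R.
    by exists (Num.truncn B); rewrite ltW// truncnS_gt.
  have N0 : 0 < N.+1%:R :> R by rewrite ltr0n.
  move: BN; rewrite ge_max !ler_pdivrMr// => /andP[N1 N2].
  have q1 : N.+1%:R * (C * (2 * (L / N.+1%:R)) ^+ 2) <= e.
    have -> : N.+1%:R * (C * (2 * (L / N.+1%:R)) ^+ 2) = 4 * C * L ^+ 2 / N.+1%:R.
      by move: (N.+1%:R : R) N0 => n n0; field; rewrite gt_eqF.
    by rewrite ler_pdivrMr// [leRHS]mulrC.
  have h1 : 2 * (L / N.+1%:R) <= r0 by rewrite mulrA ler_pdivrMr// [leRHS]mulrC.
  have h2 : N.+1%:R * (C * (2 * (L / N.+1%:R)) ^+ 2) < 1.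
    by apply: (le_lt_trans q1); lra.
  have [r r_gt0 Kr] := lipschitz_at_geod C0 flat K0 h1 h2 Kz.
  set q := N.+1%:R * _ in q1 h2 Kr.
  have [c /geodP g] := geo x y.
  (* The constant is now valid near x. As [F] is linear along geodesics from x, the pair x, y can be
     shrunk to a pair x, [c s] inside that neighbourhood. *)
  pose s := Num.min 1 (r / (mdist x y + 1)).
  have xy1 : 0 < mdist x y + 1 by rewrite ltr_wpDl ?mdist_ge0.
  have s0 : 0 < s by rewrite lt_min ltr01/= divr_gt0.
  have s1 : s <= 1 by rewrite ge_min lexx.
  have s01 : 0 <= s <= 1 by rewrite ltW.
  have sr : s * (mdist x y + 1) <= r by rewrite -ler_pdivlMr// ge_min lexx orbT.
  have := Kr x (c s); rewrite mdistxx (geod_distl g)// (aF.2 _ _ _ _ g)//.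
  have srxy : s * mdist x y <= r.
    by apply: le_trans sr; rewrite ler_wpM2l ?(ltW s0)// lerDl.
  move=> /(_ (ltW r_gt0) srxy).
  rewrite normrM gtr0_norm// mulrCA ler_pM2l// mulrAC ler_pdivlMr ?subr_gt0// => h.
  apply: le_trans h; rewrite ler_wpM2l//; lra.
apply/ler_addgt0Pr => e e0.
pose e' := Num.min (1 / 2) (e / (`|F x y| + 1)).
have F1 : 0 < `|F x y| + 1 by rewrite ltr_wpDl.
have e'0 : 0 < e' by rewrite lt_min divr_gt0//= divr_gt0.
have := step e'; rewrite e'0 ge_min lexx => /(_ isT).
have : e' * (`|F x y| + 1) <= e by rewrite -ler_pdivlMr// ge_min lexx orbT.
have := normr_ge0 (F x y); nra.
Qed.

(** If [K] is no Lipschitz constant globally, it is none near z, by [lipschitz_at_global];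
    contraction towards z then realises every smaller scale. The parameter [t] acts as a time along
    the gradient: distance about [K * t], increase [K ^+ 2 * t]. Two functions can thus be run for
    the same time. *)
Lemma steep_pair K q r z : 0 <= q -> 0 < r -> contracting X q r ->
  K = 0 \/ 0 < K /\ ~ (forall x y, `|F x y| <= K * mdist x y) ->
  exists2 t0, 0 < t0 & forall t, 0 < t <= t0 -> exists x y,
    [/\ mdist z x <= r, mdist z y <= r, F x y = K ^+ 2 * t &
        mdist x y <= (1 + q) * (K * t)].
Proof.
move=> q0 r0 con [->|[K0 nK]].
  exists 1 => // t t01; exists z, z.
  by rewrite mdistxx (cocyclexx _ aF) expr0n !mul0r mulr0 ltW.
have [x [y [zx zy xy]]] : exists x y,
    [/\ mdist z x <= r, mdist z y <= r & K * mdist x y < F x y].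
  apply: contrapT => no; apply: nK => x y.
  apply: (@lipschitz_at_global K z x y (ltW K0)).
  exists r => // {x y} x y zx zy.
  rewrite ler_norml; apply/andP; split; rewrite leNgt; apply/negP => h; apply: no.
    by exists y, x; split => //; rewrite (cocycleN x y aF) metric_sym ltrNr.
  by exists x, y.
have F0 : 0 < F x y by rewrite (le_lt_trans _ xy)// mulr_ge0 ?mdist_ge0// ltW.
have K2 : 0 < K ^+ 2 by rewrite exprn_gt0.
exists (F x y / K ^+ 2); first by rewrite divr_gt0.
move=> t /andP[t0]; rewrite ler_pdivlMr// mulrC => t1.
pose s := K ^+ 2 * t / F x y.
have s0 : 0 < s by rewrite divr_gt0// mulr_gt0.
have s01 : 0 <= s <= 1 by rewrite ltW//= ler_pdivrMr// mul1r.
have sF : s * F x y = K ^+ 2 * t by rewrite divfK// gt_eqF.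
have [geo _] := gX.
have [c /geodP g] := geo z x; have [c' /geodP g'] := geo z y.
have sle d : 0 <= d -> d <= r -> s * d <= r.
  by move=> d0; apply: le_trans; rewrite ler_piMl//; case/andP: s01.
exists (c s), (c' s); split.
- by rewrite (geod_distl g)// sle// mdist_ge0.
- by rewrite (geod_distl g')// sle// mdist_ge0.
- by rewrite (cocycle_contract aF g g').
- apply: (le_trans (con _ _ _ _ _ _ g g' zx zy s01)).
  rewrite ler_wpM2l ?addr_ge0// -(ler_pM2l K0).
  apply: (le_trans (_ : _ <= s * F x y)).
    by rewrite mulrCA ler_wpM2l ?(ltW s0)// ltW.
  by rewrite sF le_eqVlt; apply/orP; left; apply/eqP; ring.
Qed.

End Lipschitz.

Lemma affine_cocycleD F G : affine_cocycle F -> affine_cocycle G ->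
  affine_cocycle (fun x y => F x y + G x y).
Proof.
move=> aF aG; split=> [x y z|x y c s g s01].
  by rewrite -(aF.1 x y z) -(aG.1 x y z); ring.
by rewrite (aF.2 _ _ _ _ g)// (aG.2 _ _ _ _ g)//; ring.
Qed.

Lemma affine_cocycleZ a F : affine_cocycle F ->
  affine_cocycle (fun x y => a * F x y).
Proof.
move=> aF; split=> [x y z|x y c s g s01]; first by rewrite -(aF.1 x y z); ring.
by rewrite (aF.2 _ _ _ _ g)//; ring.
Qed.

(** By contraction from y, y', x and x', the sides of a b c d are at most about half of x x' and y
    y'. The medians from b and d to the midpoint of a c then bound b d, as in the parallelogram
    law. *)
Lemma parallelogram_diagonals q r x x' y y' (a b c d : X) cxy cx'y cx'y' cxy' :
  0 <= q -> contracting X q r -> short_medians X q r -> geodesic_space X ->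
  geod x y cxy -> geod x' y cx'y -> geod x' y' cx'y' -> geod x y' cxy' ->
  a = cxy 2^-1 -> b = cx'y 2^-1 -> c = cx'y' 2^-1 -> d = cxy' 2^-1 ->
  mdist x y <= r -> mdist x' y <= r -> mdist x' y' <= r -> mdist x y' <= r ->
  mdist a b <= r -> mdist b c <= r -> mdist c d <= r -> mdist d a <= r ->
  mdist a c <= r ->
  (1 - q) * (mdist a c ^+ 2 + mdist b d ^+ 2) <=
  (1 + q) ^+ 2 * (mdist x x' ^+ 2 + mdist y y' ^+ 2) / 2.
Proof.
move=> q0 con med geo gxy gx'y gx'y' gxy' aE bE cE dE xy x'y x'y' xy' ab bc cd da ac.
have h2 : 0 <= (2^-1 : R) <= 1 by rewrite invr_ge0 invf_le1//=; lra.
have h2E : 1 - 2^-1 = 2^-1 :> R by lra.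
have abx : mdist a b <= (1 + q) * (2^-1 * mdist x x').
  have := con _ _ _ _ _ _ (geod_sym gxy) (geod_sym gx'y) _ _ h2.
  by rewrite h2E aE bE; apply; rewrite metric_sym.
have dcx : mdist c d <= (1 + q) * (2^-1 * mdist x x').
  have := con _ _ _ _ _ _ (geod_sym gxy') (geod_sym gx'y') _ _ h2.
  by rewrite h2E cE dE (metric_sym (cxy' _)); apply; rewrite metric_sym.
have ady : mdist d a <= (1 + q) * (2^-1 * mdist y y').
  by rewrite metric_sym aE dE; apply: con gxy gxy' _ _ h2.
have bcy : mdist b c <= (1 + q) * (2^-1 * mdist y y').
  by rewrite bE cE; apply: con gx'y gx'y' _ _ h2.
have sqle (u v w : X) (m : R) : mdist u v <= m -> mdist u v ^+ 2 <= m ^+ 2.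
  move=> uv; rewrite ler_sqr ?nnegrE ?mdist_ge0//.
  by rewrite (le_trans _ uv) ?mdist_ge0.
move: abx dcx ady bcy => /(sqle _ _ a) k1 /(sqle _ _ a) k2 /(sqle _ _ a) k3 /(sqle _ _ a) k4.
have [e /geodP ge] := geo a c.
have m1 : mdist b (e 2^-1) ^+ 2 <= (mdist a b ^+ 2 + mdist b c ^+ 2) / 2
    - (1 - q) * (mdist a c ^+ 2 / 4).
  by have := med b a c e ge; rewrite (metric_sym b a); exact.
have m2 : mdist d (e 2^-1) ^+ 2 <= (mdist d a ^+ 2 + mdist c d ^+ 2) / 2
    - (1 - q) * (mdist a c ^+ 2 / 4).
  by have := med d a c e ge; rewrite (metric_sym d c); exact.
have bd : mdist b d ^+ 2 <= 2 * mdist b (e 2^-1) ^+ 2 + 2 * mdist d (e 2^-1) ^+ 2.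
  have := metric_triangle b (e 2^-1) d; rewrite (metric_sym (e _)).
  set u := mdist b (e _); set v := mdist d (e _); move=> /(sqle _ _ a) h.
  by apply: (le_trans h); have := sqr_ge0 (u - v); lra.
have := mulr_ge0 q0 (sqr_ge0 (mdist b d)).
move: bd m1 m2 k1 k2 k3 k4; rewrite !exprMn.
set P := mdist a c ^+ 2; set Q := mdist b d ^+ 2.
move: (mdist b (e _) ^+ 2) (mdist d (e _) ^+ 2) (mdist a b ^+ 2) => u v w.
move: (mdist b c ^+ 2) (mdist c d ^+ 2) (mdist d a ^+ 2) => w' v' u'.
move: (mdist x x' ^+ 2) (mdist y y' ^+ 2) ((1 + q) ^+ 2) => D E k.
by move: P Q => P Q; clear; lra.
Qed.

(* Along x x' and y y', close to z, the functions F + G and F - G have almost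
   their maximal slope K, K'. In the quadrilateral of the midpoints of x y,
   x' y, x' y', x y', one diagonal bounds (F + G) x x' + (F - G) y y' through F
   and the other one through G. *)
Lemma parallelogram_steep F G A B K K' (z : X) : good ->
  affine_cocycle F -> affine_cocycle G ->
  (forall x y, `|F x y| <= A * mdist x y) ->
  (forall x y, `|G x y| <= B * mdist x y) ->
  K = 0 \/ 0 < K /\ ~ (forall x y, `|F x y + G x y| <= K * mdist x y) ->
  K' = 0 \/ 0 < K' /\ ~ (forall x y, `|F x y - G x y| <= K' * mdist x y) ->
  K ^+ 2 + K' ^+ 2 <= 2 * (A ^+ 2 + B ^+ 2).
Proof.
move=> gX aF aG FA GB steepK steepK'; have [geo _] := gX.
have aD := affine_cocycleD aF aG.
have aB : affine_cocycle (fun x y => F x y - G x y).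
  have := affine_cocycleD aF (affine_cocycleZ (-1) aG).
  by under [X in affine_cocycle X -> _]eq_fun => u do
     under eq_fun => v do rewrite mulN1r.
set S := K ^+ 2 + K' ^+ 2; set T := 2 * (A ^+ 2 + B ^+ 2).
have S0 : 0 <= S by rewrite addr_ge0 ?sqr_ge0.
have T0 : 0 <= T by rewrite mulr_ge0 ?addr_ge0 ?sqr_ge0.
have main q : 0 < q <= 1 -> (1 - q) * S <= (1 + q) ^+ 4 * T.
  move=> /andP[q0 q1]; have [r r0 [con med]] := almost_flat_small gX q0.
  have r40 : 0 < r / 4 by rewrite divr_gt0.
  have con4 : contracting X q (r / 4).
    move=> ? ? ? ? ? ? g g' d1 d2; apply: (con _ _ _ _ _ _ g g').
      by rewrite (le_trans d1)//; lra.
    by rewrite (le_trans d2)//; lra.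
  have [t1 t10 pair1] := @steep_pair _ aD gX K q (r / 4) z (ltW q0) r40 con4 steepK.
  have [t2 t20 pair2] := @steep_pair _ aB gX K' q (r / 4) z (ltW q0) r40 con4 steepK'.
  pose t := Num.min t1 t2.
  have t0 : 0 < t by rewrite lt_min t10.
  have [|x [x' [zx zx' Fxx' xx']]] := pair1 t; first by rewrite t0 ge_min lexx.
  have [|y [y' [zy zy' Fyy' yy']]] := pair2 t; first by rewrite t0 ge_min lexx orbT.
  have tri u v e e' : mdist z u <= e -> mdist z v <= e' -> mdist u v <= e + e'.
    move=> zu zv; apply: (le_trans (metric_triangle u z v)).
    by rewrite (metric_sym u) lerD.
  have [cxy /geodP gxy] := geo x y; have [cx'y /geodP gx'y] := geo x' y.
  have [cx'y' /geodP gx'y'] := geo x' y'; have [cxy' /geodP gxy'] := geo x y'.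
  have h2 : 0 <= (2^-1 : R) <= 1 by rewrite invr_ge0 invf_le1//=; lra.
  pose a := cxy 2^-1; pose b := cx'y 2^-1; pose c := cx'y' 2^-1; pose d := cxy' 2^-1.
  have mid u v e : mdist z u <= r / 4 -> mdist z v <= r / 4 -> geod u v e ->
      mdist z (e 2^-1) <= r / 2.
    move=> zu zv ge; apply: (le_trans (metric_triangle z u _)).
    rewrite (geod_distl ge)//; have := tri _ _ _ _ zu zv; lra.
  have za := mid _ _ _ zx zy gxy; have zb := mid _ _ _ zx' zy gx'y.
  have zc := mid _ _ _ zx' zy' gx'y'; have zd := mid _ _ _ zx zy' gxy'.
  have rr : r / 2 + r / 2 <= r by lra.
  have r44 : r / 4 + r / 4 <= r by lra.
  have tr2 u v (zu : mdist z u <= r / 2) (zv : mdist z v <= r / 2) :=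
    le_trans (tri _ _ _ _ zu zv) rr.
  have tr4 u v (zu : mdist z u <= r / 4) (zv : mdist z v <= r / 4) :=
    le_trans (tri _ _ _ _ zu zv) r44.
  have quad := parallelogram_diagonals (a := a) (b := b) (c := c) (d := d)
    (ltW q0) con med geo gxy gx'y gx'y' gxy'
    erefl erefl erefl erefl (tr4 _ _ zx zy) (tr4 _ _ zx' zy) (tr4 _ _ zx' zy')
    (tr4 _ _ zx zy') (tr2 _ _ za zb) (tr2 _ _ zb zc) (tr2 _ _ zc zd)
    (tr2 _ _ zd za) (tr2 _ _ za zc).
  have Fac : 2 * F a c = F x x' + F y y'.
    have := aF.2 _ _ _ _ gxy h2; have := aF.2 _ _ _ _ gx'y' h2.
    rewrite -/a -/c -(aF.1 a x c) -(aF.1 x x' c) (cocycleN x a aF) => -> ->.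
    rewrite -(aF.1 x' x y') -(aF.1 x y y') (cocycleN x x' aF); lra.
  have Gdb : 2 * G d b = G x x' - G y y'.
    have := aG.2 _ _ _ _ gxy' h2; have := aG.2 _ _ _ _ gx'y h2.
    rewrite -/d -/b -(aG.1 d x b) -(aG.1 x x' b) (cocycleN x d aG) => -> ->.
    rewrite -(aG.1 x' x y) -(aG.1 x y y') (cocycleN x x' aG); lra.
  have SE : S * t <= 2 * (A * mdist a c + B * mdist b d).
    have := FA a c; have := GB d b; rewrite !ler_norml (metric_sym d b).
    move=> /andP[_ h3] /andP[_ h4]; rewrite /S mulrDl -Fxx' -Fyy'.
    by move: Fac Gdb h3 h4; clear; lra.
  have xx2 : mdist x x' ^+ 2 <= (1 + q) ^+ 2 * (K * t) ^+ 2.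
    rewrite -exprMn ler_sqr ?nnegrE ?mdist_ge0//.
    exact: le_trans (mdist_ge0 _ _) xx'.
  have yy2 : mdist y y' ^+ 2 <= (1 + q) ^+ 2 * (K' * t) ^+ 2.
    rewrite -exprMn ler_sqr ?nnegrE ?mdist_ge0//.
    exact: le_trans (mdist_ge0 _ _) yy'.
  set P := mdist a c in quad SE; set Q := mdist b d in quad SE.
  have {xx2 yy2}quad : (1 - q) * (P ^+ 2 + Q ^+ 2) <= (1 + q) ^+ 4 * t ^+ 2 * S / 2.
    apply: (le_trans quad); rewrite ler_pM2r//.
    have -> : (1 + q) ^+ 4 * t ^+ 2 * S = (1 + q) ^+ 2 *
      ((1 + q) ^+ 2 * (K * t) ^+ 2 + (1 + q) ^+ 2 * (K' * t) ^+ 2).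
      by rewrite /S; ring.
    by rewrite ler_wpM2l ?sqr_ge0// lerD.
  have CS : (A * P + B * Q) ^+ 2 <= (A ^+ 2 + B ^+ 2) * (P ^+ 2 + Q ^+ 2).
    by have := sqr_ge0 (A * Q - B * P); clear; lra.
  have S2 : (S * t) ^+ 2 <= 2 * T * (P ^+ 2 + Q ^+ 2).
    have St : 0 <= S * t by rewrite mulr_ge0// ltW.
    apply: (le_trans (_ : _ <= (2 * (A * P + B * Q)) ^+ 2)).
      by rewrite ler_sqr// nnegrE// (le_trans St).
    by rewrite /T exprMn; move: CS; clear; lra.
  have [->|S_neq0] := eqVneq S 0; first by rewrite mulr0 mulr_ge0// exprn_ge0//; lra.
  have S_gt0 : 0 < S by rewrite lt_neqAle eq_sym S_neq0.
  have t2_gt0 : 0 < S * t ^+ 2 by rewrite mulr_gt0// exprn_gt0.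
  rewrite -(ler_pM2r t2_gt0).
  have -> : (1 - q) * S * (S * t ^+ 2) = (1 - q) * (S * t) ^+ 2 by ring.
  apply: (le_trans (ler_wpM2l _ S2)); first by lra.
  have -> : (1 - q) * (2 * T * (P ^+ 2 + Q ^+ 2)) =
    2 * T * ((1 - q) * (P ^+ 2 + Q ^+ 2)) by ring.
  apply: (le_trans (ler_wpM2l _ quad)); first by rewrite mulr_ge0.
  by rewrite le_eqVlt; apply/orP; left; apply/eqP; field.
rewrite leNgt; apply/negP => TS.
have W0 : 0 < S + 15 * T by rewrite (lt_le_trans (le_lt_trans T0 TS))// lerDl mulr_ge0.
(* For [q <= 1] the fourth power in [main] is at most 1 + 15 q, so [main] gives S - T <= q (S + 15
   T). This [q] makes the right side half of S - T. *)
pose q := (S - T) / (2 * (S + 15 * T)).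
have q0 : 0 < q by rewrite divr_gt0 ?subr_gt0// mulr_gt0.
have q1 : q <= 1 by rewrite ler_pdivrMr ?mulr_gt0//; lra.
have := main q; rewrite q0 q1 => /(_ isT) h.
have : (1 + q) ^+ 4 * T <= (1 + 15 * q) * T.
  rewrite ler_wpM2r//.
  have qn n : q ^+ n.+1 <= q.
    by rewrite exprS ler_piMr ?(ltW q0)// exprn_ile1// ltW.
  have q2 := qn 1%N; have q3 := qn 2%N; have q4 := qn 3%N.
  have -> : (1 + q) ^+ 4 = 1 + 4 * q + 6 * q ^+ 2 + 4 * q ^+ 3 + q ^+ 4 by ring.
  by move: q2 q3 q4; clear; lra.
have : q * (S + 15 * T) = (S - T) / 2.
  by rewrite /q; move: (S + 15 * T) W0 => W W0; field; rewrite gt_eqF.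
move: h; clear -TS; lra.
Qed.

End AffineCocycles.

(** * The Hilbert space of affine functions *)

Section WeightedSup.
Variables (R : realType) (I : Type) (w : I -> R).
Hypothesis w_ge0 : forall i, 0 <= w i.
Implicit Types f g : I -> R.

(** Used twice: on pairs of points weighted by their distance, for the Lipschitz norm, and with
    constant weight 1, for the uniform distance on the completion. *)
Definition wbounds f := [set K : R | 0 <= K /\ forall i, `|f i| <= K * w i].

Definition wnorm f : R := inf (wbounds f).

Lemma wnorm_le f K : wbounds f K -> wnorm f <= K.
Proof. by move=> fK; apply: ge_inf => //; exists 0 => y []. Qed.

Lemma wnorm_ge0 f : 0 <= wnorm f.
Proof.
have [/set0P[K fK]|] := boolP (wbounds f != set0).
  by apply: lb_le_inf; [exists K|move=> y []].
by rewrite negbK /wnorm => /eqP ->; rewrite inf0.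
Qed.

Lemma wnormP f K : wbounds f K -> forall i, `|f i| <= wnorm f * w i.
Proof.
move=> fK i; have [wi0|wi0] := eqVneq (w i) 0.
  by case: fK => _ /(_ i); rewrite wi0 !mulr0.
have {wi0}wi : 0 < w i by rewrite lt_neqAle eq_sym wi0 w_ge0.
rewrite -ler_pdivrMr//; apply: lb_le_inf; first by exists K.
by move=> L [_ /(_ i)]; rewrite ler_pdivrMr.
Qed.

(** Each evaluation is Lipschitz, so a Cauchy filter has pointwise limits, and these are approached
    uniformly in the weighted sense. Both completeness proofs only have to check that the limit
    function belongs to the space. *)
Lemma ball_limit (T : pseudoMetricType R) (F : set_system T) (ev : T -> I -> R) :
  ProperFilter F -> cauchy F ->
  (forall a b e i, ball a e b -> `|ev a i - ev b i| <= e * w i) ->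
  exists f : I -> R, forall e, 0 < e -> exists a : T,
    F (ball a e) /\ forall i, `|f i - ev a i| <= e * w i.
Proof.
move=> FF cF lip; have /cauchyP cF' := cF.
have ccv i : cvg ((ev ^~ i) @ F).
  apply: (@R_complete R); apply/cauchy_exP => e e0.
  have wi : 0 < w i + 1 by rewrite ltr_wpDl.
  have [a Fa] := cF' (e / (w i + 1)) (divr_gt0 e0 wi).
  exists (ev a i).
  apply: (@filterS _ F _ (ball a _) _ _ Fa) => b ab; have h := lip a b _ i ab.
  rewrite /ball/= (le_lt_trans h)// mulrAC ltr_pdivrMr// ltr_pM2l//; lra.
exists (fun i => lim ((ev ^~ i) @ F)) => e e0.
have [a Fa] := cF' e e0; exists a; split => // i.
apply/ler_addgt0Pr => d d0.
have /cvg_ballP/(_ d d0) Fd := ccv i.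
have [b [ab bd]] := filter_ex (@filterI _ F _ _ _ Fa Fd).
rewrite -(subrK (ev b i) (lim _)) -addrA (le_trans (ler_normD _ _))//.
rewrite [leRHS]addrC lerD//; last by rewrite distrC; apply: lip.
by move: bd; rewrite /ball/= => /ltW.
Qed.

End WeightedSup.

Section AffineFunctionSpace.
Variables (R : realType) (X : metricType R).
Implicit Types (x y z : X) (F G : X -> X -> R^o) (K s t : R).

Definition lip_norm F : R :=
  wnorm (fun p : X * X => mdist p.1 p.2) (fun p => F p.1 p.2).

Lemma lip_norm_le F K : 0 <= K -> (forall x y, `|F x y| <= K * mdist x y) ->
  lip_norm F <= K.
Proof. by move=> K0 h; apply: wnorm_le; split => // -[]. Qed.

Lemma lip_normP F K : 0 <= K -> (forall x y, `|F x y| <= K * mdist x y) ->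
  forall x y, `|F x y| <= lip_norm F * mdist x y.
Proof.
move=> K0 h x y.
apply: (@wnormP _ _ (fun p : X * X => mdist p.1 p.2) _ _ K _ (x, y)).
  by move=> p; exact: mdist_ge0.
by split => // -[].
Qed.

(* Only zero unless [good X], so that the norm is Euclidean for every [X]. *)
Definition hpred : {pred (X -> X -> R^o)} := fun F => `[< [/\ affine_cocycle F,
  exists2 K, 0 <= K & forall x y, `|F x y| <= K * mdist x y
  & ~ good X -> F = 0] >].

Lemma hpred_submod : submod_closed hpred.
Proof.
split=> [|a F G /asboolP[aF [K K0 FK] F0] /asboolP[aG [L L0 GL] G0]];
  apply/asboolP; split => //.
- by split=> *; rewrite ?addr0 ?mulr0.
- by exists 0 => // x y; rewrite mul0r normr0.
- exact: affine_cocycleD (affine_cocycleZ a aF) aG.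
- exists (`|a| * K + L); first by rewrite addr_ge0 ?mulr_ge0.
  move=> x y; rewrite mulrDl (le_trans (ler_normD _ _))// lerD//.
  by rewrite normrM -mulrA ler_wpM2l.
- by move=> nX; rewrite F0// G0// scaler0 addr0.
Qed.

HB.instance Definition _ := GRing.isSubmodClosed.Build _ _ hpred hpred_submod.

Record hspace := HSpace { hfun :> X -> X -> R^o ; hfunP : hfun \in hpred }.

HB.instance Definition _ := [isSub for hfun].
HB.instance Definition _ := [Choice of hspace by <:].
HB.instance Definition _ := [SubChoice_isSubLmodule of hspace by <:].

Implicit Types f g h : hspace.

Lemma haffine f : affine_cocycle f.
Proof. by case: f => F /= /asboolP[]. Qed.

Lemma hbounded f : exists2 K, 0 <= K & forall x y, `|f x y| <= K * mdist x y.
Proof. by case: f => F /= /asboolP[]. Qed.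

Lemma hnot_good f : ~ good X -> hfun f = 0.
Proof. by case: f => F /= /asboolP[]. Qed.

Lemma hfunD f g x y : (f + g) x y = f x y + g x y.
Proof. by []. Qed.

Lemma hfunB f g x y : (f - g) x y = f x y - g x y.
Proof. by []. Qed.

Lemma hfunZ a f x y : (a *: f) x y = a * f x y.
Proof. by []. Qed.

Definition hnorm f := lip_norm f.

Lemma hnorm_le f K : 0 <= K -> (forall x y, `|f x y| <= K * mdist x y) ->
  hnorm f <= K.
Proof. exact: lip_norm_le. Qed.

Lemma hnormP f x y : `|f x y| <= hnorm f * mdist x y.
Proof. by have [K K0 fK] := hbounded f; exact: lip_normP K0 fK x y. Qed.

Lemma hnorm_ge0 f : 0 <= hnorm f.
Proof. exact: wnorm_ge0. Qed.

Lemma hspaceP f g : (forall x y, f x y = g x y) -> f = g.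
Proof.
by move=> fg; apply: val_inj; apply/funext => x; apply/funext => y; exact: fg.
Qed.

Lemma hnormD f g : hnorm (f + g) <= hnorm f + hnorm g.
Proof.
apply: hnorm_le => [|x y]; first by rewrite addr_ge0 ?hnorm_ge0.
by rewrite hfunD mulrDl (le_trans (ler_normD _ _))// lerD// hnormP.
Qed.

Lemma hnormZ a f : hnorm (a *: f) = `|a| * hnorm f.
Proof.
have le b g : hnorm (b *: g) <= `|b| * hnorm g.
  apply: hnorm_le => [|x y]; first by rewrite mulr_ge0 ?hnorm_ge0.
  by rewrite hfunZ normrM -mulrA ler_wpM2l// hnormP.
apply/eqP; rewrite eq_le le/=.
have [->|a0] := eqVneq a 0; first by rewrite normr0 mul0r hnorm_ge0.
rewrite -ler_pdivlMl ?normr_gt0// -normfV (le_trans _ (le _ _))//.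
by rewrite scalerA mulVf// scale1r.
Qed.

Lemma hnorm0_eq0 f : hnorm f = 0 -> f = 0.
Proof.
move=> f0; apply: hspaceP => x y; apply/eqP; rewrite -normr_le0.
by rewrite (le_trans (hnormP _ _ _))// f0 mul0r.
Qed.

Lemma hnormMn f n : hnorm (f *+ n) = hnorm f *+ n.
Proof. by rewrite -scaler_nat hnormZ normr_nat mulr_natl. Qed.

Lemma hnormN f : hnorm (- f) = hnorm f.
Proof. by rewrite -scaleN1r hnormZ normrN normr1 mul1r. Qed.

HB.instance Definition _ :=
  Num.Zmodule_isNormed.Build R hspace hnormD hnorm0_eq0 hnormMn hnormN.

Definition hdist f g := `|g - f|.

Lemma hdistxx f : hdist f f = 0.
Proof. by rewrite /hdist subrr normr0. Qed.

Lemma hdist_eq0 f g : hdist f g = 0 -> f = g.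
Proof. by move=> /normr0_eq0/subr0_eq. Qed.

Lemma hdistC f g : hdist f g = hdist g f.
Proof. exact: distrC. Qed.

Lemma hdist_triangle g f h : hdist f h <= hdist f g + hdist g h.
Proof. by rewrite addrC; exact: ler_distD. Qed.

HB.instance Definition _ :=
  isMetric.Build R hspace hdistxx hdist_eq0 hdistC hdist_triangle.

Lemma hmdistE f g : mdist f g = `|f - g|.
Proof. exact: distrC. Qed.

HB.instance Definition _ := isPointed.Build hspace 0.
HB.instance Definition _ :=
  NormedZmoduleMetric.Build R hspace (fun _ _ => erefl).
HB.instance Definition _ :=
  PseudoMetricNormedZmod_Lmodule_isNormedModule.Build R hspace hnormZ.

Lemma hspace_complete (F : set_system hspace) :
  ProperFilter F -> cauchy F -> cvg F.
Proof.
move=> FF cF.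
have [|f0 f0P] := @ball_limit R (X * X) (fun p => mdist p.1 p.2)
    (fun p => mdist_ge0 _ _) hspace F (fun f p => f p.1 p.2) FF cF.
  move=> a b e p; rewrite ballEmdist /= hmdistE => /ltW ab.
  by rewrite -hfunB (le_trans (hnormP _ _ _))// ler_wpM2r ?mdist_ge0.
pose f x y : R^o := f0 (x, y).
have approx e : 0 < e -> exists a : hspace, F (ball a e) /\
    forall x y, `|f x y - a x y| <= e * mdist x y.
  by move=> /f0P[a [Fa fa]]; exists a; split => // x y; exact: (fa (x, y)).
have eps_eq u v K : 0 <= K -> (forall e, 0 < e -> `|u - v| <= e * K) -> u = v :> R.
  move=> K0 uv; apply/subr0_eq/eqP; rewrite -normr_le0.
  apply/ler_addgt0Pr => e e0; rewrite add0r.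
  have K1 : 0 < K + 1 by rewrite ltr_wpDl.
  apply: (le_trans (uv (e / (K + 1)) (divr_gt0 e0 K1))).
  by rewrite mulrAC ler_pdivrMr// ler_pM2l//; lra.
have fP : f \in hpred.
  apply/asboolP; split.
  - split=> [x y z|x y c s g s01].
    + apply: (eps_eq _ _ (mdist x y + mdist y z + mdist x z)).
        by rewrite !addr_ge0 ?mdist_ge0.
      move=> e /approx[a [_ fa]].
      have -> : f x y + f y z - f x z =
         (f x y - a x y) + (f y z - a y z) - (f x z - a x z).
        by rewrite -((haffine a).1 x y z); ring.
      rewrite (le_trans (ler_normB _ _))// !mulrDr lerD//.
      by rewrite (le_trans (ler_normD _ _))// lerD.
    + have /andP[s0 s1] := s01.
      apply: (eps_eq _ _ (mdist x (c s) + s * mdist x y)).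
        by rewrite addr_ge0 ?mulr_ge0 ?mdist_ge0.
      move=> e /approx[a [_ fa]].
      have -> : f x (c s) - s * f x y =
         (f x (c s) - a x (c s)) - s * (f x y - a x y).
        by rewrite ((haffine a).2 _ _ _ _ g)//; ring.
      rewrite (le_trans (ler_normB _ _))// [leRHS]mulrDr lerD//.
      by rewrite normrM ger0_norm// mulrCA ler_wpM2l.
  - have [a [_ fa]] := approx 1 ltr01.
    exists (1 + hnorm a); first by rewrite addr_ge0 ?hnorm_ge0.
    move=> x y; rewrite -(subrK (a x y) (f x y)) (le_trans (ler_normD _ _))//.
    by rewrite mulrDl lerD// hnormP.
  - move=> nX; apply/funext => x; apply/funext => y.
    apply: (eps_eq _ _ (mdist x y)); first exact: mdist_ge0.
    by move=> e /approx[a [_ /(_ x y)]]; rewrite (hnot_good a nX).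
apply/cvg_ex; exists (HSpace fP); apply/fcvg_ballP => e e0.
have [a [Fa fa]] := approx (e / 2) (divr_gt0 e0 (ltr0Sn _ 1)).
apply: filterS Fa => b; rewrite !ballEmdist/= => ab.
have fa' : `|HSpace fP - a| <= e / 2.
  by apply: hnorm_le => [|x y]; [rewrite divr_ge0// ltW|exact: fa].
move: (HSpace fP) fa' => h; rewrite -hmdistE => ha.
apply: (le_lt_trans (metric_triangle h a b)); rewrite (splitr e).
exact: ler_ltD.
Qed.

HB.instance Definition _ := Uniform_isComplete.Build hspace hspace_complete.

End AffineFunctionSpace.

(** * The Jordan-von Neumann theorem *)

Section JordanVonNeumann.
Variables (R : realType) (V : normedModType R).
Hypothesis parallelogram_le : forall x y : V,
  `|x + y| ^+ 2 + `|x - y| ^+ 2 <= 2 * (`|x| ^+ 2 + `|y| ^+ 2).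
Implicit Types x y z : V.

(** The reverse inequality is the same inequality for [x + y] and [x - y]. *)
Lemma parallelogram x y :
  `|x + y| ^+ 2 + `|x - y| ^+ 2 = 2 * (`|x| ^+ 2 + `|y| ^+ 2).
Proof.
apply/eqP; rewrite eq_le parallelogram_le/=.
have := parallelogram_le (x + y) (x - y).
have -> : x + y + (x - y) = 2 *: x by rewrite addrACA subrr addr0 scaler_nat.
have -> : x + y - (x - y) = 2 *: y.
  by rewrite opprD opprK addrACA subrr add0r scaler_nat.
by rewrite !normrZ ger0_norm// !exprMn; lra.
Qed.

Definition polar_dot x y : R := (`|x + y| ^+ 2 - `|x - y| ^+ 2) / 4.

Lemma polar_dotC x y : polar_dot x y = polar_dot y x.
Proof. by rewrite /polar_dot [y + x]addrC [`|y - x|]distrC. Qed.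

Lemma polar_dotxx x : polar_dot x x = `|x| ^+ 2.
Proof.
have -> : polar_dot x x = (`|2 *: x| ^+ 2 - `|0 : V| ^+ 2) / 4.
  by rewrite /polar_dot subrr scaler_nat.
by rewrite normr0 normrZ ger0_norm// exprMn; field.
Qed.

Lemma polar_dotD x y z : polar_dot (x + y) z = polar_dot x z + polar_dot y z.
Proof.
have h1 := parallelogram (x + z) y; have h2 := parallelogram (y + z) x.
have h3 := parallelogram (x - z) y; have h4 := parallelogram (y - z) x.
have e1 : x + z + y = x + y + z by rewrite addrAC.
have e2 : y + z + x = x + y + z by rewrite addrAC (addrC y).
have e3 : x - z + y = x + y - z by rewrite addrAC.
have e4 : y - z + x = x + y - z by rewrite addrAC (addrC y).
have e5 : `|y + z - x| = `|x - z - y|.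
  by rewrite -normrN opprB opprD addrA addrAC.
have e6 : `|y - z - x| = `|x + z - y|.
  by rewrite -normrN !opprB addrA.
rewrite e1 in h1; rewrite e2 e5 in h2; rewrite e3 in h3; rewrite e4 e6 in h4.
by rewrite /polar_dot; lra.
Qed.

Lemma polar_dot_le x y : `|polar_dot x y| <= `|x| * `|y|.
Proof.
have le (u v : V) : `|u + v| ^+ 2 - `|u - v| ^+ 2 <= 4 * (`|u| * `|v|).
  have h1 : `|u + v| ^+ 2 <= (`|u| + `|v|) ^+ 2.
    by rewrite ler_sqr ?nnegrE ?addr_ge0// ler_normD.
  have h2 : (`|u| - `|v|) ^+ 2 <= `|u - v| ^+ 2.
    rewrite -[leLHS](ger0_norm (sqr_ge0 _)) normrX ler_sqr ?nnegrE//.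
    exact: ler_dist_dist.
  lra.
have := le x y; have := le x (- y).
by rewrite opprK normrN ler_norml /polar_dot; lra.
Qed.

Lemma polar_dotN x y : polar_dot (- x) y = - polar_dot x y.
Proof.
have e1 : `|- x + y| = `|x - y| by rewrite addrC distrC.
have e2 : `|- x - y| = `|x + y| by rewrite -opprD normrN.
by rewrite /polar_dot e1 e2; lra.
Qed.

(** The defect [psi] is additive, vanishes on the naturals and satisfies [|psi b| <= M * |b|].
    Removing from [N.+1%:R * b] its integer part shows that [N.+1%:R * |psi b|] is at most [M] for
    every N. *)
Lemma polar_dotZ a x y : polar_dot (a *: x) y = a * polar_dot x y.
Proof.
pose psi b := polar_dot (b *: x) y - b * polar_dot x y.
have psiD b c : psi (b + c) = psi b + psi c.
  by rewrite /psi scalerDl polar_dotD; ring.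
have psiN b : psi (- b) = - psi b by rewrite /psi scaleNr polar_dotN; ring.
have psi1 : psi 1 = 0 by rewrite /psi scale1r; ring.
have psin n b : psi (n%:R * b) = n%:R * psi b.
  elim: n => [|n IH].
    by rewrite !mul0r /psi scale0r mul0r subr0 /polar_dot add0r sub0r normrN subrr mul0r.
  by rewrite -natr1 !mulrDl !mul1r psiD IH.
pose M := 2 * (`|x| * `|y|).
have M0 : 0 <= M by rewrite mulr_ge0 ?mulr_ge0.
have psiM b : `|psi b| <= M * `|b|.
  rewrite /psi (le_trans (ler_normB _ _))// [`|b * _|]normrM.
  have := polar_dot_le (b *: x) y; rewrite [`|b *: x|]normrZ.
  have := ler_wpM2l (normr_ge0 b) (polar_dot_le x y).
  by rewrite /M; lra.
have psin0 n : psi n%:R = 0 by rewrite -[n%:R]mulr1 psin psi1 mulr0.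
suff psi0 b : 0 <= b -> psi b = 0.
  apply/eqP; rewrite -subr_eq0 -/(psi a); apply/eqP.
  have [/psi0//|a0] := leP 0 a.
  by rewrite -[a]opprK psiN psi0 ?oppr0// oppr_ge0 ltW.
move=> b0; apply/eqP; rewrite -normr_le0; apply/ler_addgt0Pr => e e0; rewrite add0r.
have [N MN] : exists N, M / e <= N.+1%:R.
  by exists (Num.truncn (M / e)); rewrite ltW// truncnS_gt.
have N0 : 0 < N.+1%:R :> R by rewrite ltr0n.
rewrite -(ler_pM2l N0).
have Nb : 0 <= N.+1%:R * b by rewrite mulr_ge0.
have /andP[t1 t2] := truncn_itv Nb; set m := Num.truncn _ in t1 t2.
have -> : N.+1%:R * `|psi b| = `|psi (N.+1%:R * b - m%:R)|.
  by rewrite psiD psiN psin0 subr0 psin normrM gtr0_norm.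
rewrite (le_trans (psiM _))//.
move: MN; rewrite ler_pdivrMr//; apply: le_trans.
rewrite ler_piMr// ger0_norm ?subr_ge0//.
by move: t2; rewrite -natr1; lra.
Qed.

End JordanVonNeumann.

Section HilbertAffine.
Variables (R : realType) (X : metricType R).
Implicit Types f g h : hspace X.

Lemma hspace_parallelogram_le f g :
  `|f + g| ^+ 2 + `|f - g| ^+ 2 <= 2 * (`|f| ^+ 2 + `|g| ^+ 2).
Proof.
have zero : (forall h, h = 0) -> `|f + g| ^+ 2 + `|f - g| ^+ 2 <= 2 * (`|f| ^+ 2 + `|g| ^+ 2).
  by move=> h0; rewrite (h0 f) (h0 g) addr0 subr0 normr0 expr0n /= !addr0 mulr0.
have [gX|nX] := pselect (good X); last first.
  by apply: zero => h; apply: val_inj; rewrite /= (hnot_good _ nX).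
have [[z _]|nz] := pselect (exists z : X, True); last first.
  by apply: zero => h; apply: hspaceP => x; exfalso; apply: nz; exists x.
(* The norm is the least Lipschitz constant, so [|h| - e] is not one; 0 takes its place when it is
   not positive. *)
have near h e : 0 < e -> exists K, (K = 0 \/ 0 < K /\
    ~ (forall x y, `|h x y| <= K * mdist x y)) /\
    `|h| ^+ 2 - 2 * `|h| * e <= K ^+ 2.
  move=> e0; have [he|eh] := leP `|h| e.
    exists 0; split; first by left.
    have := mulr_ge0 (normr_ge0 h) (normr_ge0 h).
    have := ler_wpM2l (normr_ge0 h) he; rewrite expr0n /= expr2; lra.
  exists (`|h| - e); split; last by have := sqr_ge0 e; lra.
  right; split; first by rewrite subr_gt0.
  move=> /hnorm_le; rewrite subr_ge0 => /(_ (ltW eh)).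
  by rewrite -[hnorm h]/`|h| => ?; lra.
apply/ler_addgt0Pr => e e0.
pose W := 2 * (`|f + g| + `|f - g|) + 1.
have W0 : 0 < W by rewrite ltr_wpDl// mulr_ge0// addr_ge0.
have eW : 0 < e / W by rewrite divr_gt0.
have [K [sK hK]] := near (f + g) _ eW.
have [K' [sK' hK']] := near (f - g) _ eW.
have := parallelogram_steep z gX (haffine f) (haffine g) (hnormP f) (hnormP g) sK sK'.
rewrite -[hnorm f]/`|f| -[hnorm g]/`|g| => h.
have : W * (e / W) = e by rewrite mulrC divfK// gt_eqF.
move: hK hK' h eW; rewrite /W; move: (e / _) => d.
set p := `|f + g|; set q := `|f - g|; lra.
Qed.

Definition hspace_dot f g : R := polar_dot f g.

Lemma hspace_dot_linear a f g h :
  hspace_dot (a *: f + g) h = a * hspace_dot f h + hspace_dot g h.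
Proof.
by rewrite /hspace_dot (polar_dotD hspace_parallelogram_le)
  (polar_dotZ hspace_parallelogram_le).
Qed.

HB.instance Definition _ := CompleteNormedModule_isHilbert.Build R (hspace X)
  hspace_dot_linear (@polar_dotC R (hspace X)) (@polar_dotxx R (hspace X))
  (@hmdistE R X).

End HilbertAffine.


(** * The map to the Hilbert space and the vertical distance *)

Section HilbertGeometry.
Variables (R : realType) (H : hilbertType R).
Implicit Types (x y z : H) (a b s t : R).

Lemma hdotDl x y z : hdot (x + y) z = hdot x z + hdot y z :> R.
Proof. by have := hdot_linear 1 x y z; rewrite scale1r mul1r. Qed.

Lemma hdot0l x : hdot 0 x = 0 :> R.
Proof. by have := hdotDl 0 0 x; rewrite addr0; lra. Qed.

Lemma hdotZl a x y : hdot (a *: x) y = a * hdot x y.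
Proof. by have := hdot_linear a x 0 y; rewrite hdot0l !addr0. Qed.

Lemma hdotNl x y : hdot (- x) y = - hdot x y :> R.
Proof. by rewrite -scaleN1r hdotZl mulN1r. Qed.

Lemma hdotBl x y z : hdot (x - y) z = hdot x z - hdot y z :> R.
Proof. by rewrite hdotDl hdotNl. Qed.

Lemma hdotDr x y z : hdot x (y + z) = hdot x y + hdot x z :> R.
Proof. by rewrite hdotC hdotDl !(hdotC x). Qed.

Lemma hdotZr a x y : hdot x (a *: y) = a * hdot x y.
Proof. by rewrite hdotC hdotZl (hdotC x). Qed.

Lemma hdotBr x y z : hdot x (y - z) = hdot x y - hdot x z :> R.
Proof. by rewrite hdotC hdotBl !(hdotC x). Qed.

Lemma hnorm_sqrD x y : `|x + y| ^+ 2 = `|x| ^+ 2 + 2 * hdot x y + `|y| ^+ 2.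
Proof. by rewrite -!hdot_norm hdotDl !hdotDr (hdotC y x); ring. Qed.

Lemma hnorm_sqrB x y : `|x - y| ^+ 2 = `|x| ^+ 2 - 2 * hdot x y + `|y| ^+ 2.
Proof. by rewrite -!hdot_norm hdotBl !hdotBr (hdotC y x); ring. Qed.

Lemma hdot_inj x y : (forall z, hdot x z = hdot y z :> R) -> x = y.
Proof.
move=> xy; apply/subr0_eq/eqP; rewrite -normr_eq0 -sqrf_eq0.
by rewrite -hdot_norm hdotBl xy subrr.
Qed.

Lemma hdot_le x y : `|hdot x y : R| <= `|x| * `|y|.
Proof.
have le (u v : H) : hdot u v <= `|u| * `|v|.
  have [v0|] := eqVneq (`|v| : R) 0.
    by rewrite v0 mulr0 (normr0_eq0 v0) hdotC hdot0l.
  rewrite -normr_gt0 normr_id => v0.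
  have := sqr_ge0 `| (`|v| *: u - `|u| *: v)|.
  rewrite hnorm_sqrB !normrZ !normr_id hdotZl hdotZr.
  have [u0 _|] := eqVneq (`|u| : R) 0; first by rewrite u0 mul0r (normr0_eq0 u0) hdot0l.
  rewrite -normr_gt0 normr_id => u0 h.
  have uv : 0 < `|u| * `|v| by rewrite mulr_gt0.
  by rewrite -(ler_pM2l uv); lra.
rewrite ler_norml le andbT lerNl.
by have := le (- x) y; rewrite hdotNl normrN.
Qed.

Lemma stewart x y z s :
  `|z - ((1 - s) *: x + s *: y)| ^+ 2 =
  (1 - s) * `|z - x| ^+ 2 + s * `|z - y| ^+ 2 - s * (1 - s) * `|x - y| ^+ 2.
Proof.
rewrite !hnorm_sqrB hnorm_sqrD !normrZ !hdotDr !hdotZr hdotZl !exprMn.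
by rewrite !real_normK ?num_real//; ring.
Qed.

Section Riesz.
Variables (phi : H -> R) (K : R).
Hypothesis phi_linear : forall a x y, phi (a *: x + y) = a * phi x + phi y.
Hypothesis phi_le : forall x, `|phi x| <= K * `|x|.

(** If h represents [phi], then [J x] is |x - h|^2 - |h|^2, which is least at h. *)
Let J x := `|x| ^+ 2 - 2 * phi x.

Let representers d := [set h | forall g, `|hdot h g - phi g| <= d * `|g|].

(* Almost minimisers of J almost represent phi. *)
Let representers_neq0 d : 0 < d -> representers d !=set0.
Proof.
move=> d0; have Jinf : has_inf (range J).
  split; first by exists (J 0), 0.
  exists (- K ^+ 2) => _ [x _ <-]; rewrite /J.
  have := sqr_ge0 (`|x| - K); have := phi_le x; rewrite ler_norml => /andP[_]; lra.
have [_ [h _ <-] hm] := inf_adherent (exprn_gt0 2 d0) Jinf.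
exists h => g; set c := _ - _.
have [g0|] := eqVneq (`|g| : R) 0.
  have p0 : phi 0 = 0 by have := phi_linear 1 0 0; rewrite scale1r addr0; lra.
  by rewrite /c g0 (normr0_eq0 g0) hdotC hdot0l p0 subr0 normr0 mulr0.
rewrite -normr_gt0 normr_id => g0.
have Jhg t : J (t *: g + h) = J h + t ^+ 2 * `|g| ^+ 2 + 2 * t * c.
  rewrite /J phi_linear hnorm_sqrD normrZ exprMn real_normK ?num_real//.
  by rewrite hdotZl (hdotC g) /c; ring.
(* The minimum of [J] on the line through [h] in direction [g]: it lies [c ^+ 2 / |g| ^+ 2] below
   [J h], and [J h] exceeds the infimum by less than [d ^+ 2]. *)
have : inf (range J) <= J ((- c / `|g| ^+ 2) *: g + h).
  by apply: ge_inf; [exact: Jinf.2|exists ((- c / `|g| ^+ 2) *: g + h)].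
rewrite Jhg => le; have {hm le} := lt_le_trans hm (lerD le (lexx _)).
rewrite -addrA -addrA ltrDl.
have -> : (- c / `|g| ^+ 2) ^+ 2 * `|g| ^+ 2 + (2 * (- c / `|g| ^+ 2) * c + d ^+ 2) =
   d ^+ 2 - c ^+ 2 / `|g| ^+ 2 by field; rewrite gt_eqF.
rewrite subr_gt0 ltr_pdivrMr ?exprn_gt0// -exprMn => /ltW.
rewrite -[leLHS](ger0_norm (sqr_ge0 _)) normrX ler_sqr// nnegrE.
by rewrite mulr_ge0// ltW.
Qed.

Lemma riesz : exists e, forall x, phi x = hdot e x.
Proof.
pose F := filter_from [set d : R | 0 < d] representers.
have FF : ProperFilter F.
  apply: filter_from_proper; last by move=> d; exact: representers_neq0.
  apply: filter_from_filter.
    by exists 1; rewrite /= ltr01.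
  move=> d d' d0 d'0; exists (Num.min d d'); first by rewrite /= lt_min d0.
  move=> h rh; split=> g; rewrite (le_trans (rh g))// ler_wpM2r// ge_min lexx//.
  by rewrite orbT.
have cF : cauchy F.
  apply/cauchy_exP => d d0; have d4 : 0 < d / 4 by rewrite divr_gt0.
  have [h rh] := representers_neq0 d4; exists h, (d / 4) => // h' rh'.
  rewrite ballEmdist/= mdist_norm.
  have : `|h - h'| ^+ 2 <= d / 2 * `|h - h'|.
    rewrite -hdot_norm hdotBl.
    have := rh (h - h'); have := rh' (h - h'); rewrite !ler_norml.
    by move=> /andP[? ?] /andP[? ?]; lra.
  have := normr_ge0 (h - h'); rewrite le_eqVlt => /predU1P[<-//|hh].
  by rewrite expr2 ler_pM2r// => /le_lt_trans; apply; lra.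
have Fl : F --> lim F by apply: cauchy_cvg.
set l := lim F in Fl; exists l => g.
apply/esym/subr0_eq/eqP; rewrite -normr_le0; apply/ler_addgt0Pr => e e0; rewrite add0r.
pose d := e / (2 * `|g| + 1).
have g1 : 0 < 2 * `|g| + 1 by rewrite ltr_wpDl// mulr_ge0.
have d0 : 0 < d by rewrite divr_gt0.
have /fcvg_ballP/(_ d d0) Fd := Fl.
have rd : F (representers d) by exists d.
have [h [rh lh]] := filter_ex (@filterI _ F _ _ _ rd Fd).
move: lh; rewrite ballEmdist/= mdist_norm => /ltW lh.
have h1 : `|hdot (l - h) g| <= d * `|g|.
  by rewrite (le_trans (hdot_le _ _))// ler_wpM2r.
have -> : hdot l g - phi g = hdot (l - h) g + (hdot h g - phi g).
  by rewrite hdotBl; ring.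
rewrite (le_trans (ler_normD _ _))// (le_trans (lerD h1 (rh g)))//.
have : d * (2 * `|g| + 1) = e by rewrite divfK// gt_eqF.
lra.
Qed.

End Riesz.
End HilbertGeometry.

Section BasePoint.
Variables (R : realType) (X : metricType R).
Implicit Types x y : X.

(** The argument only witnesses that X is inhabited; the chosen point is the same for every
    argument, by [baseE]. *)
Definition base x : X := xget x [set: X].

Lemma baseE x y : base x = base y.
Proof.
rewrite /base /xget; case: pselect => // -[].
by exists x; exact/asboolP.
Qed.

End BasePoint.

HB.lock Definition emb (R : realType) (X : metricType R) (x : X) : hspace X :=
  xget 0 [set e | forall f : hspace X, f (base x) x = hdot e f].

(* The squared distance in Y: |emb x - emb y| is the part of the distance that
   affine functions see. *)
HB.lock Definition vdist2 (R : realType) (X : metricType R) (x y : X) : R :=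
  mdist x y ^+ 2 - `|emb x - emb y| ^+ 2.

HB.lock Definition vdist (R : realType) (X : metricType R) (x y : X) : R :=
  Num.sqrt (vdist2 x y).

Section VerticalDistance.
Variables (R : realType) (X : metricType R).
Implicit Types (x y z : X) (c : R -> X) (f g h : hspace X) (s t q r : R).

Lemma embP x f : hdot (emb x) f = f (base x) x.
Proof.
have [e eP] : exists e : hspace X, forall f, f (base x) x = hdot e f.
  apply: (@riesz _ _ _ (mdist (base x) x)) => // h.
  by rewrite mulrC; exact: hnormP.
rewrite emb.unlock; exact/esym/(@xgetI _ 0 [set e | forall f, f (base x) x = hdot e f] e eP f).
Qed.

Lemma emb_dot x y f : hdot (emb y - emb x) f = f x y.
Proof.
rewrite hdotBl !embP (baseE y x) -((haffine f).1 (base x) x y) addrC.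
by rewrite addKr.
Qed.

Lemma emb_geod x y c s : geod x y c -> 0 <= s <= 1 ->
  emb (c s) = (1 - s) *: emb x + s *: emb y.
Proof.
move=> g s01; apply: hdot_inj => f; rewrite hdotDl !hdotZl !embP.
rewrite (baseE _ x) (baseE y x) -((haffine f).1 (base x) x).
rewrite -((haffine f).1 (base x) x y) ((haffine f).2 _ _ _ _ g)//.
by rewrite mulrDr mulrBl mul1r; ring.
Qed.

(** The squared norm of [emb x - emb y] is the value of this very affine function on the pair y, x,
    hence at most its norm times the distance. *)
Lemma emb_le x y : `|emb x - emb y| <= mdist x y.
Proof.
have : `|emb x - emb y| ^+ 2 <= `|emb x - emb y| * mdist x y.
  by rewrite -hdot_norm emb_dot metric_sym (le_trans (ler_norm _))// hnormP.
have := normr_ge0 (emb x - emb y); rewrite le_eqVlt => /predU1P[<-|h].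
  by rewrite mdist_ge0.
by rewrite expr2 ler_pM2l.
Qed.

Lemma vdist2E x y : vdist2 x y = mdist x y ^+ 2 - `|emb x - emb y| ^+ 2.
Proof. by rewrite vdist2.unlock. Qed.

Lemma vdist2_ge0 x y : 0 <= vdist2 x y.
Proof. by rewrite vdist2E subr_ge0 ler_sqr ?nnegrE ?mdist_ge0// emb_le. Qed.

Lemma vdist_sqr x y : vdist x y ^+ 2 = vdist2 x y.
Proof. by rewrite vdist.unlock sqr_sqrtr// vdist2_ge0. Qed.

Lemma vdist_ge0 x y : 0 <= vdist x y.
Proof. by rewrite vdist.unlock sqrtr_ge0. Qed.

Lemma vdistC x y : vdist x y = vdist y x.
Proof. by rewrite vdist.unlock !vdist2E metric_sym distrC. Qed.

Lemma vdistxx x : vdist x x = 0.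
Proof. by rewrite vdist.unlock vdist2E mdistxx subrr normr0 subrr sqrtr0. Qed.

Lemma vdist2_geod x y c s t : geod x y c -> 0 <= s <= 1 -> 0 <= t <= 1 ->
  vdist2 (c s) (c t) = (s - t) ^+ 2 * vdist2 x y.
Proof.
move=> g s01 t01; have [_ _ cd] := g; rewrite !vdist2E cd// !(emb_geod g)//.
have -> : (1 - s) *: emb x + s *: emb y - ((1 - t) *: emb x + t *: emb y) =
    (t - s) *: (emb x - emb y).
  rewrite opprD addrACA -!scalerBl scalerBr -scaleNr.
  have -> : 1 - s - (1 - t) = t - s by ring.
  by have -> : s - t = - (t - s) by ring.
by rewrite normrZ !exprMn !real_normK ?num_real//; ring.
Qed.

Lemma vdist_geod x y c s t : geod x y c -> 0 <= s <= 1 -> 0 <= t <= 1 ->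
  vdist (c s) (c t) = `|s - t| * vdist x y.
Proof.
by move=> g s01 t01; rewrite vdist.unlock (vdist2_geod g)// sqrtrM ?sqr_ge0// sqrtr_sqr.
Qed.

Lemma vdist2_stewart x y z c s q : geod y z c -> 0 <= s <= 1 ->
  mdist x (c s) ^+ 2 <= (1 - s) * mdist x y ^+ 2 + s * mdist x z ^+ 2
    - (1 - q) * (s * (1 - s)) * mdist y z ^+ 2 ->
  vdist2 x (c s) <= (1 - s) * vdist2 x y + s * vdist2 x z
    - s * (1 - s) * vdist2 y z + q * (s * (1 - s)) * mdist y z ^+ 2.
Proof.
move=> g s01 h; rewrite !vdist2E (emb_geod g)// stewart; move: h.
move: (`|emb x - emb y|) (`|emb x - emb z|) (`|emb y - emb z|) => ? ? ?.
lra.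
Qed.

(** Every parameter is the midpoint of an endpoint and another parameter, so the supremum is at most
    half of itself. Boundedness replaces continuity. *)
Lemma midconvex_le0 (h : R -> R) B : (forall s, 0 <= s <= 1 -> h s <= B) ->
  h 0 <= 0 -> h 1 <= 0 ->
  (forall s t, 0 <= s <= 1 -> 0 <= t <= 1 -> h ((s + t) / 2) <= (h s + h t) / 2) ->
  forall s, 0 <= s <= 1 -> h s <= 0.
Proof.
move=> hB h0 h1 hmid.
pose A := [set h s | s in [set s | 0 <= s <= 1]].
have supA : has_sup A.
  split; first by exists (h 0), 0 => //=; rewrite lexx ler01.
  by exists B => _ [s s01 <-]; exact: hB.
have hM s : 0 <= s <= 1 -> h s <= sup A.
  by move=> s01; apply: ub_le_sup; [exact: supA.2|exists s].
have hM2 s : 0 <= s <= 1 -> h s <= sup A / 2.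
  move=> s01; have [s2|s2] := leP s (1 / 2).
    have s2' : 0 <= 2 * s <= 1 by lra.
    have := hmid 0 (2 * s) _ s2'; rewrite lexx ler01 => /(_ isT).
    have -> : (0 + 2 * s) / 2 = s by field.
    by have := hM _ s2'; lra.
  have s2' : 0 <= 2 * s - 1 <= 1 by lra.
  have := hmid 1 (2 * s - 1) _ s2'; rewrite lexx ler01 => /(_ isT).
  have -> : (1 + (2 * s - 1)) / 2 = s by field.
  by have := hM _ s2'; lra.
have M0 : sup A <= sup A / 2.
  by apply: ge_sup; [exact: supA.1|move=> _ [s s01 <-]; exact: hM2].
by move=> s s01; apply: (le_trans (hM _ s01)); lra.
Qed.

(** The difference [h] of the two sides is midconvex along the geodesic: the quadratic term in
    [u * (1 - u)] has exactly the midpoint defect that [short_medians] provides. The radius doubles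
    because points of the geodesic may be [2 * r] away from x. *)
Lemma short_medians_stewart x y z c s q r :
  short_medians X q (2 * r) -> geod y z c -> 0 <= s <= 1 ->
  mdist x y <= r -> mdist x z <= r -> mdist y z <= r ->
  mdist x (c s) ^+ 2 <= (1 - s) * mdist x y ^+ 2 + s * mdist x z ^+ 2
    - (1 - q) * (s * (1 - s)) * mdist y z ^+ 2.
Proof.
move=> med g s01 xy xz yz; have [c0 c1 cd] := g.
have xc u : 0 <= u <= 1 -> mdist x (c u) <= 2 * r.
  move=> u01; have := metric_triangle x y (c u); rewrite (geod_distl g)//.
  have : u * mdist y z <= r by apply: le_trans yz; rewrite ler_piMl ?mdist_ge0//; lra.
  lra.
pose h u := mdist x (c u) ^+ 2 - ((1 - u) * mdist x y ^+ 2 + u * mdist x z ^+ 2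
    - (1 - q) * (u * (1 - u)) * mdist y z ^+ 2).
suff : h s <= 0 by rewrite /h; lra.
have B0 : exists B, forall u, 0 <= u <= 1 -> h u <= B.
  exists ((2 * r) ^+ 2 + mdist x y ^+ 2 + mdist x z ^+ 2 + `|1 - q| * mdist y z ^+ 2).
  move=> u u01; have xcu := xc _ u01; rewrite /h.
  have k1 : mdist x (c u) ^+ 2 <= (2 * r) ^+ 2.
    by rewrite ler_sqr ?nnegrE ?mdist_ge0// (le_trans _ xcu) ?mdist_ge0.
  have k2 : 0 <= (1 - u) * mdist x y ^+ 2 by rewrite mulr_ge0 ?sqr_ge0//; lra.
  have k3 : 0 <= u * mdist x z ^+ 2 by rewrite mulr_ge0 ?sqr_ge0//; lra.
  have k4 : (1 - q) * (u * (1 - u)) * mdist y z ^+ 2 <= `|1 - q| * mdist y z ^+ 2.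
    rewrite ler_wpM2r ?sqr_ge0// (le_trans (ler_norm _))// normrM ler_piMr//.
    by rewrite ger0_norm; nra.
  have k5 := sqr_ge0 (mdist x y); have k6 := sqr_ge0 (mdist x z).
  by move: k1 k2 k3 k4 k5 k6; clear; lra.
have [B hB] := B0.
apply: (midconvex_le0 hB) => //.
- by rewrite /h c0; lra.
- by rewrite /h c1; lra.
move=> u v u01 v01; have guv := geod_sub g u01 v01.
have := med x (c u) (c v) _ guv (xc _ u01) (xc _ v01).
rewrite cd//; have -> : u + 2^-1 * (v - u) = (u + v) / 2 by field.
have uv : `|u - v| * mdist y z <= 2 * r.
  have : `|u - v| * mdist y z <= 1 * mdist y z.
    by rewrite ler_wpM2r ?mdist_ge0// ler_norml; lra.
  by have := mdist_ge0 y z; lra.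
move=> /(_ uv); rewrite exprMn real_normK ?num_real// /h.
move: (mdist x (c ((u + v) / 2)) ^+ 2) (mdist x (c u) ^+ 2) (mdist x (c v) ^+ 2).
move: (mdist x y ^+ 2) (mdist x z ^+ 2) (mdist y z ^+ 2) => ? ? ? ? ? ?.
by clear; lra.
Qed.

(** At s = A / (A + B) both sides have the factor A B, and cancelling it leaves the claim. Adding a
    small [d] to [A] and [B] makes the quotient defined and the factor positive. *)
Lemma discriminant_le (A B D : R) : 0 <= A -> 0 <= B ->
  (forall s, 0 <= s <= 1 -> s * (1 - s) * D <= (1 - s) * A ^+ 2 + s * B ^+ 2) ->
  D <= (A + B) ^+ 2.
Proof.
move=> A0 B0 h; apply/ler_addgt0Pr => e e0.
pose W := 4 * (A + B) + 4.
have W0 : 0 < W by rewrite ltr_wpDl// mulr_ge0// addr_ge0.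
pose d := Num.min 1 (e / W).
have d0 : 0 < d by rewrite lt_min ltr01 divr_gt0.
have d1 : d <= 1 by rewrite ge_min lexx.
have dW : d * W <= e by rewrite -ler_pdivlMr// ge_min lexx orbT.
have Ad : 0 < A + d by lra.
have Bd : 0 < B + d by lra.
have S0 : 0 < A + d + (B + d) by lra.
pose s := (A + d) / (A + d + (B + d)).
have s01 : 0 <= s <= 1.
  by rewrite divr_ge0 ?(ltW Ad) ?(ltW S0)//= ler_pdivrMr// mul1r lerDl ltW.
have hs := h _ s01.
have {hs} : s * (1 - s) * D <= (1 - s) * (A + d) ^+ 2 + s * (B + d) ^+ 2.
  apply: (le_trans hs); apply: lerD; apply: ler_wpM2l; try lra.
    by rewrite ler_sqr ?nnegrE//; lra.
  by rewrite ler_sqr ?nnegrE//; lra.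
have -> : s * (1 - s) = (A + d) * (B + d) / (A + d + (B + d)) ^+ 2.
  by rewrite /s; field; rewrite gt_eqF.
have -> : (1 - s) * (A + d) ^+ 2 + s * (B + d) ^+ 2 = (A + d) * (B + d).
  by rewrite /s; field; rewrite gt_eqF.
rewrite mulrAC ler_pdivrMr ?exprn_gt0// ler_pM2l ?mulr_gt0// => /le_trans; apply.
have -> : (A + d + (B + d)) ^+ 2 = (A + B) ^+ 2 + d * (4 * (A + B) + 4 * d) by ring.
rewrite lerD2l (le_trans _ dW)// ler_wpM2l ?(ltW d0)// /W; lra.
Qed.

(** In Stewart's inequality for y and the geodesic from x to z the left side is at least 0. This
    holds for every parameter [s], and the discriminant condition it amounts to is the triangle
    inequality. *)
Lemma vdist2_local_triangle x y z q r : 0 <= q -> geodesic_space X ->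
  short_medians X q (2 * r) ->
  mdist y x <= r -> mdist y z <= r -> mdist x z <= r ->
  vdist2 x z <= (vdist x y + vdist y z) ^+ 2 + q * r ^+ 2.
Proof.
move=> q0 geo med yx yz xz; have [c /geodP g] := geo x z.
apply: (le_trans (_ : _ <= (vdist x y + vdist y z) ^+ 2 + q * mdist x z ^+ 2)).
  rewrite -lerBlDr; apply: discriminant_le => [||s s01]; try exact: vdist_ge0.
  have := vdist2_stewart g s01 (short_medians_stewart med g s01 yx yz xz).
  have := vdist2_ge0 y (c s).
  by rewrite (vdistC x) !vdist_sqr; lra.
rewrite lerD2l ler_wpM2l// ler_sqr ?nnegrE ?mdist_ge0//.
exact: le_trans (mdist_ge0 _ _) xz.
Qed.

(* The first variation: on the way from x to w one passes by a point u close
   to o, where the local inequality applies. *)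
Lemma vdist2_step x o w q r l : 0 <= q -> geodesic_space X ->
  short_medians X q (2 * r) -> 0 < l <= 1 ->
  mdist o w + l * mdist x o <= r ->
  vdist2 x w <= (vdist x o + vdist o w) ^+ 2 + (mdist o w ^+ 2 + q * r ^+ 2) / l.
Proof.
move=> q0 geo med /andP[l0 l1] owr; have [c /geodP g] := geo x o.
have lo : 0 <= l * mdist x o by rewrite mulr_ge0 ?mdist_ge0// ltW.
have l01 : 0 <= 1 - l <= 1 by lra.
pose u := c (1 - l).
have uo : mdist u o = l * mdist x o by rewrite (geod_distr g)//; congr (_ * _); lra.
have xu : mdist x u = (1 - l) * mdist x o by rewrite (geod_distl g).
have ou : mdist o u <= r by rewrite metric_sym uo; have := mdist_ge0 o w; lra.
have ow : mdist o w <= r by lra.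
have uw : mdist u w <= r.
  by apply: (le_trans (metric_triangle u o w)); rewrite uo; lra.
have loc := vdist2_local_triangle q0 geo med ou ow uw.
have uoE : vdist u o = l * vdist x o.
  have one01 : 0 <= (1 : R) <= 1 by rewrite ler01 lexx.
  have -> : o = c 1 by case: g.
  rewrite (vdist_geod g)//; case: (g) => _ -> _; congr (_ * _).
  by rewrite distrC ger0_norm; lra.
have eu : emb u = l *: emb x + (1 - l) *: emb o.
  by rewrite (emb_geod g)//; have -> : 1 - (1 - l) = l by ring.
have euw : emb u - emb w = l *: (emb x - emb o) + (emb o - emb w).
  by rewrite eu scalerBr scalerBl scale1r addrA addrA addrAC.
have exw : emb x - emb w = (emb x - emb o) + (emb o - emb w).
  by rewrite addrA subrK.
(* Convexity of the square, applied to [(1 - l) * mdist x o + l * (mdist u w / l)], which bounds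
   [mdist x w]. *)
have xw : mdist x w ^+ 2 <= (1 - l) * mdist x o ^+ 2 + mdist u w ^+ 2 / l.
  have h1 := metric_triangle x u w; rewrite xu in h1.
  have h2 : mdist x w ^+ 2 <= ((1 - l) * mdist x o + mdist u w) ^+ 2.
    by rewrite ler_sqr ?nnegrE ?mdist_ge0// (le_trans _ h1) ?mdist_ge0.
  apply: (le_trans h2); rewrite -(ler_pM2l l0).
  have -> : l * ((1 - l) * mdist x o ^+ 2 + mdist u w ^+ 2 / l) =
      l * (1 - l) * mdist x o ^+ 2 + mdist u w ^+ 2 by field; rewrite gt_eqF.
  rewrite -subr_ge0.
  have -> : l * (1 - l) * mdist x o ^+ 2 + mdist u w ^+ 2 -
     l * ((1 - l) * mdist x o + mdist u w) ^+ 2 =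
     (1 - l) * (l * mdist x o - mdist u w) ^+ 2 by ring.
  clear eu euw exw; by rewrite mulr_ge0 ?sqr_ge0//; lra.
have {}xw : l * mdist x w ^+ 2 <= l * (1 - l) * mdist x o ^+ 2 + mdist u w ^+ 2.
  rewrite -(ler_pM2l l0) in xw; apply: (le_trans xw).
  by rewrite le_eqVlt; apply/orP; left; apply/eqP; field; rewrite gt_eqF.
(* The squared norm of [emb u - emb w] and [l] times that of [emb x - emb w] contain the same mixed
   term [2 * (l * D)], which cancels when [loc] and [xw] are combined. *)
pose v : R := `|emb x - emb o| ^+ 2; pose g' : R := `|emb o - emb w| ^+ 2.
pose D : R := hdot (emb x - emb o) (emb o - emb w).
have nuw : `|emb u - emb w| ^+ 2 = l ^+ 2 * v + 2 * (l * D) + g'.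
  by rewrite euw hnorm_sqrD hdotZl normrZ exprMn real_normK ?num_real.
have nxw : `|emb x - emb w| ^+ 2 = v + 2 * D + g' by rewrite exw hnorm_sqrD.
have vE := vdist_sqr x o; rewrite vdist2E -/v in vE.
have gE := vdist_sqr o w; rewrite vdist2E -/g' in gE.
rewrite uoE vdist2E nuw in loc.
rewrite -(ler_pM2l l0) mulrDr [X in _ + X]mulrC divfK ?gt_eqF// vdist2E nxw.
move: loc xw vE gE; clear eu euw exw nuw nxw.
move: D v g' (mdist u w) (mdist x w) (mdist x o) (mdist o w) => D v g' U W L d.
move: (vdist x o) (vdist o w) => A B h1 h2 hA hB.
have -> : l * (A + B) ^+ 2 + (d ^+ 2 + q * r ^+ 2) =
  l * A ^+ 2 + 2 * (l * A) * B + l * B ^+ 2 + d ^+ 2 + q * r ^+ 2 by ring.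
rewrite hA hB; move: h1.
have -> : (l * A + B) ^+ 2 = l ^+ 2 * A ^+ 2 + 2 * (l * A) * B + B ^+ 2 by ring.
rewrite hA hB => h1.
have h3 : 0 <= l * d ^+ 2 by rewrite mulr_ge0 ?sqr_ge0// ltW.
move: (2 * (l * A) * B) h1 h2 h3 => AB; lra.
Qed.

(* The side from y to z is cut into n^2 pieces; by [vdist2_step] with l = 1 / n
   each piece costs an error O(n^-3). *)
Lemma vdist_triangle x y z : good X -> vdist x z <= vdist x y + vdist y z.
Proof.
move=> [geo [C [C0 [r0 r00 flat]]]].
have [c /geodP g] := geo y z.
set k := vdist y z; set L := mdist y z; set M := mdist x y + 2 * L + 1.
have L0 : 0 <= L := mdist_ge0 _ _.
have M0 : 0 < M by rewrite ltr_wpDl// addr_ge0 ?mdist_ge0 ?mulr_ge0.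
have k0 : 0 <= k := vdist_ge0 _ _.
(* With pieces of length [l ^+ 2 * L], radius [r = l * M] and [q = C * (2 * r) ^+ 2], the error term
   of [vdist2_step] is exactly [l ^+ 3 * K]. *)
pose K := L ^+ 2 + 4 * C * M ^+ 4.
have K0 : 0 <= K.
  have M40 : 0 <= M ^+ 4 by rewrite exprn_ge0// ltW.
  by rewrite addr_ge0 ?sqr_ge0// mulr_ge0// mulr_ge0.
apply/ler_addgt0Pr => e e0; pose d := e / 2.
have d0 : 0 < d by rewrite divr_gt0.
pose B := Num.max (2 * M / r0) (K / (2 * d ^+ 2)).
have [N BN] : exists N, B <= N.+1%:R.
  by exists (Num.truncn B); rewrite ltW// truncnS_gt.
set n : R := N.+1%:R in BN.
have n1 : 1 <= n by rewrite ler1n.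
have n0 : 0 < n by rewrite ltr0n.
move: BN; rewrite ge_max !ler_pdivrMr//; last by rewrite mulr_gt0// exprn_gt0.
move=> /andP[n2 n3].
pose l := n^-1.
have l0 : 0 < l by rewrite invr_gt0.
have l1 : l <= 1 by rewrite invf_le1.
have l01 : 0 < l <= 1 by rewrite l0.
have nl : n * l = 1 by rewrite divff// gt_eqF.
pose r := l * M.
have r2 : 2 * r <= r0.
  by rewrite /r mulrCA mulrC ler_pdivrMr// [leRHS]mulrC.
have rr : 0 <= 2 * r <= r0 by rewrite r2 !mulr_ge0// ltW.
have [_ med] := flat _ rr.
set q := C * _ in med.
have q0 : 0 <= q by rewrite mulr_ge0 ?sqr_ge0.
have N2 : (N.+1 ^ 2)%N%:R = n ^+ 2 :> R by rewrite natrX.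
have N20 : 0 < n ^+ 2 by rewrite exprn_gt0.
pose p (i : nat) := c (i%:R / n ^+ 2).
have i01 i : (i <= N.+1 ^ 2)%N -> 0 <= (i%:R / n ^+ 2 : R) <= 1.
  by move=> iN; rewrite divr_ge0 ?ler0n ?(ltW N20)//= ler_pdivrMr// mul1r -N2 ler_nat.
have l2E (j i : nat) : j.+1%:R / n ^+ 2 - j%:R / n ^+ 2 = l ^+ 2 :> R.
  by rewrite -mulrBl -natrB// subSnn mul1r exprVn.
have lsq : `|l ^+ 2| = l ^+ 2 by rewrite ger0_norm// sqr_ge0.
(* [d] is a head start: the inductive bound [P] is at least [d], so adding [eta] raises its square
   by at least [2 * d * eta], the error of one piece. Over all n^2 pieces this adds
   [K * l / (2 * d)], at most [d] by the choice of [B]. *)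
pose eta := K * l ^+ 3 / (2 * d).
have eta0 : 0 <= eta.
  by rewrite divr_ge0 ?mulr_ge0 ?exprn_ge0// ltW.
have main i : (i <= N.+1 ^ 2)%N ->
    vdist x (p i) <= vdist x y + d + i%:R * (l ^+ 2 * k + eta).
  elim: i => [_|i IH iN].
    by rewrite /p !mul0r addr0; case: g => -> _ _; rewrite lerDl ltW.
  have {IH} := IH (ltnW iN).
  set P := _ + _ + _ => IH.
  have Pd : d <= P.
    rewrite /P -addrA addrCA lerDl addr_ge0 ?vdist_ge0// mulr_ge0//.
    by rewrite addr_ge0// mulr_ge0 ?sqr_ge0.
  have pp : mdist (p i) (p i.+1) = l ^+ 2 * L.
    case: (g) => _ _ cd; rewrite cd ?i01 ?(ltnW iN)//.
    by rewrite distrC (l2E i 0%N) lsq.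
  have vpp : vdist (p i) (p i.+1) = l ^+ 2 * k.
    by rewrite (vdist_geod g) ?i01 ?(ltnW iN)// distrC (l2E i 0%N) lsq.
  have xp : mdist x (p i) <= mdist x y + L.
    apply: (le_trans (metric_triangle x y _)); rewrite lerD2l.
    rewrite (geod_distl g) ?i01 ?(ltnW iN)// ler_piMl//.
    by case/andP: (i01 _ (ltnW iN)).
  have hr : mdist (p i) (p i.+1) + l * mdist x (p i) <= r.
    rewrite pp expr2 -mulrA -mulrDr /r ler_pM2l//.
    have : l * L <= L by rewrite ler_piMl.
    by rewrite /M; move: xp; lra.
  have := vdist2_step q0 geo med l01 hr; rewrite pp vpp.
  have -> : ((l ^+ 2 * L) ^+ 2 + q * r ^+ 2) / l = l ^+ 3 * K.
    by rewrite /q /r /K /l; field; rewrite gt_eqF.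
  rewrite -vdist_sqr => h.
  have hP : (vdist x (p i) + l ^+ 2 * k) ^+ 2 <= (P + l ^+ 2 * k) ^+ 2.
    have lk : 0 <= l ^+ 2 * k by rewrite mulr_ge0 ?sqr_ge0.
    by rewrite ler_sqr ?nnegrE ?lerD2r// addr_ge0 ?vdist_ge0// (le_trans (ltW d0)).
  have etaE : 2 * d * eta = l ^+ 3 * K by rewrite /eta; field; rewrite gt_eqF.
  have hQ : (P + l ^+ 2 * k) ^+ 2 + l ^+ 3 * K <= (P + l ^+ 2 * k + eta) ^+ 2.
    have Xd : d <= P + l ^+ 2 * k.
      by rewrite (le_trans Pd)// lerDl mulr_ge0 ?sqr_ge0.
    rewrite -etaE; move: (P + _) Xd => Z Zd.
    have : 0 <= (Z - d) * eta by rewrite mulr_ge0// subr_ge0.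
    by have := sqr_ge0 eta; clear; lra.
  have := le_trans h (le_trans (lerD hP (lexx _)) hQ).
  rewrite ler_sqr ?nnegrE ?vdist_ge0//; last first.
    have lk : 0 <= l ^+ 2 * k by rewrite mulr_ge0 ?sqr_ge0.
    by rewrite addr_ge0// addr_ge0// (le_trans (ltW d0)).
  by rewrite /P -natr1; lra.
have := main (N.+1 ^ 2)%N (leqnn _).
have -> : p (N.+1 ^ 2)%N = z.
  by rewrite /p N2 divff ?gt_eqF//; case: g.
rewrite N2; move/le_trans; apply.
have -> : n ^+ 2 * (l ^+ 2 * k + eta) = k + K * l / (2 * d).
  by rewrite /eta /l; field; rewrite gt_eqF// gt_eqF.
have : K * l / (2 * d) <= d.
  rewrite ler_pdivrMr ?mulr_gt0// mulrC ler_pdivrMl//.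
  by move: n3; rewrite expr2; lra.
rewrite /d; lra.
Qed.

End VerticalDistance.

(** * The canonical map and isometries *)

Section VerticalSpace.
Variables (R : realType) (X : metricType R).
Implicit Types (x y z : X).

(** If X is not [good], then H is 0 and [vdist] is the distance of X; the quotient is thus a metric
    space for every X. *)
Lemma vdist_pseudo_triangle x y z : vdist x z <= vdist x y + vdist y z.
Proof.
have [gX|nX] := pselect (good X); first exact: vdist_triangle.
have emb0 u : emb u = 0 :> hspace X.
  by apply: hdot_inj => f; rewrite embP hdot0l (hnot_good f nX).
have vE (u v : X) : vdist u v = mdist u v.
  rewrite vdist.unlock vdist2E !emb0 subrr normr0 expr0n subr0 sqrtr_sqr.
  by rewrite ger0_norm ?mdist_ge0.
by rewrite !vE; exact: metric_triangle.
Qed.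

(** Chooses one point in each class of points at vertical distance 0. The quotient consists of the
    chosen points, so its elements come with a representative in X. *)
Definition canon x : X := xget x [set y | vdist x y = 0].

Lemma vdist_canon x : vdist x (canon x) = 0.
Proof. by apply: (@xgetI _ _ [set y | vdist x y = 0] x); exact: vdistxx. Qed.

Lemma eq_canon x y : vdist x y = 0 -> canon x = canon y.
Proof.
move=> xy; have E : [set z | vdist x z = 0] = [set z | vdist y z = 0].
  apply/seteqP; split=> z /= h; apply/eqP; rewrite eq_le vdist_ge0 andbT.
    by apply: le_trans (vdist_pseudo_triangle y x z) _; rewrite vdistC xy h addr0.
  by apply: le_trans (vdist_pseudo_triangle x y z) _; rewrite xy h addr0.
rewrite /canon E /xget; case: pselect => // -[].
by exists y; apply/asboolP; exact: vdistxx.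
Qed.

Lemma canonK x : canon (canon x) == canon x.
Proof. by apply/eqP/esym/eq_canon; exact: vdist_canon. Qed.

Lemma vdistl x y z : vdist x y = 0 -> vdist x z = vdist y z.
Proof.
move=> xy; apply/eqP; rewrite eq_le.
have := vdist_pseudo_triangle x y z; have := vdist_pseudo_triangle y x z.
by rewrite (vdistC y x) xy !add0r => -> ->.
Qed.

Record vquot := VQuot { vrep : X ; vrepP : canon vrep == vrep }.

HB.instance Definition _ := [isSub for vrep].
HB.instance Definition _ := [Choice of vquot by <:].

Implicit Types p q : vquot.

Let qdist p q := vdist (vrep p) (vrep q).

Let qdistxx p : qdist p p = 0.
Proof. exact: vdistxx. Qed.

Let qdist_eq0 p q : qdist p q = 0 -> p = q.
Proof.
move=> /eq_canon; rewrite (eqP (vrepP p)) (eqP (vrepP q)).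
exact: val_inj.
Qed.

Let qdistC p q : qdist p q = qdist q p.
Proof. exact: vdistC. Qed.

Let qdist_triangle q p r : qdist p r <= qdist p q + qdist q r.
Proof. exact: vdist_pseudo_triangle. Qed.

HB.instance Definition _ :=
  isMetric.Build R vquot qdistxx qdist_eq0 qdistC qdist_triangle.

Lemma vquot_mdistE p q : mdist p q = vdist (vrep p) (vrep q).
Proof. by []. Qed.

Definition vproj x : vquot := VQuot (canonK x).

Lemma eq_vproj x y : vdist x y = 0 -> vproj x = vproj y.
Proof. by move=> xy; apply: val_inj; exact: eq_canon. Qed.

Lemma vrepK : cancel vrep vproj.
Proof. by move=> p; apply: val_inj; exact/eqP/vrepP. Qed.

Lemma mdist_vproj x y : mdist (vproj x) (vproj y) = vdist x y.
Proof.
rewrite vquot_mdistE /= -(vdistl (canon y) (vdist_canon x)).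
by rewrite vdistC -(vdistl x (vdist_canon y)) vdistC.
Qed.

Lemma vproj_geod x y c : geod x y c -> geod (vproj x) (vproj y) (vproj \o c).
Proof.
move=> g; have [c0 c1 _] := g; split; rewrite /= ?c0 ?c1//.
by move=> s t s01 t01; rewrite !mdist_vproj (vdist_geod g).
Qed.

Lemma vquot_geodesic : geodesic_space X -> geodesic_space vquot.
Proof.
move=> geo p q; have [c /geodP/vproj_geod g] := geo (vrep p) (vrep q).
by exists (vproj \o c); apply/geodP; rewrite !vrepK in g.
Qed.

Lemma mdist_vproj_emb x y :
  mdist (vproj x) (vproj y) ^+ 2 + mdist (emb x) (emb y) ^+ 2 = mdist x y ^+ 2.
Proof. by rewrite mdist_vproj vdist_sqr vdist2E hmdistE subrK. Qed.

End VerticalSpace.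

(** * Affine functions on a Hilbert space and factorization *)

Section AffineFunctions.
Variable R : realType.
Implicit Types (X : metricType R) (H : hilbertType R).

Lemma polarization H H' (x y : H) (x' y' : H') : `|x + y| = `|x' + y'| ->
  `|x| = `|x'| -> `|y| = `|y'| -> hdot x y = hdot x' y' :> R.
Proof.
move=> /(congr1 (fun a => a ^+ 2)) + xx yy; rewrite !hnorm_sqrD xx yy; lra.
Qed.

Lemma bisector_dot H (u v e e' : H) : `|u - e| = `|v - e| ->
  `|u - e'| = `|v - e'| -> hdot (u - v) (e' - e) = 0 :> R.
Proof.
move=> /(congr1 (fun a => a ^+ 2)) + /(congr1 (fun a => a ^+ 2)).
by rewrite !hnorm_sqrB hdotBl !hdotBr; lra.
Qed.

Lemma geodesic_line (g : R -> R) l : 0 <= l ->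
  (forall s t, 0 <= s -> s <= t -> t <= 1 -> `|g s - g t| = l * (t - s)) ->
  forall s, 0 <= s <= 1 -> g s = g 0 + s * (g 1 - g 0).
Proof.
move=> l0 gl s /andP[s0 s1]; have := gl 0 s (lexx _) s0 s1.
have := gl s 1 s0 s1 (lexx _); have := gl 0 1 (lexx _) ler01 (lexx _).
have : 0 <= l * s by rewrite mulr_ge0.
have : 0 <= l * (1 - s) by rewrite mulr_ge0 ?subr_ge0.
rewrite subr0 mulr1 !subr0; move: (g 0) (g s) (g 1) => u v w h1 h2.
rewrite mulrBr mulr1 in h1 *; have [wu|wu] := lerP w u => lE.
  have -> : s * (w - u) = - (l * s) by rewrite -lE; ring.
  have [vu|vu] := lerP v u; have [vw|vw] := lerP w v => e1 e2; lra.
have -> : s * (w - u) = l * s by rewrite -lE; ring.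
have [vu|vu] := lerP v u; have [vw|vw] := lerP w v => e1 e2; lra.
Qed.

(** Stewart's identity gives distance 0 between [c s] and the corresponding convex combination of
    the ends. Multiplication by [b - a] covers a degenerate interval. *)
Lemma hilbert_geodesic H a b (c : R -> H) s : is_geodesic a b c ->
  a <= s <= b -> (b - a) *: c s = (b - s) *: c a + (s - a) *: c b.
Proof.
move=> /is_geodesicP[ab [l l0 cl]] /andP[sa sb].
move: ab; rewrite le_eqVlt => /predU1P[ab|ab].
  have -> : s = a by apply/eqP; rewrite eq_le sa ab sb.
  by rewrite ab subrr !scale0r addr0.
have ba : b - a != 0 by rewrite subr_eq0 gt_eqF.
pose u := (s - a) / (b - a).
suff -> : c s = (1 - u) *: c a + u *: c b.
  rewrite scalerDr !scalerA; congr (_ *: _ + _ *: _); rewrite /u; by field.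
apply/subr0_eq/eqP; rewrite -normr_eq0 -sqrf_eq0 stewart -!mdist_norm.
rewrite (metric_sym (c s)) !cl ?lexx ?(ltW ab)//; apply/eqP; rewrite /u.
by field.
Qed.

Lemma hdot_affine H (h0 : H) (a : R) : is_affine (fun h : H => a + hdot h h0 : R^o).
Proof.
have dE (h h' : H) : mdist (a + hdot h h0 : R^o) (a + hdot h' h0 : R^o) =
    `|hdot (h' - h) h0|.
  rewrite hdotBl; have -> (u v : R) : mdist (u : R^o) (v : R^o) = `|v - u| by [].
  by congr `| _ |; ring.
split.
  exists `|h0| => h h'; rewrite dE mdist_norm mulrC distrC.
  exact: hdot_le.
move=> b d c g; have /is_geodesicP[bd _] := g.
apply/is_geodesicP; split => //.
exists (`|hdot (c d - c b) h0| / (d - b)); first by rewrite divr_ge0// subr_ge0.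
move=> s t bs st td; rewrite /= dE.
move: bd; rewrite le_eqVlt => /predU1P[bd|bd].
  have -> : s = t by apply/eqP; rewrite eq_le st -bd in td *; lra.
  by rewrite !subrr hdot0l normr0 mulr0.
have db : 0 < d - b by rewrite subr_gt0.
have E : (d - b) *: (c t - c s) = (t - s) *: (c d - c b).
  rewrite !scalerBr (hilbert_geodesic g) ?(hilbert_geodesic g); [|lra..].
  rewrite opprD addrACA -!scalerBl addrC; congr (_ *: _ + _).
    by ring.
  by rewrite -scaleNr; congr (_ *: _); ring.
have : `|hdot ((d - b) *: (c t - c s)) h0| = `|hdot ((t - s) *: (c d - c b)) h0|.
  by rewrite E.
rewrite !hdotZl !normrM (gtr0_norm db) (ger0_norm (_ : 0 <= t - s)) ?subr_ge0//.
move=> e; apply: (mulfI (lt0r_neq0 db)); rewrite e; field; exact: lt0r_neq0.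
Qed.

Lemma affine_factor X (f : X -> R^o) : good X -> is_affine f ->
  exists fhat : hspace X -> R^o, is_affine fhat /\ forall x, f x = fhat (emb x).
Proof.
move=> gX [[k fk] fg]; pose F x y : R^o := f y - f x.
have FP : F \in @hpred R X.
  apply/asboolP; split => //.
  - split=> [x y z|x y c s g s01]; first by rewrite /F; ring.
    have /geodP[gc c0 c1] := g.
    have /is_geodesicP[_ [l l0 cl]] := fg _ _ _ gc.
    have fl u v : 0 <= u -> u <= v -> v <= 1 ->
        `|(f \o c) u - (f \o c) v| = l * (v - u).
      by move=> u0 uv v1; rewrite -cl// distrC.
    have := geodesic_line l0 fl s01; rewrite /= c0 c1 /F => ->.
    by rewrite addrAC subrr add0r.
  - exists `|k|; first exact: normr_ge0.
    move=> x y; have -> : `|F x y| = mdist (f x) (f y) by [].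
    by rewrite (le_trans (fk x y))// ler_wpM2r ?mdist_ge0 ?ler_norm.
have [x0|] := pselect (exists x : X, True).
  have [{}x0 _] := x0.
  exists (fun h => f (base x0) + hdot h (HSpace FP)); split.
    exact: hdot_affine.
  by move=> x; rewrite embP /= /F (baseE x0 x) addrC subrK.
move=> nx; exists (fun h => 0 + hdot h (0 : hspace X)); split.
  exact: hdot_affine.
by move=> x; case: nx; exists x.
Qed.

End AffineFunctions.

Section Isometries.
Variable R : realType.
Implicit Types X Y : metricType R.

Lemma isometry_inverse X Y (phi : X -> Y) : is_isometry phi ->
  exists psi : Y -> X, [/\ is_isometry psi, cancel phi psi & cancel psi phi].
Proof.
move=> [iso [psi phiK psiK]]; exists psi; split => //; split; last by exists phi.
by move=> y y'; rewrite -iso !psiK.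
Qed.

Lemma geod_isometric X Y (phi : X -> Y) x y c : isometric_embedding phi ->
  geod x y c -> geod (phi x) (phi y) (phi \o c).
Proof.
move=> iso [c0 c1 cd]; split; rewrite /= ?c0 ?c1// => s t s01 t01.
by rewrite !iso cd.
Qed.

Lemma geodesic_space_isometry X Y (phi : X -> Y) : is_isometry phi ->
  geodesic_space X -> geodesic_space Y.
Proof.
move=> iphi geo; have [psi [_ _ psiK]] := isometry_inverse iphi.
move=> x y; have [c /geodP g] := geo (psi x) (psi y).
exists (phi \o c); apply/geodP.
by have := geod_isometric iphi.1 g; rewrite !psiK.
Qed.

(** Membership in [hpred] depends on [good], so pullbacks stay in the space only if [good] is
    invariant. *)
Lemma good_isometry X Y (phi : X -> Y) : is_isometry phi -> good X -> good Y.
Proof.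
move=> iphi [geo [C [C0 [r0 r00 flat]]]].
have [psi [[ipsi _] _ psiK]] := isometry_inverse iphi.
split; first exact: (geodesic_space_isometry iphi).
exists C; split=> //; exists r0 => // r rr.
have [con med] := flat r rr; split.
  move=> z x x' c c' s g g'; rewrite -!ipsi => zx zx' s01.
  exact: (con _ _ _ _ _ _ (geod_isometric ipsi g) (geod_isometric ipsi g')).
move=> x y z c g; rewrite -!ipsi.
exact: (med _ _ _ _ (geod_isometric ipsi g)).
Qed.

Section Pullback.
Variables (X Y : metricType R) (psi : Y -> X).
Hypothesis ipsi : is_isometry psi.

Let pullback_subproof (f : hspace X) :
  (fun x y => f (psi x) (psi y)) \in @hpred R Y.
Proof.
apply/asboolP; split.
- split=> [x y z|x y c s g]; first exact: (haffine f).1.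
  exact: (haffine f).2 (geod_isometric ipsi.1 g).
- exists (hnorm f); first exact: hnorm_ge0.
  by move=> x y; rewrite -ipsi.1 hnormP.
- move=> nY; rewrite hnot_good// => gX; apply: nY.
  by have [phi [iphi _ _]] := isometry_inverse ipsi; exact: (good_isometry iphi).
Qed.

Definition pullback f := HSpace (pullback_subproof f).

Lemma pullbackE f x y : pullback f x y = f (psi x) (psi y).
Proof. by []. Qed.

Lemma pullbackD f g : pullback (f + g) = pullback f + pullback g.
Proof. exact: hspaceP. Qed.

Lemma pullbackB f g : pullback (f - g) = pullback f - pullback g.
Proof. exact: hspaceP. Qed.

Lemma pullback_le f : `|pullback f| <= `|f|.
Proof.
apply: hnorm_le => [|x y]; first exact: hnorm_ge0.
by rewrite pullbackE -ipsi.1 hnormP.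
Qed.

End Pullback.

Lemma pullbackK X Y (psi : Y -> X) (phi : X -> Y)
    (ipsi : is_isometry psi) (iphi : is_isometry phi) : cancel psi phi ->
  cancel (pullback iphi) (pullback ipsi).
Proof. by move=> psiK f; apply: hspaceP => x y; rewrite 2!pullbackE !psiK. Qed.

Lemma pullback_norm X Y (psi : Y -> X) (ipsi : is_isometry psi) f :
  `|pullback ipsi f| = `|f|.
Proof.
apply/eqP; rewrite eq_le pullback_le/=.
have [phi [iphi psiK phiK]] := isometry_inverse ipsi.
by rewrite -{1}[f](pullbackK iphi ipsi phiK) pullback_le.
Qed.

Lemma pullback_dot X Y (psi : Y -> X) (ipsi : is_isometry psi) f g :
  hdot (pullback ipsi f) (pullback ipsi g) = hdot f g.
Proof.
by apply: polarization; rewrite -?pullbackD pullback_norm.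
Qed.

(** The base points of X and Y are unrelated, but by [emb_dot] differences of [emb] do not depend on
    them. *)
Lemma pullback_emb X Y (psi : Y -> X) (phi : X -> Y) (ipsi : is_isometry psi) :
  cancel phi psi -> forall x y,
  pullback ipsi (emb y - emb x) = emb (phi y) - emb (phi x).
Proof.
move=> phiK x y; apply: hdot_inj => f.
have [phi' [iphi' psiK' phiK']] := isometry_inverse ipsi.
rewrite -[f](pullbackK ipsi iphi' psiK') pullback_dot !emb_dot.
by rewrite [RHS]pullbackE !phiK.
Qed.

Lemma vdist_isometry X Y (phi : X -> Y) x y : is_isometry phi ->
  vdist (phi x) (phi y) = vdist x y.
Proof.
move=> iphi; have [psi [ipsi phiK _]] := isometry_inverse iphi.
rewrite !vdist.unlock !vdist2E iphi.1 -(pullback_emb ipsi phiK).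
by rewrite pullback_norm.
Qed.

Lemma vproj_isometry X Y (phi : X -> Y) x : is_isometry phi ->
  vproj (phi (canon x)) = vproj (phi x).
Proof.
by move=> iphi; apply: eq_vproj; rewrite (vdist_isometry _ _ iphi) vdistC vdist_canon.
Qed.

Definition canonical_map X :=
  @HilbertProductMap R X (vquot X) (hspace X) (fun x => (vproj x, emb x)).

(** The first component is determined since X maps onto the quotient. For the second, [g.2 h] and
    [g'.2 h] are equally far from every [emb z]. By [bisector_dot] their difference is orthogonal to
    all [emb y - emb x], and as an affine function it then vanishes on all pairs. *)
Lemma induced_unique X Y (phi : X -> Y) g g' : is_isometry phi ->
  induces (canonical_map X) (canonical_map Y) phi g ->
  induces (canonical_map X) (canonical_map Y) phi g' -> g = g'.
Proof.
move=> iphi [ig1 ig2 ge] [ig1' ig2' ge'].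
have [psi [ipsi phiK psiK]] := isometry_inverse iphi.
rewrite [g]surjective_pairing [g']surjective_pairing; congr pair; apply/funext.
  move=> p; have := ge (vrep p); rewrite ge' /= vrepK => -[e _].
  by symmetry.
move=> h; apply: subr0_eq; apply: hspaceP => x y.
have eqd z : `|g.2 h - emb z| = `|g'.2 h - emb z|.
  have := ge (psi z); have := ge' (psi z); rewrite /= psiK => -[_ e'] [_ e].
  by rewrite -!mdist_norm {1}e e' ig2.1 ig2'.1.
by rewrite -emb_dot hdotC; exact: bisector_dot.
Qed.

Lemma induced_exists X Y (phi : X -> Y) : is_isometry phi ->
  exists g, induces (canonical_map X) (canonical_map Y) phi g.
Proof.
move=> iphi; have [psi [ipsi phiK psiK]] := isometry_inverse iphi.
(* The translation that corrects for the two base points. It can be read off at any point of X and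
   is set to 0 if X is empty. *)
have [v vP] : exists v : hspace Y,
    forall x, emb (phi x) = pullback ipsi (emb x) + v.
  have [[x0 _]|nX] := pselect (exists x : X, True); last first.
    by exists 0 => x; case: nX; exists x.
  exists (emb (phi x0) - pullback ipsi (emb x0)) => x.
  by rewrite addrCA -pullbackB (pullback_emb ipsi phiK) subrKC.
exists (fun p => vproj (phi (vrep p)), fun h => pullback ipsi h + v); split => /=.
- split.
    by move=> p q; rewrite mdist_vproj vdist_isometry.
  exists (fun p => vproj (psi (vrep p))) => p /=.
    by rewrite vproj_isometry// phiK vrepK.
  by rewrite vproj_isometry// psiK vrepK.
- split.
    move=> h h'; rewrite !mdist_norm opprD addrACA subrr addr0 -pullbackB.
    exact: pullback_norm.
  exists (fun h => pullback iphi (h - v)) => h.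
    by rewrite addrK pullbackK.
  by rewrite pullbackK// subrK.
- by move=> x; rewrite -vP vproj_isometry.
Qed.

End Isometries.

(** * Stewart inequalities and completion *)

Section BruhatTits.
Variable R : realType.
Implicit Types (X Y Z : metricType R).

(** In the Euclidean plane, the squared distance from x to the point that divides z z' in the ratio
    [s]. *)
Definition stewart_bound X (z z' : X) s x :=
  (1 - s) * mdist x z ^+ 2 + s * mdist x z' ^+ 2 - s * (1 - s) * mdist z z' ^+ 2.

(** The inequality of Bruhat and Tits, at every ratio [s] and not only at midpoints. It postulates a
    point and no geodesic, hence it can pass to limits before geodesics are known. *)
Definition cn_space X := forall (z z' : X) s, 0 <= s <= 1 ->
  exists m, forall x, mdist x m ^+ 2 <= stewart_bound z z' s x.

(* The inequality with an error that is uniform enough to pass from a dense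
   subset to the whole space. *)
Definition almost_cn X := forall (z z' : X) s e, 0 <= s <= 1 -> 0 < e ->
  exists m, forall x, mdist x m ^+ 2 <=
    stewart_bound z z' s x + e * (1 + mdist x z + mdist x z').

Lemma stewart_bound_l X (z z' : X) s :
  stewart_bound z z' s z = s ^+ 2 * mdist z z' ^+ 2.
Proof. by rewrite /stewart_bound mdistxx; ring. Qed.

Lemma stewart_bound_r X (z z' : X) s :
  stewart_bound z z' s z' = (1 - s) ^+ 2 * mdist z z' ^+ 2.
Proof. by rewrite /stewart_bound mdistxx (metric_sym z' z); ring. Qed.

Lemma complete_almost_cn X : complete_space X -> almost_cn X -> cn_space X.
Proof.
move=> cX acn z z' s s01.
set D := mdist z z'; pose w x := 1 + mdist x z + mdist x z'.
have w1 x : 1 <= w x by rewrite /w -addrA lerDl addr_ge0 ?mdist_ge0.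
pose A e := [set m | forall x, mdist x m ^+ 2 <= stewart_bound z z' s x + e * w x].
pose F := filter_from [set e : R | 0 < e] A.
have FF : ProperFilter F.
  apply: filter_from_proper; last by move=> e /(acn z z' s e s01)[m mP]; exists m.
  apply: filter_from_filter; first by exists 1; rewrite /= ltr01.
  move=> e e' e0 e'0; exists (Num.min e e'); first by rewrite /= lt_min e0.
  move=> m Am; split=> x; rewrite (le_trans (Am x))// lerD2l ler_wpM2r ?(le_trans ler01)//.
    by rewrite ge_min lexx.
  by rewrite ge_min lexx orbT.
pose K := 2 * D ^+ 2 + 3 * D + 6.
have D0 : 0 <= D := mdist_ge0 _ _.
have K0 : 0 < K by rewrite /K; have := sqr_ge0 D; lra.
(* The inequality of [m'], tested at z and z', bounds its distances to them almost optimally;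
   inserted into the inequality of [m] at [m'], they cancel the main terms. In [K], 2 D^2 + 2 D + 5
   bounds [w m'] and 1 + D comes from the two tests. *)
have Acauchy e m m' : 0 < e -> e <= 1 -> A e m -> A e m' -> mdist m' m ^+ 2 <= e * K.
  move=> e0 e1 Am Am'; apply: (le_trans (Am m')).
  have hz := Am' z; have hz' := Am' z'.
  rewrite stewart_bound_l -/D /w mdistxx -/D in hz.
  rewrite stewart_bound_r -/D /w mdistxx (metric_sym z' z) -/D in hz'.
  rewrite /stewart_bound -/D !(metric_sym m').
  have wm : w m' <= 2 * D ^+ 2 + 2 * D + 5.
    rewrite /w !(metric_sym m').
    have eD : e * (1 + 0 + D) <= 1 + 0 + D by rewrite ler_piMl// addr0 addr_ge0.
    have eD' : e * (1 + D + 0) <= 1 + D + 0 by rewrite ler_piMl// addr0 addr_ge0.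
    have sD : s ^+ 2 * D ^+ 2 <= D ^+ 2.
      by rewrite ler_piMl ?sqr_ge0// expr_le1//; lra.
    have sD' : (1 - s) ^+ 2 * D ^+ 2 <= D ^+ 2.
      by rewrite ler_piMl ?sqr_ge0// expr_le1//; lra.
    have := sqr_ge0 (mdist z m' - 1); have := sqr_ge0 (mdist z' m' - 1).
    have := sqr_ge0 D; move: hz hz' eD eD' sD sD' D0; clearbody D.
    move: (mdist z m') (mdist z' m') (e * _) (e * _) (_ ^+ 2 * _) (_ ^+ 2 * _).
    clear; move=> ? ? ? ? ? ?; lra.
  have ew : e * w m' <= e * (2 * D ^+ 2 + 2 * D + 5) by rewrite ler_wpM2l// ltW.
  have /andP[s0 s1] := s01.
  have h1 : (1 - s) * mdist z m' ^+ 2 <= (1 - s) * (s ^+ 2 * D ^+ 2 + e * (1 + 0 + D)).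
    by rewrite ler_wpM2l// subr_ge0.
  have h2 : s * mdist z' m' ^+ 2 <= s * ((1 - s) ^+ 2 * D ^+ 2 + e * (1 + D + 0)).
    by rewrite ler_wpM2l.
  move: ew h1 h2; rewrite /K; move: (w m') (mdist z m' ^+ 2) (mdist z' m' ^+ 2).
  clear; move=> ? ? ?; nra.
have cF : cauchy F.
  apply/cauchy_exP => e e0; pose d := Num.min 1 (e ^+ 2 / (2 * K)).
  have d0 : 0 < d by rewrite lt_min ltr01 divr_gt0 ?exprn_gt0// mulr_gt0.
  have d1 : d <= 1 by rewrite ge_min lexx.
  have dK : d * (2 * K) <= e ^+ 2.
    by rewrite -ler_pdivlMr ?mulr_gt0// ge_min lexx orbT.
  have [m mP] := acn z z' s d s01 d0.
  exists m, d => // m' Am'; rewrite ballEmdist/= metric_sym.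
  rewrite -(@ltr_pXn2r _ 2) ?nnegrE ?mdist_ge0 ?ltW//.
  apply: (le_lt_trans (Acauchy d m m' d0 d1 mP Am')).
  apply: lt_le_trans dK; rewrite ltr_pM2l//; lra.
have [m Fm] := cX F FF cF; exists m => x.
apply/ler_addgt0Pr => e e0.
pose W := w x + 2 * mdist x m + 3.
have W0 : 0 < W by have := w1 x; have := mdist_ge0 x m; rewrite /W; lra.
pose d := Num.min 1 (e / W).
have d0 : 0 < d by rewrite lt_min ltr01 divr_gt0.
have d1 : d <= 1 by rewrite ge_min lexx.
have dW : d * W <= e by rewrite -ler_pdivlMr// ge_min lexx orbT.
have /fcvg_ballP/(_ d d0) Fd := Fm.
have Ad : F (A d) by exists d.
have [m' [/(_ x) Am' mm']] := filter_ex (@filterI _ F _ _ _ Ad Fd).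
move: mm'; rewrite ballEmdist/= => /ltW mm'.
have h1 := metric_triangle x m' m; have h2 := metric_triangle x m m'.
rewrite (metric_sym m' m) in h1.
apply: (le_trans (_ : _ <= (mdist x m' + d) ^+ 2)).
  rewrite ler_sqr ?nnegrE ?addr_ge0 ?mdist_ge0 ?(ltW d0)//.
  by rewrite (le_trans h1)// lerD2l.
apply: (le_trans _ (lerD (lexx _) dW)).
have : d * (2 * mdist x m' + d) <= d * (2 * mdist x m + 3).
  by rewrite ler_wpM2l ?(ltW d0)//; move: h2 mm' d1; clear; lra.
move: Am'; rewrite /W; clear; lra.
Qed.

(** The bounds at z and z' add up to the distance D of z and z', so both are equalities. With these
    distances the bound for [c t] at [c s] is ((s - t) D)^2, and the triangle inequality gives the
    converse. *)
Lemma cn_geodesic X : cn_space X -> geodesic_space X.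
Proof.
move=> cn z z'; pose D := mdist z z'.
have D0 : 0 <= D := mdist_ge0 _ _.
have /choice[c cP] : forall s, exists m, 0 <= s <= 1 ->
    forall x, mdist x m ^+ 2 <= stewart_bound z z' s x.
  move=> s; have [s01|_] := boolP (0 <= s <= 1); last by exists z.
  by have [m mP] := cn z z' s s01; exists m.
have le_sqr (a b : R) : 0 <= b -> a ^+ 2 <= b ^+ 2 -> a <= b.
  move=> b0 ab; rewrite leNgt; apply/negP => ba; move: ab.
  by rewrite leNgt ltr_sqr ?nnegrE ?ba// (le_trans b0 (ltW ba)).
have zc s : 0 <= s <= 1 -> mdist z (c s) <= s * D.
  move=> s01; apply: le_sqr; first by rewrite mulr_ge0//; case/andP: s01.
  by rewrite exprMn -stewart_bound_l cP.
have z'c s : 0 <= s <= 1 -> mdist z' (c s) <= (1 - s) * D.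
  move=> s01; apply: le_sqr; first by rewrite mulr_ge0//; lra.
  by rewrite exprMn -stewart_bound_r cP.
have zcE s : 0 <= s <= 1 -> mdist z (c s) = s * D.
  move=> s01; apply/eqP; rewrite eq_le zc//=.
  have := z'c s s01; have := metric_triangle z (c s) z'.
  rewrite (metric_sym (c s)) -/D; lra.
have z'cE s : 0 <= s <= 1 -> mdist z' (c s) = (1 - s) * D.
  move=> s01; apply/eqP; rewrite eq_le z'c//=.
  have := zc s s01; have := metric_triangle z (c s) z'.
  rewrite (metric_sym (c s)) -/D; lra.
have i0 : 0 <= (0 : R) <= 1 by rewrite lexx ler01.
have i1 : 0 <= (1 : R) <= 1 by rewrite lexx ler01.
exists c; apply/geodP; split.
- by apply/esym/mdist_positivity; rewrite zcE// mul0r.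
- by apply/esym/mdist_positivity; rewrite z'cE// subrr mul0r.
move=> s t s01 t01; apply/eqP; rewrite eq_le; apply/andP; split.
  apply: le_sqr; first by rewrite mulr_ge0.
  apply: (le_trans (cP t t01 (c s))).
  rewrite /stewart_bound !(metric_sym (c s)) zcE// z'cE// -/D.
  rewrite !exprMn real_normK ?num_real//; lra.
have := metric_triangle z (c s) (c t); have := metric_triangle z (c t) (c s).
rewrite (metric_sym (c t)) !zcE// -/D.
have [st|st] := lerP t s; lra.
Qed.

(** At [c s] the bound is 0, so the point provided by [cn_space] lies on every geodesic from y to
    z. *)
Lemma cn_stewart X (y z : X) c s x : cn_space X -> geod y z c -> 0 <= s <= 1 ->
  mdist x (c s) ^+ 2 <= stewart_bound y z s x.
Proof.
move=> cn g s01; have [m mP] := cn y z s s01.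
suff -> : c s = m by [].
apply: mdist_positivity; apply/eqP; rewrite -sqrf_eq0 eq_le sqr_ge0 andbT.
apply: (le_trans (mP _)); rewrite /stewart_bound (metric_sym (c s) y).
by rewrite (geod_distl g)// (geod_distr g)//; lra.
Qed.

Lemma dot3_stewart (x y z : 'rV[R]_3) s :
  let p := (1 - s) *: x + s *: y in
  dot3 1 (z - p) (z - p) = (1 - s) * dot3 1 (z - x) (z - x) +
    s * dot3 1 (z - y) (z - y) - s * (1 - s) * dot3 1 (x - y) (x - y).
Proof. by rewrite /= /dot3 !mxE; ring. Qed.

Lemma dot3_eq0 (u : 'rV[R]_3) : dot3 1 u u = 0 -> u = 0.
Proof.
rewrite /dot3 mul1r -!expr2 => h; apply/rowP; apply: forall_I3; rewrite mxE;
  apply/eqP; rewrite -sqrf_eq0 eq_le sqr_ge0 andbT; move: h;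
  have := sqr_ge0 (u 0 0); have := sqr_ge0 (u 0 1); have := sqr_ge0 (u 0 (2 : 'I_3));
  lra.
Qed.

Lemma dot3_opp (u v : 'rV[R]_3) : dot3 1 (u - v) (u - v) = dot3 1 (v - u) (v - u).
Proof. by rewrite /dot3 !mxE; ring. Qed.

Lemma model_dist0 (u v : 'rV[R]_3) d : 0 <= d ->
  model_dist 0 u v = d <-> dot3 1 (u - v) (u - v) = d ^+ 2.
Proof.
have n0 : 0 <= dot3 1 (u - v) (u - v).
  by rewrite /dot3 mul1r -!expr2 !addr_ge0 ?sqr_ge0.
move=> d0; rewrite /model_dist ltxx; split=> [<-|->]; first by rewrite sqr_sqrtr.
by rewrite sqrtr_sqr ger0_norm.
Qed.

(** Stewart's inequality along side j, then along side i, bounds the squared distance by an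
    expression in the distances of vertices. In the plane the same expression is exact for the
    comparison points. Any two vertices are equal or adjacent, so all the distances involved
    agree. *)
Lemma cn_cat X : complete_space X -> cn_space X -> cat_space 0 X.
Proof.
move=> cX cn; split => //; first exact: cn_geodesic.
move=> v c w tri _ comp i j s t p q s01 t01 [_ ip pi'] [_ jq qj'].
have g k : geod (v k) (v (ordS k)) (c k) by apply/geodP/tri.
have side k : dot3 1 (w k - w (ordS k)) (w k - w (ordS k)) = mdist (v k) (v (ordS k)) ^+ 2.
  by apply/model_dist0; [exact: mdist_ge0|exact: (comp k).2].
have dw k l : dot3 1 (w k - w l) (w k - w l) = mdist (v k) (v l) ^+ 2.
  have : k = l \/ l = ordS k \/ k = ordS l.
    move: k l; do 2!apply: forall_I3; rewrite ?ordS_I3;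
      by [left|right; left|right; right].
  move=> [->|[->|->]]; first by rewrite subrr /dot3 !mxE mdistxx; ring.
    exact: side.
  by rewrite dot3_opp metric_sym side.
have point k u r : 0 <= u <= 1 -> model_dist 0 (w k) r = mdist (v k) (c k u) ->
    model_dist 0 r (w (ordS k)) = mdist (c k u) (v (ordS k)) ->
    r = (1 - u) *: w k + u *: w (ordS k).
  move=> u01 /model_dist0-/(_ (mdist_ge0 _ _)) e1 /model_dist0-/(_ (mdist_ge0 _ _)) e2.
  apply/subr0_eq/dot3_eq0; rewrite dot3_stewart dot3_opp e1 e2 side.
  by rewrite (geod_distl (g k))// (geod_distr (g k))//; ring.
rewrite (point i s p)// (point j t q)// /model_dist ltxx.
rewrite -[leLHS](ger0_norm (mdist_ge0 _ _)) -sqrtr_sqr ler_wsqrtr//.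
have /andP[s0 s1] := s01; have /andP[t0 t1] := t01.
have h k : mdist (c i s) (v k) ^+ 2 <= stewart_bound (v i) (v (ordS i)) s (v k).
  by rewrite metric_sym; exact: cn_stewart.
apply: (le_trans (cn_stewart (c i s) cn (g j) t01)).
rewrite dot3_stewart !(dot3_opp (_ + _)) !dot3_stewart !dw lerD2r lerD//.
  by rewrite ler_wpM2l ?subr_ge0// h.
by rewrite ler_wpM2l// h.
Qed.

Lemma cat_vquot_cn X : cat_space 0 X -> cn_space (vquot X).
Proof.
move=> [_ geo thin] p q s s01.
have [c /geodP g] := geo (vrep p) (vrep q); exists (vproj (c s)) => r.
have i1 : 0 <= (1 : R) <= 1 by rewrite lexx ler01.
have [c' /geodP g'] := geo (vrep p) (vrep r).
have := thin_apex0 thin geo g g' s01 i1; have [_ -> _] := g' => h.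
have st : mdist (vrep r) (c s) ^+ 2 <= (1 - s) * mdist (vrep r) (vrep p) ^+ 2
    + s * mdist (vrep r) (vrep q) ^+ 2
    - (1 - 0) * (s * (1 - s)) * mdist (vrep p) (vrep q) ^+ 2.
  rewrite metric_sym (le_trans h)// (metric_sym (vrep r) (vrep p)).
  by rewrite (metric_sym (vrep r) (vrep q)); lra.
have := vdist2_stewart g s01 st.
have rE : mdist r (vproj (c s)) = vdist (vrep r) (c s).
  by rewrite -{1}[r]vrepK mdist_vproj.
rewrite rE /stewart_bound !vquot_mdistE !vdist_sqr; lra.
Qed.

End BruhatTits.

(** * The completion of a metric space *)

Section Completion.
Variables (R : realType) (Y : metricType R).
Implicit Types (x y : Y) (e K : R).

(* A point of the completion is represented by its distance function on Y. *)
Definition cpred : {pred (Y -> R)} := fun g =>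
  `[< forall e, 0 < e -> exists y, forall x, `|g x - mdist y x| <= e >].

Record completion := Completion { cfun :> Y -> R ; cfunP : cfun \in cpred }.

HB.instance Definition _ := [isSub for cfun].
HB.instance Definition _ := [Choice of completion by <:].

Implicit Types g h : completion.

Definition cdist g h : R := wnorm (fun=> 1) (fun x => g x - h x).

Lemma cdist_le g h K : 0 <= K -> (forall x, `|g x - h x| <= K) -> cdist g h <= K.
Proof. by move=> K0 le; apply: wnorm_le; split => // x; rewrite mulr1. Qed.

Lemma cfun_near g e : 0 < e -> exists y, forall x, `|g x - mdist y x| <= e.
Proof. by case: g => f /= /asboolP; exact. Qed.

Lemma cdistP g h x : `|g x - h x| <= cdist g h.
Proof.
have [y gy] := cfun_near g ltr01; have [z hz] := cfun_near h ltr01.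
rewrite -[leRHS]mulr1.
apply: (@wnormP _ _ (fun=> 1) _ (fun x => g x - h x) (1 + mdist y z + 1) _ x) => //.
split=> [|u]; first by rewrite !addr_ge0 ?mdist_ge0.
have := gy u; have := hz u; have := mdist_diff_le u y z.
rewrite mulr1 !(metric_sym u) !ler_norml => /andP[? ?] /andP[? ?] /andP[? ?]; lra.
Qed.

Lemma cdistxx g : cdist g g = 0.
Proof.
apply/eqP; rewrite eq_le wnorm_ge0 andbT; apply: cdist_le => // x.
by rewrite subrr normr0.
Qed.

Lemma cdist_eq0 g h : cdist g h = 0 -> g = h.
Proof.
move=> gh; apply: val_inj; apply/funext => x; apply/subr0_eq/eqP.
by rewrite -normr_le0 -gh; exact: cdistP.
Qed.

Lemma cdistC g h : cdist g h = cdist h g.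
Proof.
suff le g' h' : cdist g' h' <= cdist h' g' by apply/eqP; rewrite eq_le !le.
by apply: cdist_le => [|x]; [exact: wnorm_ge0|rewrite distrC cdistP].
Qed.

Lemma cdist_triangle h g k : cdist g k <= cdist g h + cdist h k.
Proof.
apply: cdist_le => [|x]; first by rewrite addr_ge0 ?wnorm_ge0.
have -> : g x - k x = (g x - h x) + (h x - k x) by rewrite addrA subrK.
by rewrite (le_trans (ler_normD _ _))// lerD ?cdistP.
Qed.

HB.instance Definition _ :=
  isMetric.Build R completion cdistxx cdist_eq0 cdistC cdist_triangle.

Let cinj_subproof y : mdist y \in cpred.
Proof. by apply/asboolP => e e0; exists y => x; rewrite subrr normr0 ltW. Qed.

Definition cinj y := Completion (cinj_subproof y).

(** As a uniform limit of distance functions, [g] differs from the distance to y by at most [g y],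
    and this value is attained at y. *)
Lemma mdist_cinj g y : mdist g (cinj y) = g y.
Proof.
have g0 : 0 <= g y.
  apply/ler_addgt0Pr => e e0; have [z /(_ y)] := cfun_near g e0.
  by have := mdist_ge0 z y; rewrite ler_norml => ? /andP[? ?]; lra.
apply/eqP; rewrite eq_le; apply/andP; split; last first.
  by have := cdistP g (cinj y) y; rewrite /= mdistxx subr0; exact: le_trans (ler_norm _).
apply: cdist_le => // x; apply/ler_addgt0Pr => e e0.
have [z gz] := cfun_near g (divr_gt0 e0 (ltr0Sn R 1)).
have := gz x; have := gz y; have := metric_triangle z y x.
have := metric_triangle z x y; have := metric_triangle y z x.
rewrite (metric_sym x y) (metric_sym y z) !ler_norml /= => ? ? ? /andP[? ?] /andP[? ?]; lra.
Qed.

Lemma cinj_isometric : isometric_embedding cinj.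
Proof. by move=> x y; rewrite mdist_cinj. Qed.

Lemma cinj_near g e : 0 < e -> exists y, mdist g (cinj y) <= e.
Proof.
move=> e0; have [y gy] := cfun_near g e0; exists y.
by apply: cdist_le => //; exact: ltW.
Qed.

Lemma completion_complete : complete_space completion.
Proof.
move=> F FF cF.
have [|f fP] := @ball_limit R Y (fun=> 1) (fun=> ler01) completion F
    (fun g x => g x) FF cF.
  by move=> a b e x; rewrite ballEmdist /= mulr1 => /ltW; exact: le_trans (cdistP _ _ _).
have fc : f \in cpred.
  apply/asboolP => e e0; have e2 : 0 < e / 2 by rewrite divr_gt0.
  have [a [_ fa]] := fP _ e2; have [y ay] := cfun_near a e2.
  exists y => x; have := fa x; have := ay x; rewrite mulr1 !ler_norml.
  by move=> /andP[? ?] /andP[? ?]; lra.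
exists (Completion fc); apply/fcvg_ballP => e e0.
have e2 : 0 < e / 2 by rewrite divr_gt0.
have [a [Fa fa]] := fP _ e2.
apply: filterS Fa => b; rewrite !ballEmdist/= => ab.
apply: (le_lt_trans (metric_triangle _ a _)); rewrite (splitr e) ler_ltD//.
by apply: cdist_le => [|x]; [exact: ltW|rewrite -[leRHS]mulr1; exact: fa].
Qed.

Lemma cinj_completion : is_completion cinj.
Proof.
split; [exact: completion_complete|exact: cinj_isometric|].
move=> O [g Og] oO; have /nbhs_ballP[e /= e0 eO] := open_nbhs_nbhs (conj oO Og).
have [y gy] := cinj_near g (divr_gt0 e0 (ltr0Sn R 1)).
exists (cinj y); split; last by exists y.
by apply: eO; rewrite ballEmdist /= (le_lt_trans gy)//; lra.
Qed.

Lemma completion_almost_cn : cn_space Y -> almost_cn completion.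
Proof.
move=> cn z z' s e s01 e0; have /andP[s0 s1] := s01.
(* Replacing x, z, z' by nearby points of Y costs [9 * (d * W)] in [um2]. The square of
   [mdist u m + d] adds [8 * (d * W)] from its mixed term and one more [d * W] from [d ^+ 2]: 18 in
   all. *)
pose d := Num.min 1 (e / 18).
have d0 : 0 < d by rewrite lt_min ltr01 divr_gt0.
have d1 : d <= 1 by rewrite ge_min lexx.
have dE : d * 18 <= e by rewrite -ler_pdivlMr// ge_min lexx orbT.
have [y zy] := cinj_near z d0; have [y' zy'] := cinj_near z' d0.
have [m mP] := cn y y' s s01; exists (cinj m) => x.
have [u xu] := cinj_near x d0.
set a := mdist x z; set b := mdist x z'; pose D := mdist z z'.
have a0 : 0 <= a := mdist_ge0 _ _.
have b0 : 0 <= b := mdist_ge0 _ _.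
have Dab : D <= a + b.
  by rewrite /D /a (metric_sym x z); exact: metric_triangle.
have ua : mdist u y <= a + 2 * d.
  rewrite -cinj_isometric; have := metric_triangle (cinj u) x (cinj y).
  have := metric_triangle x z (cinj y); rewrite (metric_sym _ x) -/a; lra.
have ub : mdist u y' <= b + 2 * d.
  rewrite -cinj_isometric; have := metric_triangle (cinj u) x (cinj y').
  have := metric_triangle x z' (cinj y'); rewrite (metric_sym _ x) -/b; lra.
have yD : D <= mdist y y' + 2 * d.
  rewrite -cinj_isometric; have := metric_triangle z (cinj y) z'.
  have := metric_triangle (cinj y) (cinj y') z'; rewrite (metric_sym (cinj y') z') -/D; lra.
have Dy : mdist y y' <= D + 2 * d.
  rewrite -cinj_isometric; have := metric_triangle (cinj y) z (cinj y').
  have := metric_triangle z z' (cinj y'); rewrite (metric_sym (cinj y) z) -/D; lra.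
have ym : mdist y m <= mdist y y'.
  rewrite -ler_sqr ?nnegrE ?mdist_ge0// (le_trans (mP y))// stewart_bound_l.
  by rewrite ler_piMl ?sqr_ge0// expr_le1.
have um : mdist u m <= 4 * (1 + a + b).
  by have := metric_triangle u y m; lra.
have xm : mdist x (cinj m) <= mdist u m + d.
  by rewrite -cinj_isometric; have := metric_triangle x (cinj u) (cinj m); lra.
have w0 : 0 <= 1 + a + b by rewrite !addr_ge0.
set W := 1 + a + b; have W1 : 1 <= W by rewrite /W -addrA lerDl addr_ge0.
have dd : d ^+ 2 <= d * W by rewrite expr2 ler_wpM2l ?(ltW d0)// (le_trans d1).
have sq (v c : R) : 0 <= v -> 0 <= c -> c <= W -> v <= c + 2 * d ->
    v ^+ 2 <= c ^+ 2 + 8 * (d * W).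
  move=> v0 c0 cW vc; apply: (le_trans (_ : _ <= (c + 2 * d) ^+ 2)).
    by rewrite ler_sqr ?nnegrE// (le_trans v0).
  have : d * c <= d * W by rewrite ler_wpM2l// ltW.
  move: dd; clear; lra.
have D2 : D ^+ 2 - 4 * (d * W) <= mdist y y' ^+ 2.
  have D'0 := mdist_ge0 y y'; have [DD'|D'D] := lerP D (mdist y y').
    have : 0 <= d * W by rewrite mulr_ge0 ?(ltW d0)// (le_trans ler01).
    have : D ^+ 2 <= mdist y y' ^+ 2 by rewrite ler_sqr ?nnegrE// mdist_ge0.
    lra.
  have : (D - mdist y y') * (D + mdist y y') <= 2 * d * (2 * W).
    apply: ler_pM; [|rewrite addr_ge0 ?mdist_ge0//| |]; rewrite /W; lra.
  lra.
have um2 : mdist u m ^+ 2 <= stewart_bound z z' s x + 9 * (d * W).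
  apply: (le_trans (mP u)); rewrite /stewart_bound -/a -/b -/D.
  have h1 : mdist u y ^+ 2 <= a ^+ 2 + 8 * (d * W).
    by apply: sq; rewrite ?mdist_ge0// /W; lra.
  have h2 : mdist u y' ^+ 2 <= b ^+ 2 + 8 * (d * W).
    by apply: sq; rewrite ?mdist_ge0// /W; lra.
  have k1 : (1 - s) * mdist u y ^+ 2 <= (1 - s) * (a ^+ 2 + 8 * (d * W)).
    by rewrite ler_wpM2l// subr_ge0.
  have k2 : s * mdist u y' ^+ 2 <= s * (b ^+ 2 + 8 * (d * W)) by rewrite ler_wpM2l.
  have k3 : s * (1 - s) * (D ^+ 2 - 4 * (d * W)) <= s * (1 - s) * mdist y y' ^+ 2.
    by rewrite ler_wpM2l// mulr_ge0// subr_ge0.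
  have k4 : 0 <= (1 - 4 * (s * (1 - s))) * (d * W).
    rewrite mulr_ge0//; last by rewrite mulr_ge0 ?(ltW d0)// (le_trans ler01).
    by have := sqr_ge0 (1 - 2 * s); clear; lra.
  by move: k1 k2 k3 k4; clear; lra.
apply: (le_trans (_ : _ <= (mdist u m + d) ^+ 2)).
  by rewrite ler_sqr ?nnegrE ?addr_ge0 ?mdist_ge0// ltW.
have k1 : d * mdist u m <= d * (4 * W) by rewrite ler_wpM2l// ltW.
have k2 : d * 18 * W <= e * W by rewrite ler_wpM2r// (le_trans ler01).
by move: um2 k1 k2 dd; clear; lra.
Qed.

End Completion.

(* "Canonically defined": one assignment S, independent of kappa and natural
   for isometries. The case X' = X of the fourth clause says that an isometry
   of X determines isometries of Y and H; by uniqueness the assignment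
   phi |-> g respects composition and identities. *)
Theorem theorem1p1 (R : realType) :
  exists S : forall X : metricType R, hilbert_product_map X,
  forall (kappa : R) (X : metricType R), cat_space kappa X ->
  [/\ geodesic_space (Yfactor (S X)),
      (forall x x' : X,
         prod_dist (embed (S X) x) (embed (S X) x') = mdist x x'),
      (forall f : X -> R^o, is_affine f ->
         exists fhat : Hfactor (S X) -> R^o,
           is_affine fhat /\ forall x, f x = fhat (embed (S X) x).2),
      (forall (X' : metricType R) (phi : X -> X'), is_isometry phi ->
         exists! g, induces (S X) (S X') phi g)
    & (cat_space 0 X ->
         exists (Z : metricType R) (j : Yfactor (S X) -> Z),
           is_completion j /\ cat_space 0 Z)].
Proof.
exists (@canonical_map R) => kappa X catX.
have [_ geo _] := catX.
split.
- exact: vquot_geodesic.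
- move=> x x'; rewrite /prod_dist /= mdist_vproj_emb sqrtr_sqr.
  by rewrite ger0_norm ?mdist_ge0.
- move=> f; apply: affine_factor; split => //; exact: cat_almost_flat catX.
- move=> X' phi iphi; have [g gP] := induced_exists iphi.
  by exists g; split => // g'; exact: induced_unique.
- move=> cat0; exists (completion (vquot X)), (@cinj R (vquot X)).
  split; first exact: cinj_completion.
  apply: cn_cat; first exact: completion_complete.
  apply: complete_almost_cn; first exact: completion_complete.
  by apply: completion_almost_cn; exact: cat_vquot_cn.
Qed.
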